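(* There is a monomorphism of simplicial sets $\beta:N_s(\mathsf{Cat})\hookrightarrow N_\Delta(N_2\mathsf{Cat})$ from the skew nerve of $\mathsf{Cat}$ to the homotopy coherent nerve of $N_2(\mathsf{Cat})$.
   Context: Conventions. All categories are small, $I$ is the terminal category. The product of categories (and functors) is treated as strictly associative and unital: $(A\times B)\times C=A\times(B\times C)$, $A\times I=A=I\times A$ (one replaces the monoidal 2-category $\mathsf{Cat}$ by an equivalent strict one). $\circ$ denotes composition of functors and horizontal composition of natural transformations, $\bullet$ vertical composition. Skew nerve $N_s(\mathsf{Cat})$: the simplicial set with a unique $0$-simplex $*$; $1$-simplices are categories $B_{01}$; $2$-simplices are functors $B_{012}:B_{01}\times B_{12}\to B_{02}$; $3$-simplices are natural transformations $B_{0123}:B_{013}\circ(1\times B_{123})\Rightarrow B_{023}\circ(B_{012}\times1)$ of functors $B_{01}\times B_{12}\times B_{23}\to B_{03}$ (with faces given by the subscripts); a $4$-simplex is a quintuple of such transformations $B_{1234},B_{0234},B_{0134},B_{0124},B_{0123}$ with compatible faces such that the pentagon commutes: $$(1\circ(B_{0123}\times1))\bullet(B_{0134}\circ1)\bullet(1\circ(1\times B_{1234}))=(B_{0234}\circ1)\bullet(B_{0124}\circ1)$$ as transformations $B_{014}\circ(1\times B_{124})\circ(1\times1\times B_{234})\Rightarrow B_{034}\circ(B_{023}\times1)\circ(B_{012}\times1\times1)$, where on the right one uses the equality $B_{024}\circ(B_{012}\times1)\circ(1\times1\times B_{234})=B_{024}\circ(1\times B_{234})\circ(B_{012}\times1\times1)$.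 Higher simplices are determined by $4$-coskeletality. Degeneracies insert identities: $s_0( * )=I$, degeneracies of a category $B$ are $1_B$ viewed as $I\times B\to B$ and $B\times I\to B$, degeneracies of a $2$-simplex are identity transformations. Homotopy coherent nerve. $S[n]$ is the simplicially enriched category with objects $0,\dots,n$; for $p\le q$, $S[n](p,q)$ is the nerve of the poset of subsets of $\{p,\dots,q\}$ containing $p$ and $q$ (and $S[n](p,q)=\emptyset$ for $q<p$). A $k$-simplex is written as a chain $C_0\subseteq\dots\subseteq C_k$; orientation: an inclusion $C_0\subseteq C_1$ is an arrow from $C_1$ to $C_0$, so $d_i$ deletes $C_{k-i}$. Composition is union, identities are $\{p\}$. For a simplicially enriched category $U$, $N_\Delta(U)_n$ is the set of simplicially enriched functors $S[n]\to U$; an order-preserving map $[m]\to[n]$ induces $S[m]\to S[n]$ by direct image of subsets, and acts on $N_\Delta(U)$ by precomposition. $N_2(\mathsf{Cat})$ is the simplicially enriched category with one object $*$ whose mapping simplicial set has: $0$-simplices categories; $1$-simplices functors $T$ ($d_1T$ the domain, $d_0T$ the codomain); $2$-simplices natural transformations $\eta:T_{12}\circ T_{01}\Rightarrow T_{02}$ ($d_0\eta=T_{12}$, $d_1\eta=T_{02}$, $d_2\eta=T_{01}$); $3$-simplices families $\eta_{ijk}:T_{jk}\circ T_{ij}\Rightarrow T_{ik}$ ($0\le i<j<k\le3$) with $\eta_{013}\bullet(\eta_{123}\circ1)=\eta_{023}\bullet(1\circ\eta_{012})$; higher simplices by $3$-coskeletality; degeneracies insert identities. Composition is given by $\times$,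 with identity $I$. $N_\Delta(N_2\mathsf{Cat})$ is its homotopy coherent nerve. *)

(* Defs.v *)
From mathcomp Require Import all_boot.
From mathcomp Require Import boolp.

Set Implicit Arguments.
Unset Strict Implicit.
Unset Printing Implicit Defensive.

#[local] Obligation Tactic := idtac.

Record category := Category {
  ob :> Type;
  hom : ob -> ob -> Type;
  idc : forall x, hom x x;
  compc : forall x y z, hom y z -> hom x y -> hom x z;
  compcA : forall x y z t (h : hom z t) (g : hom y z) (f : hom x y),
    compc h (compc g f) = compc (compc h g) f;
  compIc : forall x y (f : hom x y), compc (idc y) f = f;
  compcI : forall x y (f : hom x y), compc f (idc x) = f }.

Record functor (C D : category) := Functor {
  fob :> C -> D;
  fhom : forall x y, hom x y -> hom (fob x) (fob y);
  fhom_id : forall x, fhom (idc x) = idc (fob x);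
  fhom_comp : forall x y z (g : hom y z) (f : hom x y),
    fhom (compc g f) = compc (fhom g) (fhom f) }.

Record natTrans (C D : category) (F G : functor C D) := NatTrans {
  component :> forall x, hom (F x) (G x);
  naturality : forall x y (f : hom x y),
    compc (component y) (fhom F f) = compc (fhom G f) (component x) }.

Program Definition functor_id (C : category) : functor C C :=
  @Functor C C id (fun _ _ f => f) _ _.
Next Obligation. by []. Qed.
Next Obligation. by []. Qed.

Program Definition functor_comp (A B C : category)
    (G : functor B C) (F : functor A B) : functor A C :=
  @Functor A C (fun x => G (F x)) (fun _ _ f => fhom G (fhom F f)) _ _.
Next Obligation. by move=> * /=; rewrite !fhom_id. Qed.
Next Obligation. by move=> * /=; rewrite !fhom_comp. Qed.

Program Definition nat_id (C D : category) (F : functor C D) : natTrans F F :=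
  @NatTrans C D F F (fun x => idc (F x)) _.
Next Obligation. by move=> * /=; rewrite compIc compcI. Qed.

Program Definition nat_vcomp (C D : category) (F G H : functor C D)
    (b : natTrans G H) (a : natTrans F G) : natTrans F H :=
  @NatTrans C D F H (fun x => compc (b x) (a x)) _.
Next Obligation.
by move=> * /=; rewrite -compcA naturality compcA naturality compcA.
Qed.

Program Definition nat_hcomp (A B C : category) (F G : functor A B)
    (H K : functor B C) (b : natTrans H K) (a : natTrans F G) :
    natTrans (functor_comp H F) (functor_comp K G) :=
  @NatTrans A C _ _ (fun x => compc (fhom K (a x)) (b (F x))) _.
Next Obligation.
move=> A B C F G H K b a x y f /=.
by rewrite -compcA naturality !compcA -!fhom_comp naturality.
Qed.

Program Definition terminal_category : category :=
  @Category unit (fun _ _ => unit) (fun _ => tt) (fun _ _ _ _ _ => tt) _ _ _.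
Next Obligation. by []. Qed.
Next Obligation. by move=> ? ? []. Qed.
Next Obligation. by move=> ? ? []. Qed.

Program Definition product_category (C D : category) : category :=
  @Category (C * D)%type (fun x y => (hom x.1 y.1 * hom x.2 y.2)%type)
    (fun x => (idc x.1, idc x.2))
    (fun _ _ _ g f => (compc g.1 f.1, compc g.2 f.2)) _ _ _.
Next Obligation. by move=> *; rewrite /= !compcA. Qed.
Next Obligation. by move=> C D x y [f g]; rewrite /= !compIc. Qed.
Next Obligation. by move=> C D x y [f g]; rewrite /= !compcI. Qed.

Program Definition proj1_functor (C D : category) :
    functor (product_category C D) C :=
  @Functor (product_category C D) C fst (fun _ _ f => f.1) _ _.
Next Obligation. by []. Qed.
Next Obligation. by []. Qed.

Program Definition proj2_functor (C D : category) :
    functor (product_category C D) D :=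
  @Functor (product_category C D) D snd (fun _ _ f => f.2) _ _.
Next Obligation. by []. Qed.
Next Obligation. by []. Qed.

Program Definition pair_functor (A C D : category)
    (F : functor A C) (G : functor A D) : functor A (product_category C D) :=
  @Functor A (product_category C D) (fun x => (F x, G x))
    (fun _ _ f => (fhom F f, fhom G f)) _ _.
Next Obligation. by move=> * /=; rewrite !fhom_id. Qed.
Next Obligation. by move=> * /=; rewrite !fhom_comp. Qed.

Program Definition terminal_functor (C : category) :
    functor C terminal_category :=
  @Functor C terminal_category (fun _ => tt) (fun _ _ _ => tt) _ _.
Next Obligation. by []. Qed.
Next Obligation. by []. Qed.

(** Cat is replaced by the equivalent strict monoidal 2-category whose objects
    are finite sequences of categories: [:: A1; ...; An] stands for the category
    A1 x (... x (An x I)), the product is concatenation and the unit object I is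
    the empty sequence.  Functors and natural transformations between two
    sequences are the functors and natural transformations between the
    categories they stand for. *)
Fixpoint cat_of (s : seq category) : category :=
  if s is A :: s' then product_category A (cat_of s') else terminal_category.

Fixpoint joinF (s t : seq category) :
    functor (product_category (cat_of s) (cat_of t)) (cat_of (s ++ t)) :=
  match s with
  | [::] => proj2_functor (cat_of [::]) (cat_of t)
  | A :: s' =>
    let P1 := proj1_functor (cat_of (A :: s')) (cat_of t) in
    let P2 := proj2_functor (cat_of (A :: s')) (cat_of t) in
    pair_functor (functor_comp (proj1_functor A (cat_of s')) P1)
      (functor_comp (joinF s' t)
        (pair_functor (functor_comp (proj2_functor A (cat_of s')) P1) P2))
  end.

Fixpoint leftF (s t : seq category) : functor (cat_of (s ++ t)) (cat_of s) :=
  match s with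
  | [::] => terminal_functor (cat_of t)
  | A :: s' =>
    pair_functor (proj1_functor A (cat_of (s' ++ t)))
      (functor_comp (leftF s' t) (proj2_functor A (cat_of (s' ++ t))))
  end.

Fixpoint rightF (s t : seq category) : functor (cat_of (s ++ t)) (cat_of t) :=
  match s with
  | [::] => functor_id (cat_of t)
  | A :: s' => functor_comp (rightF s' t) (proj2_functor A (cat_of (s' ++ t)))
  end.

Definition functor_prod (s t s' t' : seq category)
    (F : functor (cat_of s) (cat_of s')) (G : functor (cat_of t) (cat_of t')) :
    functor (cat_of (s ++ t)) (cat_of (s' ++ t')) :=
  functor_comp (joinF s' t')
    (pair_functor (functor_comp F (leftF s t)) (functor_comp G (rightF s t))).

Program Definition nat_pair (A C D : category) (F F' : functor A C)
    (G G' : functor A D) (a : natTrans F F') (b : natTrans G G') :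
    natTrans (pair_functor F G) (pair_functor F' G') :=
  @NatTrans A (product_category C D) _ _ (fun x => (a x, b x)) _.
Next Obligation. by move=> * /=; rewrite !naturality. Qed.

Definition nat_prod (s t s' t' : seq category)
    (F F' : functor (cat_of s) (cat_of s')) (a : natTrans F F')
    (G G' : functor (cat_of t) (cat_of t')) (b : natTrans G G') :
    natTrans (functor_prod F G) (functor_prod F' G') :=
  nat_hcomp (nat_id (joinF s' t'))
    (nat_pair (nat_hcomp a (nat_id (leftF s t)))
              (nat_hcomp b (nat_id (rightF s t)))).

(** 1-cells and 2-cells are bundled with their sources and targets, so that the
    equations of the strict structure are plain equalities. *)
Record cell1 := Cell1 {
  dom1 : seq category;
  cod1 : seq category;
  functor_of :> functor (cat_of dom1) (cat_of cod1) }.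

Record cell2 := Cell2 {
  src : cell1;
  tgt_functor : functor (cat_of (dom1 src)) (cat_of (cod1 src));
  nat_of :> natTrans (functor_of src) tgt_functor }.

Definition tgt (a : cell2) : cell1 := Cell1 (tgt_functor a).

Definition id1 (A : seq category) : cell1 := Cell1 (functor_id (cat_of A)).

Definition id2 (F : cell1) : cell2 := Cell2 (nat_id (functor_of F)).

(** The compositions below are total functions; they return a dummy value on
    cells which are not composable. *)
Definition comp1 (G F : cell1) : cell1 :=
  match pselect (cod1 F = dom1 G) with
  | left e =>
    eq_rect (cod1 F)
      (fun B => forall C, functor (cat_of B) (cat_of C) -> cell1)
      (fun _ G' => Cell1 (functor_comp G' (functor_of F)))
      (dom1 G) e _ (functor_of G)
  | right _ => F
  end.

Definition vcomp (b a : cell2) : cell2 :=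
  match pselect (tgt a = src b) with
  | left e =>
    eq_rect (tgt a)
      (fun G => forall H : functor (cat_of (dom1 G)) (cat_of (cod1 G)),
         natTrans (functor_of G) H -> cell2)
      (fun _ b' => @Cell2 (src a) _ (nat_vcomp b' (nat_of a)))
      (src b) e _ (nat_of b)
  | right _ => a
  end.

Definition hcomp (b a : cell2) : cell2 :=
  match pselect (cod1 (src a) = dom1 (src b)) with
  | left e =>
    eq_rect (cod1 (src a))
      (fun B => forall C (H K : functor (cat_of B) (cat_of C)),
         natTrans H K -> cell2)
      (fun _ H K b' =>
         @Cell2 (Cell1 (functor_comp H (functor_of (src a)))) _
           (nat_hcomp b' (nat_of a)))
      (dom1 (src b)) e _ _ _ (nat_of b)
  | right _ => a
  end.

Definition prod1 (F G : cell1) : cell1 :=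
  Cell1 (functor_prod (functor_of F) (functor_of G)).

Definition prod2 (a b : cell2) : cell2 :=
  @Cell2 (prod1 (src a) (src b)) _ (nat_prod (nat_of a) (nat_of b)).

Lemma comp1E (A B C : seq category) (G : functor (cat_of B) (cat_of C))
    (F : functor (cat_of A) (cat_of B)) :
  comp1 (Cell1 G) (Cell1 F) = Cell1 (functor_comp G F).
Proof.
rewrite /comp1 /=; case: pselect => [e|//].
by rewrite (Prop_irrelevance e erefl).
Qed.

Lemma vcompE (A B : seq category) (F G H : functor (cat_of A) (cat_of B))
    (b : natTrans G H) (a : natTrans F G) :
  vcomp (@Cell2 (Cell1 G) H b) (@Cell2 (Cell1 F) G a) =
  @Cell2 (Cell1 F) H (nat_vcomp b a).
Proof.
rewrite /vcomp /= /tgt /=; case: pselect => [e|//].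
by rewrite (Prop_irrelevance e erefl).
Qed.

Lemma hcompE (A B C : seq category) (F G : functor (cat_of A) (cat_of B))
    (H K : functor (cat_of B) (cat_of C))
    (b : natTrans H K) (a : natTrans F G) :
  hcomp (@Cell2 (Cell1 H) K b) (@Cell2 (Cell1 F) G a) =
  @Cell2 (Cell1 (functor_comp H F)) (functor_comp K G) (nat_hcomp b a).
Proof.
rewrite /hcomp /=; case: pselect => [e|//].
by rewrite (Prop_irrelevance e erefl).
Qed.

Lemma existT_inj (T : Type) (P : T -> Type) (x : T) (p q : P x) :
  existT P x p = existT P x q -> p = q.
Proof.
move=> e; have := projT2_eq e.
by rewrite (Prop_irrelevance (projT1_eq e) erefl).
Qed.

Record arrow (C : category) := Arrow {
  arrow_src : C;
  arrow_tgt : C;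
  arrow_hom : hom arrow_src arrow_tgt }.

Lemma Arrow_inj (C : category) (x y : C) (f g : hom x y) :
  Arrow f = Arrow g -> f = g.
Proof.
move=> e; pose T := {x : C & {y : C & hom x y}}.
pose phi (a : arrow C) : T := existT _ _ (existT _ _ (arrow_hom a)).
exact: existT_inj (existT_inj (congr1 phi e)).
Qed.

Lemma functor_eq (C D : category) (F G : functor C D) :
  (forall x y (f : hom x y), Arrow (fhom F f) = Arrow (fhom G f)) -> F = G.
Proof.
case: F G => [F0 F1 F1i F1c] [G0 G1 G1i G1c] /= E.
have E0 : F0 = G0 by apply: funext => x; case: (E x x (idc x)).
move: G1 G1i G1c E; rewrite -{}E0 => G1 G1i G1c E.
have E1 : F1 = G1.
  apply: functional_extensionality_dep => x.
  apply: functional_extensionality_dep => y; apply: funext => f.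
  exact: Arrow_inj (E x y f).
by subst G1; congr Functor; apply: Prop_irrelevance.
Qed.

Lemma functor_compA (A B C D : category) (H : functor C D) (G : functor B C)
    (F : functor A B) :
  functor_comp H (functor_comp G F) = functor_comp (functor_comp H G) F.
Proof. exact: functor_eq. Qed.

Lemma functor_compI (A B : category) (F : functor A B) :
  functor_comp F (functor_id A) = F.
Proof. exact: functor_eq. Qed.

Lemma functor_compIl (A B : category) (F : functor A B) :
  functor_comp (functor_id B) F = F.
Proof. exact: functor_eq. Qed.

Lemma natTrans_eq (C D : category) (F G : functor C D) (a b : natTrans F G) :
  (forall x, a x = b x) -> a = b.
Proof.
case: a b => [a0 a1] [b0 b1] /= E.
have E0 : a0 = b0 by apply: functional_extensionality_dep.
by subst b0; congr NatTrans; apply: Prop_irrelevance.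
Qed.

Record tarrow := TArrow { ta_seq : seq category; ta_arrow : arrow (cat_of ta_seq) }.
Record tobj := TObj { to_seq : seq category; to_obj : cat_of to_seq }.

Lemma TArrow_inj (s : seq category) (f g : arrow (cat_of s)) :
  TArrow f = TArrow g -> f = g.
Proof.
move=> e; pose phi a := existT (fun s => arrow (cat_of s)) _ (ta_arrow a).
exact: existT_inj (congr1 phi e).
Qed.

Lemma TObj_inj (s : seq category) (x y : cat_of s) : TObj x = TObj y -> x = y.
Proof.
move=> e; pose phi a := existT (fun s => cat_of s : Type) _ (to_obj a).
exact: existT_inj (congr1 phi e).
Qed.

Definition map_arrow (C D : category) (F : functor C D) (f : arrow C) :=
  Arrow (fhom F (arrow_hom f)).

Definition graph1 (F : cell1) (u v : tarrow) : Prop :=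
  exists f : arrow (cat_of (dom1 F)),
    u = TArrow f /\ v = TArrow (map_arrow (functor_of F) f).

Lemma cell1_eq (F G : cell1) : dom1 F = dom1 G -> cod1 F = cod1 G ->
  (forall f g, graph1 F f g -> graph1 G f g) -> F = G.
Proof.
case: F G => [A B F] [A' B' G] /= eA eB; subst A' B' => E.
congr Cell1; apply: functor_eq => x y f.
have [|g [/TArrow_inj <- /TArrow_inj //]] :=
  E (TArrow (Arrow f)) (TArrow (map_arrow F (Arrow f))).
by exists (Arrow f).
Qed.

Lemma Cell1_inj (A B : seq category) (F G : functor (cat_of A) (cat_of B)) :
  Cell1 F = Cell1 G -> F = G.
Proof.
move=> e; pose phi F := existT (fun A => {B & functor (cat_of A) (cat_of B)}) _
  (existT _ _ (functor_of F)).
exact: existT_inj (existT_inj (congr1 phi e)).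
Qed.

Definition graph2 (a : cell2) (u : tobj) (v : tarrow) : Prop :=
  exists x : cat_of (dom1 (src a)),
    u = TObj x /\ v = TArrow (Arrow (nat_of a x)).

Lemma cell2_eq (a b : cell2) : src a = src b -> tgt a = tgt b ->
  (forall x f, graph2 a x f -> graph2 b x f) -> a = b.
Proof.
case: a b => [[A B F] G a] [[A' B' F'] G' b] /= eF.
have eA := congr1 dom1 eF; have eB := congr1 cod1 eF.
rewrite /= in eA eB; subst A' B'.
have {}eF : F = F' := Cell1_inj eF; subst F' => eG.
have {}eG : G = G' := Cell1_inj eG; subst G' => E; congr Cell2; apply: natTrans_eq => x.
have [|y [/TObj_inj <- /TArrow_inj]] :=
  E (TObj x) (TArrow (Arrow (a x))); first by exists x.
exact: Arrow_inj.
Qed.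

Definition tprod_obj (x y : tobj) : tobj :=
  TObj (joinF (to_seq x) (to_seq y) (to_obj x, to_obj y)).

Definition prod_arrow (C D : category) (f : arrow C) (g : arrow D) :
    arrow (product_category C D) :=
  @Arrow (product_category C D) (arrow_src f, arrow_src g)
    (arrow_tgt f, arrow_tgt g) (arrow_hom f, arrow_hom g).

Definition join_arrow (s t : seq category) (f : arrow (cat_of s))
    (g : arrow (cat_of t)) : arrow (cat_of (s ++ t)) :=
  map_arrow (joinF s t) (prod_arrow f g).

Definition tprod_arrow (f g : tarrow) : tarrow :=
  TArrow (join_arrow (ta_arrow f) (ta_arrow g)).

Lemma tprod_objA x y z :
  tprod_obj (tprod_obj x y) z = tprod_obj x (tprod_obj y z).
Proof.
case: x => s x; elim: s x => [|A s IH] // [a x].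
pose c (u : tobj) : tobj := @TObj (A :: to_seq u) (a, to_obj u).
by have := congr1 c (IH x).
Qed.

Lemma tprod_arrowA f g h :
  tprod_arrow (tprod_arrow f g) h = tprod_arrow f (tprod_arrow g h).
Proof.
case: f => s f; elim: s f => [|A s IH] // [[a x] [a' x'] [k f]].
pose c (u : tarrow) : tarrow :=
  @TArrow (A :: ta_seq u) (prod_arrow (Arrow k) (ta_arrow u)).
by have := congr1 c (IH (Arrow f)).
Qed.

Lemma tprod_obj0 x : tprod_obj x (@TObj [::] tt) = x.
Proof.
case: x => s x; elim: s x => [|A s IH]; first by case.
case=> a x; pose c (u : tobj) : tobj := @TObj (A :: to_seq u) (a, to_obj u).
by have := congr1 c (IH x).
Qed.

Definition tt_arrow : arrow (cat_of [::]) :=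
  @Arrow terminal_category tt tt tt.

Lemma tprod_arrow0 f : tprod_arrow f (TArrow tt_arrow) = f.
Proof.
case: f => s f; elim: s f => [|A s IH]; first by case=> [] [] [] [].
move=> [[a x] [a' x'] [k f]].
pose c (u : tarrow) : tarrow :=
  @TArrow (A :: ta_seq u) (prod_arrow (Arrow k) (ta_arrow u)).
by have := congr1 c (IH (Arrow f)).
Qed.

Lemma split_arrow (s t : seq category) (f : arrow (cat_of (s ++ t))) :
  f = join_arrow (map_arrow (leftF s t) f) (map_arrow (rightF s t) f).
Proof.
elim: s f => [|A s IH] /=; first by case.
move=> [[a x] [a' x'] [k f]].
pose c (u : arrow (cat_of (s ++ t))) : arrow (cat_of (A :: s ++ t)) :=
  prod_arrow (Arrow k) u.
by have := congr1 c (IH (Arrow f)).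
Qed.

Lemma left_join_arrow (s t : seq category) (f : arrow (cat_of s))
  (g : arrow (cat_of t)) : map_arrow (leftF s t) (join_arrow f g) = f.
Proof.
elim: s f => [|A s IH]; first by case=> [] [] [] [].
move=> [[a x] [a' x'] [k f]].
by have := congr1 (prod_arrow (Arrow k)) (IH (Arrow f)).
Qed.

Lemma right_join_arrow (s t : seq category) (f : arrow (cat_of s))
  (g : arrow (cat_of t)) : map_arrow (rightF s t) (join_arrow f g) = g.
Proof.
elim: s f => [|A s IH]; first by case: g.
move=> [[a x] [a' x'] [k f]]; exact: IH (Arrow f).
Qed.

Lemma split_obj (s t : seq category) (x : cat_of (s ++ t)) :
  x = joinF s t (leftF s t x, rightF s t x).
Proof.
elim: s x => [|A s IH] //= [a x].
by have := congr1 (pair a) (IH x).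
Qed.

Lemma left_join_obj (s t : seq category) (x : cat_of s) (y : cat_of t) :
  leftF s t (joinF s t (x, y)) = x.
Proof. elim: s x => [[]//|A s IH] [a x]; by have := congr1 (pair a) (IH x). Qed.

Lemma right_join_obj (s t : seq category) (x : cat_of s) (y : cat_of t) :
  rightF s t (joinF s t (x, y)) = y.
Proof. elim: s x => [[]//|A s IH] [a x]; exact: IH x. Qed.

Lemma graph1_prod (F G : cell1) u v : graph1 (prod1 F G) u v <->
  exists u1 u2 v1 v2, [/\ u = tprod_arrow u1 u2, v = tprod_arrow v1 v2,
    graph1 F u1 v1 & graph1 G u2 v2].
Proof.
split.
- case=> f [-> ->].
  exists (TArrow (map_arrow (leftF (dom1 F) (dom1 G)) f)).
  exists (TArrow (map_arrow (rightF (dom1 F) (dom1 G)) f)).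
  eexists; eexists; split; last 2 first.
  + by eexists; split; first reflexivity.
  + by eexists; split; first reflexivity.
  + by rewrite /tprod_arrow /= -split_arrow.
  + by [].
- case=> _ [] _ [] _ [] _ [-> -> [f [-> ->]] [g [-> ->]]].
  exists (join_arrow f g); split=> //.
  by rewrite -{1}[f](left_join_arrow f g) -{2}[g](right_join_arrow f g).
Qed.

Lemma nat_prodE (s t s' t' : seq category)
    (F F' : functor (cat_of s) (cat_of s')) (a : natTrans F F')
    (G G' : functor (cat_of t) (cat_of t')) (b : natTrans G G') x :
  Arrow (nat_prod a b x) =
  join_arrow (Arrow (a (leftF s t x))) (Arrow (b (rightF s t x))).
Proof. by rewrite /= !fhom_id compcI !compIc. Qed.

Lemma graph2_prod (a b : cell2) u v : graph2 (prod2 a b) u v <->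
  exists u1 u2 v1 v2, [/\ u = tprod_obj u1 u2, v = tprod_arrow v1 v2,
    graph2 a u1 v1 & graph2 b u2 v2].
Proof.
split.
- case=> x [-> ->].
  exists (TObj (leftF (dom1 (src a)) (dom1 (src b)) x)).
  exists (TObj (rightF (dom1 (src a)) (dom1 (src b)) x)).
  eexists; eexists; split; last 2 first.
  + by eexists; split; first reflexivity.
  + by eexists; split; first reflexivity.
  + by rewrite /tprod_obj /= -split_obj.
  + exact: (f_equal (@TArrow _) (nat_prodE _ _ _)).
- case=> _ [] _ [] _ [] _ [-> -> [x [-> ->]] [y [-> ->]]].
  exists (joinF _ _ (x, y)); split=> //.
  apply: esym; apply: etrans (f_equal (@TArrow _) (nat_prodE _ _ _)) _.
  by rewrite left_join_obj right_join_obj.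
Qed.

Lemma prod1A F G H : prod1 (prod1 F G) H = prod1 F (prod1 G H).
Proof.
apply: cell1_eq; rewrite /= ?catA // => u v /graph1_prod.
move=> [_ [u3 [_ [v3 [-> -> /graph1_prod [u1 [u2 [v1 [v2 [-> -> h1 h2]]]]] h3]]]]].
rewrite !tprod_arrowA; apply/graph1_prod.
do 4!eexists; split; [reflexivity|reflexivity|exact: h1|].
by apply/graph1_prod; do 4!eexists; split; [reflexivity|reflexivity| |].
Qed.

Lemma prod1I F : prod1 F (id1 [::]) = F.
Proof.
apply: cell1_eq; rewrite /= ?cats0 // => u v /graph1_prod.
move=> [u1 [_ [v1 [_ [-> -> h1 [f [-> ->]]]]]]].
by move: f => /= [[] [] []]; rewrite !tprod_arrow0.
Qed.

Lemma functor_prodIl (s t : seq category) (F : functor (cat_of s) (cat_of t)) :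
  functor_prod (functor_id (cat_of [::])) F = F.
Proof. exact: functor_eq. Qed.

Lemma prodI1 F : prod1 (id1 [::]) F = F.
Proof. by case: F => A B F; rewrite /prod1 /= functor_prodIl. Qed.

Lemma prod1_id A B : prod1 (id1 A) (id1 B) = id1 (A ++ B).
Proof.
apply: cell1_eq => // u v /graph1_prod.
move=> [_ [_ [_ [_ [-> -> [f [-> ->]] [g [-> ->]]]]]]].
by exists (join_arrow f g).
Qed.

Lemma prod1_comp F F' G G' : cod1 F = dom1 G -> cod1 F' = dom1 G' ->
  prod1 (comp1 G F) (comp1 G' F') = comp1 (prod1 G G') (prod1 F F').
Proof.
case: F F' G G' => [A B F] [A' B' F'] [B0 C G] [B0' C' G'] /= eB eB'.
subst B0 B0'; rewrite !comp1E /prod1 /=; congr Cell1.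
apply: functor_eq => x y f.
pose f1 := Arrow (fhom F (fhom (leftF A A') f)).
pose f2 := Arrow (fhom F' (fhom (rightF A A') f)).
transitivity (join_arrow (map_arrow G f1) (map_arrow G' f2)); first by [].
transitivity (join_arrow (map_arrow G (map_arrow (leftF B B') (join_arrow f1 f2)))
  (map_arrow G' (map_arrow (rightF B B') (join_arrow f1 f2)))); last by [].
by rewrite left_join_arrow right_join_arrow.
Qed.

Lemma dom1_comp F G : cod1 F = dom1 G -> dom1 (comp1 G F) = dom1 F.
Proof. by case: F G => [A B F] [B0 C G] /= e; subst B0; rewrite comp1E. Qed.

Lemma cod1_comp F G : cod1 F = dom1 G -> cod1 (comp1 G F) = cod1 G.
Proof. by case: F G => [A B F] [B0 C G] /= e; subst B0; rewrite comp1E. Qed.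

Lemma comp1I F A : dom1 F = A -> comp1 F (id1 A) = F.
Proof. by move=> <-; case: F => * /=; rewrite comp1E functor_compI. Qed.

Lemma comp1Il F A : cod1 F = A -> comp1 (id1 A) F = F.
Proof. by move=> <-; case: F => * /=; rewrite comp1E functor_compIl. Qed.

Lemma comp1A F G H : cod1 F = dom1 G -> cod1 G = dom1 H ->
  comp1 H (comp1 G F) = comp1 (comp1 H G) F.
Proof.
case: F G H => [A B F] [B0 C G] [C0 D H] /= eB eC; subst B0 C0.
by rewrite !comp1E functor_compA.
Qed.

Lemma src_vcomp a b : tgt a = src b -> src (vcomp b a) = src a.
Proof.
by case: b => G H b /= e; subst G; case: a H b => [[A B F] G a] H b; rewrite vcompE.
Qed.

Lemma tgt_vcomp a b : tgt a = src b -> tgt (vcomp b a) = tgt b.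
Proof.
by case: b => G H b /= e; subst G; case: a H b => [[A B F] G a] H b; rewrite vcompE.
Qed.

Lemma hcomp_ind (P : cell2 -> cell2 -> Prop) :
  (forall A B C (F G : functor (cat_of A) (cat_of B))
     (H K : functor (cat_of B) (cat_of C)) (b : natTrans H K) (a : natTrans F G),
     P (@Cell2 (Cell1 H) K b) (@Cell2 (Cell1 F) G a)) ->
  forall b a, cod1 (src a) = dom1 (src b) -> P b a.
Proof.
move=> h [[B0 C H] K b] [[A B F] G a] /= e; subst B0; exact: h.
Qed.

Lemma vcomp_ind (P : cell2 -> cell2 -> Prop) :
  (forall A B (F G H : functor (cat_of A) (cat_of B))
     (b : natTrans G H) (a : natTrans F G),
     P (@Cell2 (Cell1 G) H b) (@Cell2 (Cell1 F) G a)) ->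
  forall b a, tgt a = src b -> P b a.
Proof.
move=> h [G0 H b] a /= e; subst G0; case: a H b => [[A B F] G a] H b; exact: h.
Qed.

Lemma src_hcomp a b : cod1 (src a) = dom1 (src b) ->
  src (hcomp b a) = comp1 (src b) (src a).
Proof. by move: b a; apply: hcomp_ind => *; rewrite hcompE comp1E. Qed.

Lemma tgt_hcomp a b : cod1 (src a) = dom1 (src b) ->
  tgt (hcomp b a) = comp1 (tgt b) (tgt a).
Proof. by move: b a; apply: hcomp_ind => *; rewrite hcompE comp1E. Qed.

Lemma tgt_id2 F : tgt (id2 F) = F.
Proof. by case: F. Qed.

Lemma vcompI a F : src a = F -> vcomp a (id2 F) = a.
Proof.
move=> <-; case: a => [[A B F'] G a]; rewrite /id2 /= vcompE; congr Cell2.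
by apply: natTrans_eq => x /=; rewrite compcI.
Qed.

Lemma vcompIl a F : tgt a = F -> vcomp (id2 F) a = a.
Proof.
move=> <-; case: a => [[A B F'] G a]; rewrite /id2 /= vcompE; congr Cell2.
by apply: natTrans_eq => x /=; rewrite compIc.
Qed.

Lemma hcomp_id2 F G : cod1 F = dom1 G ->
  hcomp (id2 G) (id2 F) = id2 (comp1 G F).
Proof.
case: F G => [A B F] [B0 C G] /= e; subst B0; rewrite comp1E /id2 hcompE /=.
by congr Cell2; apply: natTrans_eq => x /=; rewrite fhom_id compIc.
Qed.

Lemma hcompI a A : dom1 (src a) = A -> hcomp a (id2 (id1 A)) = a.
Proof.
move=> <-; apply: cell2_eq.
- by rewrite src_hcomp //= comp1I.
- by rewrite tgt_hcomp //= tgt_id2 comp1I.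
- case: a => [[A' B F] G a] /= x f; rewrite /id2 hcompE => -[y [-> ->]].
  by exists y; rewrite /= fhom_id compIc.
Qed.

Lemma hcompIl a A : cod1 (src a) = A -> hcomp (id2 (id1 A)) a = a.
Proof.
move=> <-; apply: cell2_eq.
- by rewrite src_hcomp //= comp1Il.
- by rewrite tgt_hcomp //= tgt_id2 comp1Il.
- case: a => [[A' B F] G a] /= x f; rewrite /id2 hcompE => -[y [-> ->]].
  by exists y; rewrite /= compcI.
Qed.

Lemma prod2A a b c : prod2 (prod2 a b) c = prod2 a (prod2 b c).
Proof.
apply: cell2_eq; [exact: prod1A|exact: (prod1A (tgt a) (tgt b) (tgt c))|].
move=> u v /graph2_prod.
move=> [_ [u3 [_ [v3 [-> -> /graph2_prod [u1 [u2 [v1 [v2 [-> -> h1 h2]]]]] h3]]]]].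
rewrite tprod_objA tprod_arrowA; apply/graph2_prod.
do 4!eexists; split; [reflexivity|reflexivity|exact: h1|].
by apply/graph2_prod; do 4!eexists; split; [reflexivity|reflexivity| |].
Qed.

Lemma prod2I a : prod2 a (id2 (id1 [::])) = a.
Proof.
apply: cell2_eq; [exact: prod1I|exact: (prod1I (tgt a))|].
move=> u v /graph2_prod [u1 [_ [v1 [_ [-> -> h1 [[] [-> ->]]]]]]].
by rewrite tprod_obj0 tprod_arrow0.
Qed.

Lemma prod2Il a : prod2 (id2 (id1 [::])) a = a.
Proof.
apply: cell2_eq; [exact: prodI1|exact: (prodI1 (tgt a))|].
move=> u v /graph2_prod [_ [u2 [_ [v2 [-> -> [[] [-> ->]] h]]]]].
by case: u2 v2 h => s y [t [x x' f]].
Qed.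

Lemma prod2_id F G : prod2 (id2 F) (id2 G) = id2 (prod1 F G).
Proof.
case: F G => [A B F] [A' B' G]; rewrite /prod2 /id2 /=; congr Cell2.
apply: natTrans_eq => x; rewrite /= !fhom_id !compIc compcI.
exact: (fhom_id (joinF B B')).
Qed.

Lemma prod2E (A B A' B' : seq category) (F G : functor (cat_of A) (cat_of B))
    (F' G' : functor (cat_of A') (cat_of B'))
    (a : natTrans F G) (b : natTrans F' G') :
  prod2 (@Cell2 (Cell1 F) G a) (@Cell2 (Cell1 F') G' b) =
  @Cell2 (Cell1 (functor_prod F F')) (functor_prod G G') (nat_prod a b).
Proof. by []. Qed.

Lemma prod2_vcomp a b a' b' : tgt a = src b -> tgt a' = src b' ->
  prod2 (vcomp b a) (vcomp b' a') = vcomp (prod2 b b') (prod2 a a').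
Proof.
move: b a; apply: vcomp_ind => A B F G H b a.
move: b' a'; apply: vcomp_ind => A' B' F' G' H' b' a'.
rewrite !vcompE.
apply: (f_equal (@Cell2 (Cell1 (functor_prod F F')) (functor_prod H H'))).
apply: natTrans_eq => x.
by rewrite /nat_vcomp /= !fhom_id !compcI !compIc -fhom_comp.
Qed.

Lemma prod2_hcomp a b a' b' :
  cod1 (src a) = dom1 (src b) -> cod1 (src a') = dom1 (src b') ->
  prod2 (hcomp b a) (hcomp b' a') = hcomp (prod2 b b') (prod2 a a').
Proof.
move=> e e'; apply: cell2_eq.
- by rewrite src_hcomp /= ?e ?e' // !src_hcomp // prod1_comp.
- rewrite tgt_hcomp /= ?e ?e' //.
  rewrite -[LHS]/(prod1 (tgt (hcomp b a)) (tgt (hcomp b' a'))) !tgt_hcomp //.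
  exact: prod1_comp.
move: b a e; apply: hcomp_ind => A B C F G H K b a.
move: b' a' e'; apply: hcomp_ind => A' B' C' F' G' H' K' b' a'.
move=> u v; rewrite !hcompE => -[x [-> ->]]; rewrite ?prod2E ?hcompE.
exists x; split=> //; congr TArrow.
pose p (f : arrow (cat_of B)) (g : arrow (cat_of B')) := join_arrow
  (Arrow (compc (fhom K (arrow_hom f)) (b (arrow_src f))))
  (Arrow (compc (fhom K' (arrow_hom g)) (b' (arrow_src g)))).
pose f := Arrow (a (leftF A A' x)); pose f' := Arrow (a' (rightF A A' x)).
transitivity (p f f').
  by rewrite /p /join_arrow /map_arrow /= !fhom_id !compIc compcI.
transitivity (p (map_arrow (leftF B B') (join_arrow f f'))
                (map_arrow (rightF B B') (join_arrow f f'))).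
  by rewrite left_join_arrow right_join_arrow.
by rewrite /p /join_arrow /map_arrow /= !fhom_id !compIc !compcI -fhom_comp.
Qed.

Record simplex_map (m n : nat) := SimplexMap {
  smap :> 'I_m.+1 -> 'I_n.+1;
  smap_mono : forall i j : 'I_m.+1, i <= j -> smap i <= smap j }.

Definition smap_id (n : nat) : simplex_map n n :=
  @SimplexMap n n id (fun _ _ h => h).

Definition smap_comp (l m n : nat) (g : simplex_map m n) (f : simplex_map l m) :
    simplex_map l n :=
  @SimplexMap l n (fun i => g (f i)) (fun _ _ h => smap_mono g (smap_mono f h)).

Program Definition coface (n : nat) (i : 'I_n.+2) : simplex_map n n.+1 :=
  @SimplexMap n n.+1 (lift i) _.
Next Obligation. by move=> n i j k jk; rewrite /= leq_bump2. Qed.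

Lemma unbump_ord (n : nat) (i : 'I_n.+1) (j : 'I_n.+2) : unbump i j < n.+1.
Proof.
rewrite /unbump; case: (ltnP i j) => [ij|ji] /=; last first.
  by rewrite subn0 (leq_ltn_trans ji).
by rewrite subn1 -ltnS prednK ?(leq_trans _ ij).
Qed.

(** The surjection taking the value [i] twice. *)
Program Definition codegen (n : nat) (i : 'I_n.+1) : simplex_map n.+1 n :=
  @SimplexMap n.+1 n (fun j => Ordinal (unbump_ord i j)) _.
Next Obligation.
move=> n i j k jk; rewrite /= /unbump.
case: (ltnP i j) => [ij|ji]; case: (ltnP i k) => [ik|ki]; rewrite /= ?subn0 //.
- exact: leq_sub2r.
- by move: (leq_trans ij jk); rewrite ltnNge ki.
- by rewrite subn1 -ltnS prednK ?(leq_ltn_trans ji) // (leq_trans _ ik).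
Qed.

Definition smap_terminal (n : nat) : simplex_map n 0 :=
  @SimplexMap n 0 (fun _ => ord0) (fun _ _ _ => leqnn 0).

Record simplicial_set := SimplicialSet {
  simplices :> nat -> Type;
  act : forall m n, simplex_map m n -> simplices n -> simplices m;
  act_id : forall n x, act (smap_id n) x = x;
  act_comp : forall l m n (g : simplex_map m n) (f : simplex_map l m) x,
    act (smap_comp g f) x = act f (act g x) }.

Record simplicial_map (X Y : simplicial_set) := SimplicialMap {
  simp_map :> forall n, X n -> Y n;
  simp_map_act : forall m n (f : simplex_map m n) x,
    simp_map (act f x) = act f (simp_map x) }.

Definition simplicial_comp (X Y Z : simplicial_set) (g : simplicial_map Y Z)
    (f : simplicial_map X Y) : simplicial_map X Z.
Proof.
exists (fun n x => g n (f n x)).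
by move=> m n h x; rewrite !simp_map_act.
Defined.

Definition monomorphism (X Y : simplicial_set) (f : simplicial_map X Y) : Prop :=
  forall (Z : simplicial_set) (g h : simplicial_map Z X),
    simplicial_comp f g = simplicial_comp f h -> g = h.

Definition standard_simplex (n : nat) : simplicial_set.
Proof.
exists (fun m => simplex_map m n) (fun l m f g => smap_comp g f).
- by move=> m [].
- by [].
Defined.

Lemma simplicial_map_eq (X Y : simplicial_set) (f g : simplicial_map X Y) :
  (forall n x, f n x = g n x) -> f = g.
Proof.
case: f g => [f fa] [g ga] /= E.
have e : f = g.
  by apply: functional_extensionality_dep => n; apply: funext => x.
by subst g; congr SimplicialMap; apply: Prop_irrelevance.
Qed.

Lemma monomorphismP (X Y : simplicial_set) (f : simplicial_map X Y) :
  monomorphism f <-> forall n, injective (f n).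
Proof.
split=> [mf n x y e|inj Z g h e]; last first.
  apply: simplicial_map_eq => n z; apply: (inj n).
  exact: (congr1 (fun k : simplicial_map Z Y => k n z) e).
pose yo x : simplicial_map (standard_simplex n) X :=
  @SimplicialMap (standard_simplex n) X (fun m (g : simplex_map m n) => act g x)
    (fun l m g h => act_comp h g x).
have yo_xy : yo x = yo y.
  by apply: mf; apply: simplicial_map_eq => m g; rewrite /= !simp_map_act e.
have := congr1 (fun k : simplicial_map (standard_simplex n) X =>
  k n (smap_id n)) yo_xy.
by rewrite /= !act_id.
Qed.

(** Faces [face h i] with [i <= k.+1] and degeneracies [degen h j] with [j <= k]
    are the meaningful ones; the other indices are unconstrained and unused. *)
Record truncated_simplicial_set (r : nat) := TruncatedSimplicialSet {
  tsimplices :> nat -> Type;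
  face : forall k, k < r -> nat -> tsimplices k.+1 -> tsimplices k;
  degen : forall k, k < r -> nat -> tsimplices k -> tsimplices k.+1;
  face_face : forall k (h : k < r) (h' : k.+1 < r) i j x, i < j <= k.+2 ->
    face h i (face h' j x) = face h j.-1 (face h' i x);
  face_degen_lt : forall k (h : k < r) (h' : k.+1 < r) i j x, i < j <= k.+1 ->
    face h' i (degen h' j x) = degen h j.-1 (face h i x);
  face_degen_eq : forall k (h : k < r) i j x, j <= i <= j.+1 -> j <= k ->
    face h i (degen h j x) = x;
  face_degen_gt : forall k (h : k < r) (h' : k.+1 < r) i j x, j.+1 < i <= k.+2 ->
    face h' i (degen h' j x) = degen h j (face h i.-1 x);
  degen_degen : forall k (h : k < r) (h' : k.+1 < r) i j x, i <= j <= k ->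
    degen h' i (degen h j x) = degen h' j.+1 (degen h i x) }.

(** An n-simplex of the r-coskeletal simplicial set with r-truncation [X] is a
    map to [X] from the r-truncation of the standard n-simplex. *)
Record coskeleton_simplex (r : nat) (X : truncated_simplicial_set r) (n : nat) :=
  CoskeletonSimplex {
    cosk_fun :> forall k, k <= r -> simplex_map k n -> X k;
    cosk_face : forall k (h : k < r) (i : 'I_k.+2) (f : simplex_map k.+1 n),
      cosk_fun (ltnW h) (smap_comp f (coface i)) = face h i (cosk_fun h f);
    cosk_degen : forall k (h : k < r) (i : 'I_k.+1) (f : simplex_map k n),
      cosk_fun h (smap_comp f (codegen i)) = degen h i (cosk_fun (ltnW h) f) }.

Lemma coskeleton_simplex_eq (r : nat) (X : truncated_simplicial_set r) (n : nat)
    (x y : coskeleton_simplex X n) :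
  (forall k (h : k <= r) f, x k h f = y k h f) -> x = y.
Proof.
case: x y => [x xf xd] [y yf yd] /= E.
have e : x = y.
  apply: functional_extensionality_dep => k.
  apply: functional_extensionality_dep => h.
  by apply: functional_extensionality_dep => f; apply: E.
by subst y; congr CoskeletonSimplex; apply: Prop_irrelevance.
Qed.

Definition coskeleton_act (r : nat) (X : truncated_simplicial_set r)
    (m n : nat) (g : simplex_map m n) (x : coskeleton_simplex X n) :
    coskeleton_simplex X m :=
  @CoskeletonSimplex r X m (fun k h f => x k h (smap_comp g f))
    (fun k h i f => cosk_face x h i (smap_comp g f))
    (fun k h i f => cosk_degen x h i (smap_comp g f)).

Definition coskeleton (r : nat) (X : truncated_simplicial_set r) :
    simplicial_set.
Proof.
exists (coskeleton_simplex X) (@coskeleton_act r X).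
- by move=> n x; apply: coskeleton_simplex_eq => k h [].
- by move=> l m n g f x; apply: coskeleton_simplex_eq.
Defined.

(** [scomp] is written in diagrammatic order. *)
Record simplicial_category := SimplicialCategory {
  sob :> Type;
  shom : sob -> sob -> simplicial_set;
  sid : forall a, shom a a 0;
  scomp : forall a b c n, shom a b n -> shom b c n -> shom a c n;
  scomp_act : forall a b c m n (f : simplex_map m n)
    (x : shom a b n) (y : shom b c n),
    scomp (act f x) (act f y) = act f (scomp x y);
  scompA : forall a b c d n
    (x : shom a b n) (y : shom b c n) (z : shom c d n),
    scomp (scomp x y) z = scomp x (scomp y z);
  scomp_idl : forall a b n (x : shom a b n),
    scomp (act (smap_terminal n) (sid a)) x = x;
  scomp_idr : forall a b n (x : shom a b n),
    scomp x (act (smap_terminal n) (sid b)) = x }.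

Record simplicial_functor (S U : simplicial_category) := SimplicialFunctor {
  sfob :> S -> U;
  sfhom : forall a b n, shom a b n -> shom (sfob a) (sfob b) n;
  sfhom_act : forall a b m n (f : simplex_map m n) (x : shom a b n),
    sfhom (act f x) = act f (sfhom x);
  sfhom_id : forall a, sfhom (sid a) = sid (sfob a);
  sfhom_comp : forall a b c n (x : shom a b n) (y : shom b c n),
    sfhom (scomp x y) = scomp (sfhom x) (sfhom y) }.

Lemma simplicial_functor_eq (S U : simplicial_category) (o : S -> U)
    (F G : forall a b n, shom a b n -> shom (o a) (o b) n) Fa Fi Fc Ga Gi Gc :
  (forall a b n x, F a b n x = G a b n x) ->
  @SimplicialFunctor S U o F Fa Fi Fc = @SimplicialFunctor S U o G Ga Gi Gc.
Proof.
move=> E; have e : F = G.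
  apply: functional_extensionality_dep => a.
  apply: functional_extensionality_dep => b.
  by apply: functional_extensionality_dep => n; apply: funext => x.
by subst G; congr SimplicialFunctor; apply: Prop_irrelevance.
Qed.

Definition sfunctor_comp (S T U : simplicial_category)
    (G : simplicial_functor T U) (F : simplicial_functor S T) :
    simplicial_functor S U.
Proof.
exists (fun a => G (F a)) (fun a b n x => sfhom G (sfhom F x)).
- by move=> a b m n f x; rewrite !sfhom_act.
- by move=> a; rewrite !sfhom_id.
- by move=> a b c n x y; rewrite !sfhom_comp.
Defined.

(** k-simplices of S[n](p, q).  The vertex [chain i] is the member C_(k-i) of
    the chain C_0 \subset ... \subset C_k, so that arrows go from larger to
    smaller subsets.  There is no such chain when q < p. *)
Record chain (n : nat) (p q : 'I_n.+1) (k : nat) := Chain {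
  chain_fun :> 'I_k.+1 -> {set 'I_n.+1};
  chain_range : forall i x, x \in chain_fun i -> p <= x <= q;
  chain_left : forall i, p \in chain_fun i;
  chain_right : forall i, q \in chain_fun i;
  chain_anti : forall i j : 'I_k.+1, i <= j -> chain_fun j \subset chain_fun i }.

Lemma chain_eq (n : nat) (p q : 'I_n.+1) (k : nat) (c d : chain p q k) :
  (forall i, c i = d i) -> c = d.
Proof.
case: c d => [c c1 c2 c3 c4] [d d1 d2 d3 d4] /= /funext e; subst d.
by congr Chain; apply: Prop_irrelevance.
Qed.

Definition chain_act (n : nat) (p q : 'I_n.+1) (k l : nat)
    (f : simplex_map k l) (c : chain p q l) : chain p q k.
Proof.
exists (fun i => c (f i)).
- by move=> i x; apply: chain_range.
- by move=> i; apply: chain_left.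
- by move=> i; apply: chain_right.
- by move=> i j ij; apply: chain_anti; apply: smap_mono.
Defined.

Definition chain_sset (n : nat) (p q : 'I_n.+1) : simplicial_set.
Proof.
exists (chain p q) (@chain_act n p q).
- by move=> k c; apply: chain_eq.
- by move=> k l m g f c; apply: chain_eq.
Defined.

Definition chain_id (n : nat) (p : 'I_n.+1) : chain p p 0.
Proof.
exists (fun _ => [set p]).
- by move=> _ x; rewrite inE => /eqP ->; rewrite leqnn.
- by move=> _; rewrite inE.
- by move=> _; rewrite inE.
- by [].
Defined.

Definition chain_union (n : nat) (p q r : 'I_n.+1) (k : nat)
    (c : chain p q k) (d : chain q r k) : chain p r k.
Proof.
exists (fun i => c i :|: d i).
- have /andP[pq _] := chain_range (chain_right c ord0).
  have /andP[_ qr] := chain_range (chain_left d ord0).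
  move=> i x; rewrite inE => /orP[/chain_range|/chain_range] /andP[h h'].
    by rewrite h (leq_trans h').
  by rewrite h' andbT (leq_trans _ h).
- by move=> i; rewrite inE chain_left.
- by move=> i; rewrite inE chain_right orbT.
- by move=> i j ij; apply: setUSS; apply: chain_anti.
Defined.

Definition simplex_category (n : nat) : simplicial_category.
Proof.
exists 'I_n.+1 (@chain_sset n) (@chain_id n) (@chain_union n).
- by move=> *; apply: chain_eq.
- by move=> p q r s k c d e; apply: chain_eq => i; rewrite /= setUA.
- move=> p q k c; apply: chain_eq => i /=.
  by apply/setUidPr; rewrite sub1set chain_left.
- move=> p q k c; apply: chain_eq => i /=.
  by apply/setUidPl; rewrite sub1set chain_right.
Defined.

Definition chain_image (m n : nat) (f : simplex_map m n) (p q : 'I_m.+1)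
    (k : nat) (c : chain p q k) : chain (f p) (f q) k.
Proof.
exists (fun i => f @: c i).
- move=> i _ /imsetP[x /chain_range/andP[h h'] ->].
  by rewrite !smap_mono.
- by move=> i; rewrite imset_f ?chain_left.
- by move=> i; rewrite imset_f ?chain_right.
- by move=> i j ij; apply: imsetS; apply: chain_anti.
Defined.

Definition simplex_functor (m n : nat) (f : simplex_map m n) :
    simplicial_functor (simplex_category m) (simplex_category n).
Proof.
exists (smap f) (@chain_image m n f).
- by move=> *; apply: chain_eq.
- by move=> p; apply: chain_eq => i; rewrite /= imset_set1.
- by move=> p q r k c d; apply: chain_eq => i; rewrite /= imsetU.
Defined.

Definition coherent_nerve (U : simplicial_category) : simplicial_set.
Proof.
exists (fun n => simplicial_functor (simplex_category n) U)
  (fun m n f F => sfunctor_comp F (simplex_functor f)).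
- move=> n [o F Fa Fi Fc]; apply: simplicial_functor_eq => p q k c /=.
  by congr F; apply: chain_eq => i; rewrite /= imset_id.
- move=> l m n g f [o F Fa Fi Fc]; apply: simplicial_functor_eq => p q k c /=.
  by congr F; apply: chain_eq => i; rewrite /= imset_comp.
Defined.

Notation "G \o1 F" := (comp1 G F) (at level 50, left associativity).
Notation "F \x1 G" := (prod1 F G) (at level 40, left associativity).
Notation "b \o2 a" := (hcomp b a) (at level 50, left associativity).
Notation "a \x2 b" := (prod2 a b) (at level 40, left associativity).
Notation "b \v a" := (vcomp b a) (at level 52, left associativity).

(** [d i] is the i-th face of a simplex. *)
Definition compatible3 (X Y : Type) (d : nat -> X -> Y) (x0 x1 x2 x3 : X) :
    Prop :=
  (d 0 x1 = d 0 x0 /\ d 0 x2 = d 1 x0 /\ d 0 x3 = d 2 x0) /\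
  (d 1 x2 = d 1 x1 /\ d 1 x3 = d 2 x1) /\
  d 2 x3 = d 2 x2.

Definition compatible4 (X Y : Type) (d : nat -> X -> Y) (x0 x1 x2 x3 x4 : X) :
    Prop :=
  (d 0 x1 = d 0 x0 /\ d 0 x2 = d 1 x0 /\ d 0 x3 = d 2 x0 /\ d 0 x4 = d 3 x0) /\
  (d 1 x2 = d 1 x1 /\ d 1 x3 = d 2 x1 /\ d 1 x4 = d 3 x1) /\
  (d 2 x3 = d 2 x2 /\ d 2 x4 = d 3 x2) /\
  d 3 x4 = d 3 x3.

(** 2-simplices B012 : B01 x B12 -> B02. *)
Record skew2 := Skew2 {
  s2_01 : seq category;
  s2_12 : seq category;
  s2_02 : seq category;
  s2_map :> cell1;
  s2_dom : dom1 s2_map = s2_01 ++ s2_12;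
  s2_cod : cod1 s2_map = s2_02 }.

Definition skew2_face (i : nat) (b : skew2) : seq category :=
  match i with 0 => s2_12 b | 1 => s2_02 b | _ => s2_01 b end.

Definition skew1_degen (j : nat) (B : seq category) : skew2 :=
  match j with
  | 0 => @Skew2 [::] B B (id1 B) erefl erefl
  | _ => @Skew2 B [::] B (id1 B) (esym (cats0 B)) erefl
  end.

(** 3-simplices
    B0123 : B013 o (1 x B123) => B023 o (B012 x 1). *)
Record skew3 := Skew3 {
  s3_123 : skew2;
  s3_023 : skew2;
  s3_013 : skew2;
  s3_012 : skew2;
  s3_compatible : compatible3 skew2_face s3_123 s3_023 s3_013 s3_012;
  s3_map :> cell2;
  s3_src : src s3_map = s3_013 \o1 (id1 (s2_01 s3_012) \x1 s3_123);
  s3_tgt : tgt s3_map = s3_023 \o1 (s3_012 \x1 id1 (s2_12 s3_123)) }.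

Definition skew3_face (i : nat) (b : skew3) : skew2 :=
  match i with 0 => s3_123 b | 1 => s3_023 b | 2 => s3_013 b | _ => s3_012 b end.

(** Both sides are transformations from B014 o (1 x B124) o (1 x 1 x B234) to
    B034 o (B023 x 1) o (B012 x 1 x 1). *)
Definition pentagon (b1234 b0234 b0134 b0124 b0123 : skew3) : Prop :=
  let B01 := id1 (s2_01 (s3_012 b0123)) in
  let B12 := id1 (s2_12 (s3_012 b0123)) in
  let B23 := id1 (s2_12 (s3_123 b0123)) in
  let B34 := id1 (s2_12 (s3_123 b1234)) in
  let B012 := s3_012 b0123 in
  let B123 := s3_123 b0123 in
  let B234 := s3_123 b1234 in
  let B034 := s3_023 b0134 in
  let B014 := s3_013 b0124 in
  (id2 B034 \o2 (b0123 \x2 id2 B34)) \v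
    (b0134 \o2 id2 (B01 \x1 B123 \x1 B34)) \v
    (id2 B014 \o2 (id2 B01 \x2 b1234)) =
  (b0234 \o2 id2 (B012 \x1 B23 \x1 B34)) \v
    (b0124 \o2 id2 (B01 \x1 B12 \x1 B234)).

Record skew4 := Skew4 {
  s4_1234 : skew3;
  s4_0234 : skew3;
  s4_0134 : skew3;
  s4_0124 : skew3;
  s4_0123 : skew3;
  s4_compatible :
    compatible4 skew3_face s4_1234 s4_0234 s4_0134 s4_0124 s4_0123;
  s4_pentagon : pentagon s4_1234 s4_0234 s4_0134 s4_0124 s4_0123 }.

Definition skew4_face (i : nat) (b : skew4) : skew3 :=
  match i with
  | 0 => s4_1234 b | 1 => s4_0234 b | 2 => s4_0134 b | 3 => s4_0124 b
  | _ => s4_0123 b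
  end.

Lemma skew2_eq (a b : skew2) : s2_01 a = s2_01 b -> s2_12 a = s2_12 b ->
  s2_02 a = s2_02 b -> s2_map a = s2_map b -> a = b.
Proof.
case: a b => [x y z f p q] [x' y' z' f' p' q'] /= ? ? ? ?; subst.
by congr Skew2; apply: Prop_irrelevance.
Qed.

Lemma skew3_eq (a b : skew3) : s3_123 a = s3_123 b -> s3_023 a = s3_023 b ->
  s3_013 a = s3_013 b -> s3_012 a = s3_012 b -> s3_map a = s3_map b -> a = b.
Proof.
case: a b => [x y z t c f p q] [x' y' z' t' c' f' p' q'] /= ex ey ez et ef.
subst x' y' z' t' f'.
by rewrite (Prop_irrelevance c' c) (Prop_irrelevance p' p) (Prop_irrelevance q' q).
Qed.

Lemma skew4_eq (a b : skew4) :
  (forall i, skew4_face i a = skew4_face i b) -> a = b.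
Proof.
case: a b => [x y z t u c p] [x' y' z' t' u' c' p'] E.
have /= := (E 0, E 1, E 2, E 3, E 4) => -[[[[? ?] ?] ?] ?]; subst.
by congr Skew4; apply: Prop_irrelevance.
Qed.

Program Definition skew2_degen0 (b : skew2) : skew3 :=
  @Skew3 b b (skew1_degen 0 (s2_02 b)) (skew1_degen 0 (s2_01 b)) _ (id2 b) _ _.
Next Obligation. by []. Qed.
Next Obligation. by move=> b; rewrite /= prodI1 comp1Il ?s2_cod. Qed.
Next Obligation.
by move=> b; rewrite /= tgt_id2 prod1_id comp1I ?s2_dom.
Qed.

Program Definition skew2_degen1 (b : skew2) : skew3 :=
  @Skew3 (skew1_degen 0 (s2_12 b)) b b (skew1_degen 1 (s2_01 b)) _ (id2 b) _ _.
Next Obligation. by []. Qed.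
Next Obligation. by move=> b; rewrite /= prod1_id comp1I ?s2_dom. Qed.
Next Obligation.
by move=> b; rewrite /= tgt_id2 prod1_id comp1I ?s2_dom.
Qed.

Program Definition skew2_degen2 (b : skew2) : skew3 :=
  @Skew3 (skew1_degen 1 (s2_12 b)) (skew1_degen 1 (s2_02 b)) b b _ (id2 b) _ _.
Next Obligation. by []. Qed.
Next Obligation. by move=> b; rewrite /= prod1_id comp1I ?s2_dom. Qed.
Next Obligation.
by move=> b; rewrite /= tgt_id2 prod1I comp1Il ?s2_cod.
Qed.

Definition skew2_degen (j : nat) (b : skew2) : skew3 :=
  match j with
  | 0 => skew2_degen0 b | 1 => skew2_degen1 b | _ => skew2_degen2 b
  end.

Lemma compatible3_face (b : skew3) i j : i < j <= 3 ->
  skew2_face i (skew3_face j b) = skew2_face j.-1 (skew3_face i b).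
Proof.
have [[? [? ?]] [[? ?] ?]] := s3_compatible b.
by case: i j => [|[|[|i]]] [|[|[|[|j]]]].
Qed.

Lemma s3_compatE (b : skew3) :
  (s2_12 (s3_023 b) = s2_12 (s3_123 b) /\
   s2_12 (s3_013 b) = s2_02 (s3_123 b) /\
   s2_12 (s3_012 b) = s2_01 (s3_123 b)) /\
  (s2_02 (s3_013 b) = s2_02 (s3_023 b) /\
   s2_02 (s3_012 b) = s2_01 (s3_023 b)) /\
  s2_01 (s3_012 b) = s2_01 (s3_013 b).
Proof. exact: s3_compatible b. Qed.

Lemma s3_composable (b : skew3) :
  cod1 (id1 (s2_01 (s3_012 b)) \x1 s3_123 b) = dom1 (s3_013 b).
Proof.
have [[_ [c2 _]] [_ c6]] := s3_compatE b.
by rewrite s2_dom /= s2_cod c2 c6.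
Qed.

Lemma s3_dom1 (b : skew3) : dom1 (src b) =
  s2_01 (s3_012 b) ++ s2_12 (s3_012 b) ++ s2_12 (s3_123 b).
Proof.
have [[_ [_ c3]] _] := s3_compatE b.
by rewrite s3_src dom1_comp ?s3_composable //= s2_dom c3.
Qed.

Lemma s3_cod1 (b : skew3) : cod1 (src b) = s2_02 (s3_013 b).
Proof. by rewrite s3_src cod1_comp ?s3_composable // s2_cod. Qed.

Lemma s3_tgt_composable (b : skew3) :
  cod1 (s3_012 b \x1 id1 (s2_12 (s3_123 b))) = dom1 (s3_023 b).
Proof.
have [[c1 _] [[_ c5] _]] := s3_compatE b.
by rewrite s2_dom /= s2_cod c5 c1.
Qed.

Ltac skew3_compat b :=
  have [[? [? ?]] [[? ?] ?]] := s3_compatE b;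
  repeat split; first [reflexivity | match goal with H : _ = _ |- _ =>
    first [exact: (f_equal (skew1_degen 0) H) | exact: (f_equal (skew1_degen 1) H)
      | exact: (f_equal (skew1_degen 0) (esym H)) | exact: (f_equal (skew1_degen 1) (esym H))] end].

Lemma skew3_degen0_subproof (b : skew3) :
  compatible4 skew3_face b b (skew2_degen 0 (s3_023 b))
    (skew2_degen 0 (s3_013 b)) (skew2_degen 0 (s3_012 b)).
Proof. skew3_compat b. Qed.

Lemma skew3_degen1_subproof (b : skew3) :
  compatible4 skew3_face (skew2_degen 0 (s3_123 b)) b b
    (skew2_degen 1 (s3_013 b)) (skew2_degen 1 (s3_012 b)).
Proof. skew3_compat b. Qed.

Lemma skew3_degen2_subproof (b : skew3) :
  compatible4 skew3_face (skew2_degen 1 (s3_123 b)) (skew2_degen 1 (s3_023 b))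
    b b (skew2_degen 2 (s3_012 b)).
Proof. skew3_compat b. Qed.

Lemma skew3_degen3_subproof (b : skew3) :
  compatible4 skew3_face (skew2_degen 2 (s3_123 b)) (skew2_degen 2 (s3_023 b))
    (skew2_degen 2 (s3_013 b)) b b.
Proof. skew3_compat b. Qed.

Lemma s3_hcompI (b : skew3) : b \o2 id2 (id1 (s2_01 (s3_012 b)) \x1
    id1 (s2_12 (s3_012 b)) \x1 id1 (s2_12 (s3_123 b))) = b.
Proof. by rewrite !prod1_id hcompI // s3_dom1 catA. Qed.

Lemma s3_id_src (b : skew3) :
  id2 (s3_013 b) \o2 id2 (id1 (s2_01 (s3_012 b)) \x1 s3_123 b) = id2 (src b).
Proof. by rewrite hcomp_id2 ?s3_composable // s3_src. Qed.

Lemma s3_id_tgt (b : skew3) :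
  id2 (s3_023 b) \o2 id2 (s3_012 b \x1 id1 (s2_12 (s3_123 b))) = id2 (tgt b).
Proof. by rewrite hcomp_id2 ?s3_tgt_composable // s3_tgt. Qed.

Lemma pentagon0 (b : skew3) :
  pentagon b b (skew2_degen 0 (s3_023 b))
    (skew2_degen 0 (s3_013 b)) (skew2_degen 0 (s3_012 b)).
Proof.
rewrite /pentagon /= ?prod2_id ?prod1I ?prodI1 ?prod2I ?prod2Il.
by rewrite ?s3_id_src ?s3_id_tgt ?s3_hcompI ?hcompIl ?s3_cod1 // ?(vcompI, vcompIl, tgt_id2).
Qed.

Lemma pentagon1 (b : skew3) :
  pentagon (skew2_degen 0 (s3_123 b)) b b
    (skew2_degen 1 (s3_013 b)) (skew2_degen 1 (s3_012 b)).
Proof.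
rewrite /pentagon /= ?prod2_id ?prod1I ?prodI1 ?prod2I ?prod2Il.
by rewrite ?s3_id_src ?s3_id_tgt ?s3_hcompI ?hcompIl ?s3_cod1 // ?(vcompI, vcompIl, tgt_id2).
Qed.

Lemma pentagon2 (b : skew3) :
  pentagon (skew2_degen 1 (s3_123 b)) (skew2_degen 1 (s3_023 b))
    b b (skew2_degen 2 (s3_012 b)).
Proof.
rewrite /pentagon /= ?prod2_id ?prod1I ?prodI1 ?prod2I ?prod2Il.
by rewrite ?s3_id_src ?s3_id_tgt ?s3_hcompI ?hcompIl ?s3_cod1 // ?(vcompI, vcompIl, tgt_id2).
Qed.

Lemma pentagon3 (b : skew3) :
  pentagon (skew2_degen 2 (s3_123 b)) (skew2_degen 2 (s3_023 b))
    (skew2_degen 2 (s3_013 b)) b b.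
Proof.
rewrite /pentagon /= ?prod2_id ?prod1I ?prodI1 ?prod2I ?prod2Il.
by rewrite ?s3_id_src ?s3_id_tgt ?s3_hcompI ?hcompIl ?s3_cod1 // ?(vcompI, vcompIl, tgt_id2).
Qed.

Definition skew3_degen (j : nat) (b : skew3) : skew4 :=
  match j with
  | 0 => Skew4 (skew3_degen0_subproof b) (pentagon0 b)
  | 1 => Skew4 (skew3_degen1_subproof b) (pentagon1 b)
  | 2 => Skew4 (skew3_degen2_subproof b) (pentagon2 b)
  | _ => Skew4 (skew3_degen3_subproof b) (pentagon3 b)
  end.

Definition skew_simplex (k : nat) : Type :=
  match k with
  | 1 => seq category | 2 => skew2 | 3 => skew3 | 4 => skew4 | _ => unit
  end.

Definition skew_face (k : nat) :
    k < 4 -> nat -> skew_simplex k.+1 -> skew_simplex k :=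
  match k with
  | 0 => fun _ _ _ => tt
  | 1 => fun _ => skew2_face
  | 2 => fun _ => skew3_face
  | 3 => fun _ => skew4_face
  | _ => fun h => False_rect _ (notF h)
  end.

Definition skew_degen (k : nat) :
    k < 4 -> nat -> skew_simplex k -> skew_simplex k.+1 :=
  match k with
  | 0 => fun _ _ _ => [::]
  | 1 => fun _ => skew1_degen
  | 2 => fun _ => skew2_degen
  | 3 => fun _ => skew3_degen
  | _ => fun h => False_rect _ (notF h)
  end.

Lemma skew_face_face k (h : k < 4) (h' : k.+1 < 4) i j x : i < j <= k.+2 ->
  skew_face h i (skew_face h' j x) = skew_face h j.-1 (skew_face h' i x).
Proof.
case: k h h' x => [|[|[|[|k]]]] h h' x //.
- have [[? [? ?]] [[? ?] ?]] := s3_compatible x.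
  by case: i j => [|[|[|i]]] [|[|[|[|j]]]] // /andP[].
- have [[? [? [? ?]]] [[? [? ?]] [[? ?] ?]]] := s4_compatible x.
  by case: i j => [|[|[|[|i]]]] [|[|[|[|[|j]]]]] // /andP[].
Qed.

Lemma skew_face_degen_lt k (h : k < 4) (h' : k.+1 < 4) i j x : i < j <= k.+1 ->
  skew_face h' i (skew_degen h' j x) = skew_degen h j.-1 (skew_face h i x).
Proof.
case: k h h' x => [|[|[|[|k]]]] h h' x //.
- by case: i j => [|[|i]] [|[|j]] // /andP[].
- by case: i j => [|[|[|i]]] [|[|[|j]]] // /andP[].
- by case: i j => [|[|[|[|i]]]] [|[|[|[|j]]]] // /andP[].
Qed.

Lemma skew_face_degen_eq k (h : k < 4) i j x : j <= i <= j.+1 -> j <= k ->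
  skew_face h i (skew_degen h j x) = x.
Proof.
case: k h x => [|[|[|[|k]]]] h x //.
- by case: x.
- by case: i j => [|[|[|i]]] [|[|j]] // /andP[].
- by case: i j => [|[|[|[|i]]]] [|[|[|j]]] // /andP[].
- by case: i j => [|[|[|[|[|i]]]]] [|[|[|[|j]]]] // /andP[].
Qed.

Lemma skew_face_degen_gt k (h : k < 4) (h' : k.+1 < 4) i j x : j.+1 < i <= k.+2 ->
  skew_face h' i (skew_degen h' j x) = skew_degen h j (skew_face h i.-1 x).
Proof.
case: k h h' x => [|[|[|[|k]]]] h h' x //.
- by case: i j => [|[|[|i]]] [|[|j]] // /andP[].
- by case: i j => [|[|[|[|i]]]] [|[|[|j]]] // /andP[].
- by case: i j => [|[|[|[|[|i]]]]] [|[|[|[|j]]]] // /andP[].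
Qed.

Lemma skew_degen_degen k (h : k < 4) (h' : k.+1 < 4) i j x : i <= j <= k ->
  skew_degen h' i (skew_degen h j x) = skew_degen h' j.+1 (skew_degen h i x).
Proof.
case: k h h' x => [|[|[|[|k]]]] h h' x //.
- by case: i j => [|i] [|j] // _; apply: skew2_eq.
- by case: i j => [|[|i]] [|[|j]] // _; apply: skew3_eq => //=; apply: skew2_eq.
- case: i j => [|[|[|i]]] [|[|[|j]]] // _; apply: skew4_eq => //;
  by move=> [|[|[|[|l]]]] //=; apply: skew3_eq => //=; apply: skew2_eq.
Qed.

Definition skew_truncation : truncated_simplicial_set 4 :=
  TruncatedSimplicialSet skew_face_face skew_face_degen_lt skew_face_degen_eq
    skew_face_degen_gt skew_degen_degen.

Definition skew_nerve_Cat : simplicial_set := coskeleton skew_truncation.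

(** 2-simplices  T12 o T01 => T02. *)
Record duskin2 := Duskin2 {
  d2_12 : cell1;
  d2_02 : cell1;
  d2_01 : cell1;
  d2_composable : cod1 d2_01 = dom1 d2_12;
  d2_map :> cell2;
  d2_src : src d2_map = d2_12 \o1 d2_01;
  d2_tgt : tgt d2_map = d2_02 }.

Definition duskin1_face (i : nat) (T : cell1) : seq category :=
  match i with 0 => cod1 T | _ => dom1 T end.

Definition duskin2_face (i : nat) (a : duskin2) : cell1 :=
  match i with 0 => d2_12 a | 1 => d2_02 a | _ => d2_01 a end.

(** 3-simplices: eta_013 . (eta_123 o 1) = eta_023 . (1 o eta_012). *)
Record duskin3 := Duskin3 {
  d3_123 : duskin2;
  d3_023 : duskin2;
  d3_013 : duskin2;
  d3_012 : duskin2;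
  d3_compatible : compatible3 duskin2_face d3_123 d3_023 d3_013 d3_012;
  d3_cocycle :
    d3_013 \v (d3_123 \o2 id2 (d2_01 d3_012)) =
    d3_023 \v (id2 (d2_12 d3_123) \o2 d3_012) }.

Definition duskin3_face (i : nat) (a : duskin3) : duskin2 :=
  match i with 0 => d3_123 a | 1 => d3_023 a | 2 => d3_013 a | _ => d3_012 a end.

Lemma duskin2_eq (a b : duskin2) : d2_12 a = d2_12 b -> d2_02 a = d2_02 b ->
  d2_01 a = d2_01 b -> d2_map a = d2_map b -> a = b.
Proof.
case: a b => [x y z c f p q] [x' y' z' c' f' p' q'] /= ex ey ez ef.
move: c' p' q'; rewrite -ex -ey -ez -ef => c' p' q'.
by rewrite (Prop_irrelevance c' c) (Prop_irrelevance p' p) (Prop_irrelevance q' q).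
Qed.

Lemma duskin3_eq (a b : duskin3) :
  (forall i, duskin3_face i a = duskin3_face i b) -> a = b.
Proof.
case: a b => [x y z t c p] [x' y' z' t' c' p'] E.
have /= := (E 0, E 1, E 2, E 3) => -[[[? ?] ?] ?]; subst.
by congr Duskin3; apply: Prop_irrelevance.
Qed.

Program Definition duskin1_degen0 (T : cell1) : duskin2 :=
  @Duskin2 T T (id1 (dom1 T)) erefl (id2 T) _ (tgt_id2 T).
Next Obligation. by move=> T; rewrite comp1I. Qed.

Program Definition duskin1_degen1 (T : cell1) : duskin2 :=
  @Duskin2 (id1 (cod1 T)) T T erefl (id2 T) _ (tgt_id2 T).
Next Obligation. by move=> T; rewrite comp1Il. Qed.

Definition duskin1_degen (j : nat) (T : cell1) : duskin2 :=
  match j with 0 => duskin1_degen0 T | _ => duskin1_degen1 T end.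

Lemma d2_dom1 (a : duskin2) : dom1 (src a) = dom1 (d2_01 a).
Proof. by rewrite d2_src dom1_comp ?d2_composable. Qed.

Lemma d2_cod1 (a : duskin2) : cod1 (src a) = cod1 (d2_12 a).
Proof. by rewrite d2_src cod1_comp ?d2_composable. Qed.

Lemma d2_dom1_02 (a : duskin2) : dom1 (d2_02 a) = dom1 (d2_01 a).
Proof. by rewrite -d2_tgt -d2_dom1. Qed.

Lemma d2_cod1_02 (a : duskin2) : cod1 (d2_02 a) = cod1 (d2_12 a).
Proof. by rewrite -d2_tgt -d2_cod1. Qed.

Program Definition duskin2_degen0 (a : duskin2) : duskin3 :=
  @Duskin3 a a (duskin1_degen 0 (d2_02 a)) (duskin1_degen 0 (d2_01 a)) _ _.
Next Obligation.
by move=> a; do !split=> //=; rewrite /= d2_dom1_02.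
Qed.
Next Obligation.
move=> a; rewrite /= hcompI ?d2_dom1 // vcompIl ?d2_tgt //.
by rewrite hcomp_id2 ?d2_composable // vcompI ?d2_src.
Qed.

Program Definition duskin2_degen1 (a : duskin2) : duskin3 :=
  @Duskin3 (duskin1_degen 0 (d2_12 a)) a a (duskin1_degen 1 (d2_01 a)) _ _.
Next Obligation.
by move=> a; do !split=> //=; rewrite /= d2_composable.
Qed.
Next Obligation. by []. Qed.

Program Definition duskin2_degen2 (a : duskin2) : duskin3 :=
  @Duskin3 (duskin1_degen 1 (d2_12 a)) (duskin1_degen 1 (d2_02 a)) a a _ _.
Next Obligation.
by move=> a; do !split=> //=; rewrite /= d2_cod1_02.
Qed.
Next Obligation.
move=> a; rewrite /= hcompIl ?d2_cod1 // vcompIl ?d2_tgt //.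
by rewrite hcomp_id2 ?d2_composable // vcompI ?d2_src.
Qed.

Definition duskin2_degen (j : nat) (a : duskin2) : duskin3 :=
  match j with
  | 0 => duskin2_degen0 a | 1 => duskin2_degen1 a | _ => duskin2_degen2 a
  end.

Definition duskin_simplex (k : nat) : Type :=
  match k with
  | 0 => seq category | 1 => cell1 | 2 => duskin2 | 3 => duskin3 | _ => unit
  end.

Definition duskin_face (k : nat) :
    k < 3 -> nat -> duskin_simplex k.+1 -> duskin_simplex k :=
  match k with
  | 0 => fun _ => duskin1_face
  | 1 => fun _ => duskin2_face
  | 2 => fun _ => duskin3_face
  | _ => fun h => False_rect _ (notF h)
  end.

Definition duskin_degen (k : nat) :
    k < 3 -> nat -> duskin_simplex k -> duskin_simplex k.+1 :=
  match k with
  | 0 => fun _ _ => id1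
  | 1 => fun _ => duskin1_degen
  | 2 => fun _ => duskin2_degen
  | _ => fun h => False_rect _ (notF h)
  end.

Lemma duskin_face_face k (h : k < 3) (h' : k.+1 < 3) i j x : i < j <= k.+2 ->
  duskin_face h i (duskin_face h' j x) = duskin_face h j.-1 (duskin_face h' i x).
Proof.
case: k h h' x => [|[|[|k]]] h h' x //.
- have ? := d2_composable x; have ? := d2_dom1_02 x; have ? := d2_cod1_02 x.
  by case: i j => [|[|i]] [|[|[|j]]] // /andP[].
- have [[? [? ?]] [[? ?] ?]] := d3_compatible x.
  by case: i j => [|[|[|i]]] [|[|[|[|j]]]] // /andP[].
Qed.

Lemma duskin_face_degen_lt k (h : k < 3) (h' : k.+1 < 3) i j x : i < j <= k.+1 ->
  duskin_face h' i (duskin_degen h' j x) = duskin_degen h j.-1 (duskin_face h i x).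
Proof.
case: k h h' x => [|[|[|k]]] h h' x //.
- by case: i j => [|[|i]] [|[|j]] // /andP[].
- by case: i j => [|[|[|i]]] [|[|[|j]]] // /andP[].
Qed.

Lemma duskin_face_degen_eq k (h : k < 3) i j x : j <= i <= j.+1 -> j <= k ->
  duskin_face h i (duskin_degen h j x) = x.
Proof.
case: k h x => [|[|[|k]]] h x //.
- by case: i j => [|[|i]] [|j] // /andP[].
- by case: i j => [|[|[|i]]] [|[|j]] // /andP[].
- by case: i j => [|[|[|[|i]]]] [|[|[|j]]] // /andP[].
Qed.

Lemma duskin_face_degen_gt k (h : k < 3) (h' : k.+1 < 3) i j x :
  j.+1 < i <= k.+2 ->
  duskin_face h' i (duskin_degen h' j x) = duskin_degen h j (duskin_face h i.-1 x).
Proof.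
case: k h h' x => [|[|[|k]]] h h' x //.
- by case: i j => [|[|[|i]]] [|[|j]] // /andP[].
- by case: i j => [|[|[|[|i]]]] [|[|[|j]]] // /andP[].
Qed.

Lemma duskin_degen_degen k (h : k < 3) (h' : k.+1 < 3) i j x : i <= j <= k ->
  duskin_degen h' i (duskin_degen h j x) = duskin_degen h' j.+1 (duskin_degen h i x).
Proof.
case: k h h' x => [|[|[|k]]] h h' x //.
- by case: i j => [|i] [|j] // _; apply: duskin2_eq.
- by case: i j => [|[|i]] [|[|j]] // _; apply: duskin3_eq => -[|[|[|l]]] //=;
  apply: duskin2_eq.
Qed.

Definition duskin_truncation : truncated_simplicial_set 3 :=
  TruncatedSimplicialSet duskin_face_face duskin_face_degen_lt
    duskin_face_degen_eq duskin_face_degen_gt duskin_degen_degen.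

Program Definition duskin2_prod (a b : duskin2) : duskin2 :=
  @Duskin2 (d2_12 a \x1 d2_12 b) (d2_02 a \x1 d2_02 b) (d2_01 a \x1 d2_01 b)
    _ (a \x2 b) _ _.
Next Obligation. by move=> a b; rewrite /= !d2_composable. Qed.
Next Obligation.
by move=> a b; rewrite /= !d2_src prod1_comp ?d2_composable.
Qed.
Next Obligation.
by move=> a b; rewrite -[LHS]/(tgt a \x1 tgt b) !d2_tgt.
Qed.

Lemma d3_compatE (a : duskin3) :
  (d2_12 (d3_023 a) = d2_12 (d3_123 a) /\
   d2_12 (d3_013 a) = d2_02 (d3_123 a) /\
   d2_12 (d3_012 a) = d2_01 (d3_123 a)) /\
  (d2_02 (d3_013 a) = d2_02 (d3_023 a) /\
   d2_02 (d3_012 a) = d2_01 (d3_023 a)) /\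
  d2_01 (d3_012 a) = d2_01 (d3_013 a).
Proof. exact: d3_compatible a. Qed.

Lemma d3_hcomposable (a : duskin3) :
  cod1 (d2_01 (d3_012 a)) = dom1 (src (d3_123 a)).
Proof.
have [[_ [_ c3]] _] := d3_compatE a.
by rewrite d2_dom1 -c3 d2_composable.
Qed.

Lemma d3_hcomposable' (a : duskin3) :
  cod1 (src (d3_012 a)) = dom1 (d2_12 (d3_123 a)).
Proof.
have [[_ [_ c3]] _] := d3_compatE a.
by rewrite d2_cod1 c3 d2_composable.
Qed.

Lemma d3_vcomposable (a : duskin3) :
  tgt (d3_123 a \o2 id2 (d2_01 (d3_012 a))) = src (d3_013 a).
Proof.
have [[_ [c2 _]] [_ c6]] := d3_compatE a.
by rewrite tgt_hcomp ?d3_hcomposable // tgt_id2 d2_src d2_tgt c2 c6.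
Qed.

Lemma d3_vcomposable' (a : duskin3) :
  tgt (id2 (d2_12 (d3_123 a)) \o2 d3_012 a) = src (d3_023 a).
Proof.
have [[c1 _] [[_ c5] _]] := d3_compatE a.
by rewrite tgt_hcomp ?d3_hcomposable' // tgt_id2 d2_src d2_tgt c1 c5.
Qed.

Program Definition duskin3_prod (a b : duskin3) : duskin3 :=
  @Duskin3 (duskin2_prod (d3_123 a) (d3_123 b))
    (duskin2_prod (d3_023 a) (d3_023 b)) (duskin2_prod (d3_013 a) (d3_013 b))
    (duskin2_prod (d3_012 a) (d3_012 b)) _ _.
Next Obligation.
move=> a b; have [[p1 [p2 p3]] [[p4 p5] p6]] := d3_compatE a.
have [[q1 [q2 q3]] [[q4 q5] q6]] := d3_compatE b.
by do !split; rewrite /= ?(p1, p2, p3, p4, p5, p6, q1, q2, q3, q4, q5, q6).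
Qed.
Next Obligation.
move=> a b; rewrite /= -!prod2_id.
rewrite -!prod2_hcomp ?d3_hcomposable ?d3_hcomposable' //.
rewrite -!prod2_vcomp ?d3_vcomposable ?d3_vcomposable' //.
by rewrite !d3_cocycle.
Qed.

Definition duskin_prod (k : nat) :
    duskin_simplex k -> duskin_simplex k -> duskin_simplex k :=
  match k with
  | 0 => cat | 1 => prod1 | 2 => duskin2_prod | 3 => duskin3_prod
  | _ => fun _ _ => tt
  end.

Lemma duskin_prod_face k (h : k < 3) i x y :
  duskin_face h i (duskin_prod x y) =
  duskin_prod (duskin_face h i x) (duskin_face h i y).
Proof.
case: k h x y => [|[|[|k]]] h x y //.
- by case: i.
- by case: i => [|[|i]].
- by case: i => [|[|[|i]]].
Qed.

Lemma duskin_prod_degen k (h : k < 3) j x y :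
  duskin_degen h j (duskin_prod x y) =
  duskin_prod (duskin_degen h j x) (duskin_degen h j y).
Proof.
case: k h x y => [|[|[|k]]] h x y //=.
- by rewrite prod1_id.
- by case: j => [|j]; apply: duskin2_eq; rewrite /= ?prod1_id ?prod2_id.
- case: j => [|[|j]]; apply: duskin3_eq => -[|[|[|l]]] //=;
  by apply: duskin2_eq; rewrite /= ?prod1_id ?prod2_id.
Qed.

Lemma duskin_prodA k (x y z : duskin_simplex k) :
  duskin_prod (duskin_prod x y) z = duskin_prod x (duskin_prod y z).
Proof.
have A2 (a b c : duskin2) : duskin2_prod (duskin2_prod a b) c =
    duskin2_prod a (duskin2_prod b c).
  by apply: duskin2_eq; rewrite /= ?prod1A ?prod2A.
case: k x y z => [|[|[|[|k]]]] x y z //=.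
- by rewrite catA.
- exact: prod1A.
- by apply: duskin3_eq => -[|[|[|l]]] /=.
Qed.

Definition duskin_nerve_Cat : simplicial_set := coskeleton duskin_truncation.

Program Definition duskin_comp (n : nat) (x y : duskin_nerve_Cat n) :
    duskin_nerve_Cat n :=
  @CoskeletonSimplex 3 duskin_truncation n
    (fun k h f => @duskin_prod k (cosk_fun x h f) (cosk_fun y h f)) _ _.
Next Obligation.
by move=> n x y k h i f; rewrite /= !cosk_face; apply: esym; apply: duskin_prod_face.
Qed.
Next Obligation.
by move=> n x y k h i f; rewrite /= !cosk_degen; apply: esym; apply: duskin_prod_degen.
Qed.

Definition duskin_unit (k : nat) : duskin_simplex k :=
  match k with
  | 0 => [::] | 1 => id1 [::]
  | 2 => duskin1_degen 0 (id1 [::])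
  | 3 => duskin2_degen 0 (duskin1_degen 0 (id1 [::]))
  | _ => tt
  end.

Lemma duskin_unit_face k (h : k < 3) i :
  duskin_face h i (duskin_unit k.+1) = duskin_unit k.
Proof.
case: k h => [|[|[|k]]] h //.
- by case: i.
- by case: i => [|[|i]].
- by case: i => [|[|[|i]]].
Qed.

Lemma duskin_unit_degen k (h : k < 3) j :
  duskin_degen h j (duskin_unit k) = duskin_unit k.+1.
Proof.
case: k h => [|[|[|k]]] h //=.
- by case: j => // j; apply: duskin2_eq.
- by case: j => [|[|j]] //; apply: duskin3_eq => -[|[|[|l]]] //=;
  apply: duskin2_eq.
Qed.

Definition duskin_id : duskin_nerve_Cat 0 :=
  @CoskeletonSimplex 3 duskin_truncation 0 (fun k _ _ => duskin_unit k)
    (fun k h i _ => esym (duskin_unit_face h i))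
    (fun k h i _ => esym (duskin_unit_degen h i)).

Lemma duskin_prodIl k (x : duskin_simplex k) :
  duskin_prod (duskin_unit k) x = x.
Proof.
have A2 (a : duskin2) : duskin2_prod (duskin_unit 2) a = a.
  by apply: duskin2_eq; rewrite /= ?prodI1 ?prod2Il.
case: k x => [|[|[|[|k]]]] x //=.
- exact: prodI1.
- by apply: duskin3_eq => -[|[|[|l]]] /=; apply: A2.
- by case: x.
Qed.

Lemma duskin_prodI k (x : duskin_simplex k) :
  duskin_prod x (duskin_unit k) = x.
Proof.
have A2 (a : duskin2) : duskin2_prod a (duskin_unit 2) = a.
  by apply: duskin2_eq; rewrite /= ?prod1I ?prod2I.
case: k x => [|[|[|[|k]]]] x //=.
- exact: cats0.
- exact: prod1I.
- by apply: duskin3_eq => -[|[|[|l]]] /=; apply: A2.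
- by case: x.
Qed.

Definition N2_Cat : simplicial_category.
Proof.
exists unit (fun _ _ => duskin_nerve_Cat) (fun _ => duskin_id)
  (fun _ _ _ => duskin_comp).
- by move=> *; apply: coskeleton_simplex_eq.
- by move=> *; apply: coskeleton_simplex_eq => k h f; apply: duskin_prodA.
- by move=> *; apply: coskeleton_simplex_eq => k h f; apply: duskin_prodIl.
- by move=> *; apply: coskeleton_simplex_eq => k h f; apply: duskin_prodI.
Defined.

(* Main.v *)
(** A simplex of the skew nerve is a family of categories B_pq, functors B_pqr
    and transformations B_pqrs.  A set {p = d_0 < ... < d_m = q} is sent to the
    product B_{d_0 d_1} x ... x B_{d_{m-1} d_m}; an inclusion C \subset D to the
    functor which multiplies each segment of D between consecutive elements of C
    with all brackets to the left; and E \subset C \subset D to the unique way of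
    rebracketing with the B_pqrs, which exists because left bracketing is terminal
    among all bracketings.  The cocycle condition is Mac Lane coherence, proved by
    reading D from left to right: moving the last position of D by one step is the
    pentagon, everything else is naturality.  B_pq, B_pqr and B_pqrs are recovered
    from {p,q}, from {p,r} \subset {p,q,r} and from
    {p,s} \subset {p,q,s} \subset {p,q,r,s}, hence injectivity. *)

From mathcomp Require Import all_boot.
From mathcomp Require Import boolp.
Require Import Defs.

Set Implicit Arguments.
Unset Strict Implicit.
Unset Printing Implicit Defensive.

(** The obstacle is bookkeeping: a pasting of many cells makes sense only once all inner boundaries
    are identified, and strictness is available only as equality of bundled cells. Equations are
    therefore tested on generalized elements, which turns a diagram into an equation between terms
    in the applied structure maps, and interchange into naturality in an argument. The statements
    about whole chains are too weak for induction on the positions. Each recursion carries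
    accumulators, namely the last positions read and the products formed since then, and is studied
    for arbitrary contents of these. The cocycle condition then acquires a fifth cell, an associator
    of the accumulators, which is an identity when they are empty. Positions are only weakly
    increasing throughout. Since B_pp is the unit, closing a segment, reading the final position
    twice and identifying positions along a simplex map all become instances of the unit laws. *)

Lemma src_prod2 a b : src (a \x2 b) = src a \x1 src b. Proof. by []. Qed.
Lemma tgt_prod2 a b : tgt (a \x2 b) = tgt a \x1 tgt b. Proof. by []. Qed.

(** * Vertical and horizontal composition of cells *)

Lemma vcompA a b c : tgt a = src b -> tgt b = src c ->
  c \v (b \v a) = (c \v b) \v a.
Proof.
case: c => K L c /= ab; move: b a ab.
apply: vcomp_ind => A B F G M b a /= e; subst K.
rewrite !vcompE; congr Cell2; apply: natTrans_eq => x /=.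
by rewrite compcA.
Qed.

(** The endpoints of the two sides differ by associativity of functor composition, which is an
    equation and not a conversion; hence the comparison by boundaries and graphs. *)
Lemma hcompA a b c : cod1 (src a) = dom1 (src b) -> cod1 (src b) = dom1 (src c) ->
  c \o2 (b \o2 a) = (c \o2 b) \o2 a.
Proof.
move=> ab bc; apply: cell2_eq.
- by rewrite !src_hcomp ?comp1A // ?cod1_comp ?dom1_comp.
- by rewrite !tgt_hcomp ?comp1A //= ?src_hcomp ?cod1_comp ?dom1_comp.
move: bc ab; case: c => [[C0 E M] N c]; move: b a.
move=> [[B0 C H] K b] [[A B F] G a] /= e1 e2; subst C0 B0.
move=> x f; rewrite !hcompE => -[y [-> ->]]; exists y; split=> //.
by rewrite /= fhom_comp compcA.
Qed.

Lemma hcomp_vcomp a b c d : tgt a = src b -> tgt c = src d ->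
  cod1 (src a) = dom1 (src c) ->
  (d \v c) \o2 (b \v a) = (d \o2 b) \v (c \o2 a).
Proof.
move: b a; apply: vcomp_ind => A B F G K b a; move: d c.
apply: vcomp_ind => B0 C F' G' K' d c /= e; subst B0.
rewrite !vcompE !hcompE.
apply: etrans; last exact: (esym (vcompE _ _)).
congr Cell2; apply: natTrans_eq => x /=.
by rewrite fhom_comp -!compcA [in RHS](compcA (d _)) naturality !compcA.
Qed.

(** Whiskering by a functor becomes horizontal composition with its identity cell, so functors and
    transformations are applied to elements by the same operation. *)
Local Coercion id2 : cell1 >-> cell2.

(** * Left-bracketed composites *)

(** The indices are unrestricted, so that recursions over positions carry no order proofs;
    [coherent] speaks of weakly increasing tuples. Repeated indices are kept because they yield
    units, from which a recursion restarts when a segment has been closed. *)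
Record skew_family (n : nat) := SkewFamily {
  obj : 'I_n.+1 -> 'I_n.+1 -> seq category;
  mor : 'I_n.+1 -> 'I_n.+1 -> 'I_n.+1 -> cell1;
  asc : 'I_n.+1 -> 'I_n.+1 -> 'I_n.+1 -> 'I_n.+1 -> cell2 }.

Record coherent (n : nat) (X : skew_family n) : Prop := Coherent {
  obj_refl (p : 'I_n.+1) : obj X p p = [::];
  dom_mor (p q r : 'I_n.+1) : p <= q -> q <= r -> dom1 (mor X p q r) = obj X p q ++ obj
    X q r;
  cod_mor (p q r : 'I_n.+1) : p <= q -> q <= r -> cod1 (mor X p q r) = obj X p r;
  mor_idl (p q : 'I_n.+1) : p <= q -> mor X p p q = id1 (obj X p q);
  mor_idr (p q : 'I_n.+1) : p <= q -> mor X p q q = id1 (obj X p q);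
  src_asc (p q r s : 'I_n.+1) : p <= q -> q <= r -> r <= s ->
    src (asc X p q r s) = mor X p q s \o1 (id1 (obj X p q) \x1 mor X q r s);
  tgt_asc (p q r s : 'I_n.+1) : p <= q -> q <= r -> r <= s ->
    tgt (asc X p q r s) = mor X p r s \o1 (mor X p q r \x1 id1 (obj X r s));
  asc_id1 (p q r : 'I_n.+1) : p <= q -> q <= r -> asc X p p q r = mor X p q r;
  asc_id2 (p q r : 'I_n.+1) : p <= q -> q <= r -> asc X p q q r = mor X p q r;
  asc_id3 (p q r : 'I_n.+1) : p <= q -> q <= r -> asc X p q r r = mor X p q r;
  asc_pentagon (p q r s t : 'I_n.+1) : p <= q -> q <= r -> r <= s -> s <= t ->
    (mor X p s t \o2 (asc X p q r s \x2 id1 (obj X s t))) \v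
      (asc X p q s t \o2 (id1 (obj X p q) \x1 mor X q r s \x1 id1 (obj X s t))) \v
      (mor X p q t \o2 (id1 (obj X p q) \x2 asc X q r s t)) =
    (asc X p r s t \o2 (mor X p q r \x1 id1 (obj X r s) \x1 id1 (obj X s t))) \v
      (asc X p q r t \o2 (id1 (obj X p q) \x1 id1 (obj X q r) \x1 mor X r s t)) }.

(** A cell [U] with [el L U] is a generalized element of [L]: applying a functor
    or a transformation [a] to it means [a \o2 U], with no condition on the domain
    of [U]. *)
Definition el (L : seq category) (U : cell2) : Prop := cod1 (src U) = L.

Section GeneralizedElements.

Implicit Types (F : cell1) (a U V Z : cell2) (L M : seq category).

Lemma el_id1 L : el L (id1 L). Proof. by []. Qed.

Lemma el_prod U V L M : el L U -> el M V -> el (L ++ M) (U \x2 V).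
Proof. by move=> <- <-. Qed.

Lemma el_hcomp a U L M : dom1 (src a) = L -> cod1 (src a) = M -> el L U ->
  el M (a \o2 U).
Proof. by move=> dl <- h; rewrite /el src_hcomp ?cod1_comp ?h ?dl. Qed.

Lemma el_vcomp U V L : tgt U = src V -> el L U -> el L (V \v U).
Proof. by move=> UV; rewrite /el src_vcomp. Qed.

Lemma src_happ a U : el (dom1 (src a)) U -> src (a \o2 U) = src a \o1 src U.
Proof. exact: src_hcomp. Qed.

Lemma tgt_happ a U : el (dom1 (src a)) U -> tgt (a \o2 U) = tgt a \o1 tgt U.
Proof. exact: tgt_hcomp. Qed.

Lemma happ_vcomp F U V : el (dom1 F) U -> tgt U = src V ->
  F \o2 (V \v U) = (F \o2 V) \v (F \o2 U).
Proof. by move=> h UV; rewrite -{1}(vcompI (a := F) erefl) hcomp_vcomp ?tgt_id2. Qed.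

(** Interchange with an identity inserted in each argument. Together with [happ_natr] this is the
    naturality square of [a] at [U]. *)
Lemma happ_natl a U : el (dom1 (src a)) U ->
  a \o2 U = (tgt a \o2 U) \v (a \o2 src U).
Proof.
move=> h; rewrite -hcomp_vcomp ?tgt_id2 //.
by rewrite [_ \v a]vcompIl // vcompI.
Qed.

Lemma happ_natr a U : el (dom1 (src a)) U ->
  a \o2 U = (a \o2 tgt U) \v (src a \o2 U).
Proof.
move=> h; rewrite -hcomp_vcomp ?tgt_id2 //.
by rewrite vcompI // vcompIl.
Qed.

Lemma vcomp_hcomp a b F : tgt a = src b -> cod1 F = dom1 (src a) ->
  (b \v a) \o2 F = (b \o2 F) \v (a \o2 F).
Proof.
by move=> ab h; rewrite -{1}(vcompI (a := F) erefl) hcomp_vcomp ?tgt_id2.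
Qed.

End GeneralizedElements.

#[local] Opaque comp1 vcomp hcomp functor_prod nat_prod.

Section Coherence.

Variables (n : nat) (X : skew_family n) (cX : coherent X) (q : 'I_n.+1).

Implicit Types (a e c d t : 'I_n.+1) (s : seq 'I_n.+1).
Implicit Types A E C D : 'I_n.+1 -> bool.
Implicit Types (F G : cell1) (b U V W Y Z : cell2) (L : seq category).

Notation B := (obj X).

(** Below, [s] lists the positions still to be read, [q] is the final position, and
    [E], [C], [D] are increasing sets of positions whose last elements read so far
    are [e <= c <= d].  Positions of [s] outside [D] are skipped. *)
Fixpoint sorted_to D d s : bool :=
  if s is t :: s' then
    if D t then (d <= t) && sorted_to D t s' else sorted_to D d s'
  else d <= q.

Fixpoint path_obj D d s : seq category :=
  if s is t :: s' then
    if D t then B d t ++ path_obj D t s' else path_obj D d s'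
  else B d q.

(** B_cd x B_{d d'} x B_{d' d''} x ... -> B_{c c'} x B_{c' c''} x ..., where the
    d's are the elements of [D] and the c's those of [C]; the first factor
    accumulates the part of the current segment already multiplied. *)
Fixpoint bracket D C c d s : cell1 :=
  if s is t :: s' then
    if D t then
      (if C t then id1 (B c t) \x1 bracket D C t t s' else bracket D C c t s')
        \o1 (mor X c d t \x1 id1 (path_obj D t s'))
    else bracket D C c d s'
  else mor X c d q.

(** What is left once [t] has been multiplied into the current segment. If [t] lies in [C], that
    segment is finished and the recursion restarts at [t] with the empty product [B t t]. *)
Definition bracket_at D C c t s : cell1 :=
  if C t then id1 (B c t) \x1 bracket D C t t s else bracket D C c t s.

(** [bracket C E e c \o1 (1 \x1 bracket D C c d)] => [bracket D E e d \o1
    (mor e c d \x1 1)]; the recursion moves [d] to the next position [t] of [D],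
    which uses [asc e c d t], and then resets [c], and also [e], if [t] lies in [C],
    respectively in [E]. *)
Fixpoint rebracket D C E e c d s : cell2 :=
  if s is t :: s' then
    if D t then
      (bracket_at D E e t s' \o2 (asc X e c d t \x2 id1 (path_obj D t s'))) \v
      ((if E t then mor X e c t \x2 rebracket D C E t t t s'
        else if C t then rebracket D C E e t t s' \o2
          (mor X e c t \x1 id1 (path_obj D t s'))
        else rebracket D C E e c t s')
       \o2 (id1 (B e c) \x1 (mor X c d t \x1 id1 (path_obj D t s'))))
    else rebracket D C E e c d s'
  else asc X e c d q.

(** A position of [E] finishes the segments of both [C] and [E], so the cell is a product. A
    position of [C] alone finishes the inner segment, whose value is first multiplied into the outer
    one by [mor X e c t]. *)
Definition rebracket_at D C E e c t s : cell2 :=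
  if E t then mor X e c t \x2 rebracket D C E t t t s
  else if C t then rebracket D C E e t t s \o2 (mor X e c t \x1 id1 (path_obj D t s))
  else rebracket D C E e c t s.

Lemma bracket_cons D C c d t s : D t ->
  bracket D C c d (t :: s) = bracket_at D C c t s \o1
    (mor X c d t \x1 id1 (path_obj D t s)).
Proof. by move=> /= ->. Qed.

Lemma rebracket_cons D C E e c d t s : D t -> rebracket D C E e c d (t :: s) =
  (bracket_at D E e t s \o2 (asc X e c d t \x2 id1 (path_obj D t s))) \v
  (rebracket_at D C E e c t s
    \o2 (id1 (B e c) \x1 (mor X c d t \x1 id1 (path_obj D t s)))).
Proof. by move=> /= ->. Qed.

Lemma sorted_to_sub D C c d s : subpred C D -> c <= d -> sorted_to D d s ->
  sorted_to C c s.
Proof.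
move=> CD; elim: s c d => [|t s IH] c d cd /=; first exact: leq_trans.
case: ifP => Dt; last by case: ifP => [/CD|_]; [rewrite Dt|apply: IH].
case/andP=> dt /[dup] /(IH _ _ (leqnn t)) st /(IH c t (leq_trans cd dt)) sc.
by case: ifP; rewrite ?(leq_trans cd dt) ?st.
Qed.

Lemma hom_bracket D C c d s : subpred C D -> c <= d -> sorted_to D d s ->
  dom1 (bracket D C c d s) = B c d ++ path_obj D d s /\ cod1 (bracket D C c d s) =
    path_obj C c s.
Proof.
move=> CD; elim: s c d => [|t s IH] c d cd /=.
  by move=> dq; rewrite (dom_mor cX) ?(cod_mor cX).
case: ifP => Dt; last by case: ifP => [/CD|_]; [rewrite Dt|apply: IH].
case/andP=> dt st; have ct := leq_trans cd dt.
have [d1 c1] := IH c t ct st; have [d2 c2] := IH t t (leqnn t) st.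
have h : cod1 (mor X c d t \x1 id1 (path_obj D t s)) = dom1 (bracket_at D C c t s).
  by rewrite /bracket_at; case: ifP; rewrite /= (cod_mor cX) ?d1 // d2 (obj_refl cX).
rewrite dom1_comp ?cod1_comp //= (dom_mor cX) // catA; split=> //.
by case: ifP => Ct; rewrite /= ?c1 ?c2.
Qed.

Lemma dom_bracket D C c d s : subpred C D -> c <= d -> sorted_to D d s ->
  dom1 (bracket D C c d s) = B c d ++ path_obj D d s.
Proof. by move=> h1 h2 h3; case: (hom_bracket h1 h2 h3). Qed.

Lemma cod_bracket D C c d s : subpred C D -> c <= d -> sorted_to D d s ->
  cod1 (bracket D C c d s) = path_obj C c s.
Proof. by move=> h1 h2 h3; case: (hom_bracket h1 h2 h3). Qed.

Lemma dom_bracket_at D C c t s : subpred C D -> c <= t -> sorted_to D t s ->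
  dom1 (bracket_at D C c t s) = B c t ++ path_obj D t s.
Proof.
move=> CD ct st; rewrite /bracket_at; case: ifP => _; last exact: dom_bracket.
by rewrite /= dom_bracket // (obj_refl cX).
Qed.

Lemma cod_asc e c d t : e <= c -> c <= d -> d <= t ->
  cod1 (src (asc X e c d t)) = B e t.
Proof.
move=> ec cd dt; have ct := leq_trans cd dt.
by rewrite (src_asc cX) // cod1_comp /= ?(cod_mor cX) ?(dom_mor cX).
Qed.

(** This is [path_obj C c (t :: s)] unfolded once; the two are convertible. *)
Definition bracket_at_cod C c t s := if C t then B c t ++ path_obj C t s else path_obj C
  c s.

Lemma cod_bracket_at D C c t s : subpred C D -> c <= t -> sorted_to D t s ->
  cod1 (bracket_at D C c t s) = bracket_at_cod C c t s.
Proof.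
by move=> CD ct st; rewrite /bracket_at /bracket_at_cod; case: ifP => _ /=; rewrite
  cod_bracket.
Qed.

(** * Generalized elements *)

Definition mor_app c d t U V := mor X c d t \o2 (U \x2 V).
Definition asc_app e c d t W U V := asc X e c d t \o2 (W \x2 (U \x2 V)).
Definition bracket_app D C c d s U Z := bracket D C c d s \o2 (U \x2 Z).
Definition bracket_at_app D C c t s U Z := bracket_at D C c t s \o2 (U \x2 Z).
Definition rebracket_app D C E e c d s W U Z := rebracket D C E e c d s \o2
  (W \x2 (U \x2 Z)).
Definition rebracket_at_app D C E e c t s W U Z :=
  rebracket_at D C E e c t s \o2 (W \x2 (U \x2 Z)).
(** An element of the unit [B t t], hence the empty accumulator of a segment that starts at [t]. *)
Local Notation one := (id2 (id1 [::])).

Lemma el_one c : el (B c c) one.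
Proof. by rewrite /el /= (obj_refl cX). Qed.

Lemma el_mor_app c d t U V : c <= d -> d <= t -> el (B c d) U -> el (B d t) V ->
  el (B c t) (mor_app c d t U V).
Proof.
move=> cd dt hU hV; apply: (el_hcomp (L := B c d ++ B d t)).
- exact: dom_mor.
- exact: cod_mor.
- exact: el_prod.
Qed.

Lemma el_bracket_app D C c d s U Z : subpred C D -> c <= d -> sorted_to D d s ->
  el (B c d) U -> el (path_obj D d s) Z -> el (path_obj C c s)
    (bracket_app D C c d s U Z).
Proof.
move=> CD cd ds hU hZ; apply: (el_hcomp (L := B c d ++ path_obj D d s)).
- exact: dom_bracket.
- exact: cod_bracket.
- exact: el_prod.
Qed.

Lemma el_bracket_at_app D C c t s U Z : subpred C D -> c <= t -> sorted_to D t s ->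
  el (B c t) U -> el (path_obj D t s) Z -> el (bracket_at_cod C c t s)
    (bracket_at_app D C c t s U Z).
Proof.
move=> CD ct ts hU hZ; apply: (el_hcomp (L := B c t ++ path_obj D t s)).
- exact: dom_bracket_at.
- exact: cod_bracket_at.
- exact: el_prod.
Qed.

Lemma el_asc_app e c d t W U V : e <= c -> c <= d -> d <= t ->
  el (B e c) W -> el (B c d) U -> el (B d t) V ->
  el (B e t) (asc_app e c d t W U V).
Proof.
move=> ec cd dt hW hU hV; have ct := leq_trans cd dt.
apply: (el_hcomp (L := B e c ++ B c d ++ B d t)); last by do ?apply: el_prod.
- rewrite (src_asc cX) // dom1_comp /= ?(cod_mor cX) ?(dom_mor cX) //.
- exact: cod_asc.
Qed.

Lemma bracket_app_cons D C c d t s U V Z : subpred C D -> c <= d -> d <= t ->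
  sorted_to D t s -> D t ->
  el (B c d) U -> el (B d t) V -> el (path_obj D t s) Z ->
  bracket_app D C c d (t :: s) U (V \x2 Z) = bracket_at_app D C c t s
    (mor_app c d t U V) Z.
Proof.
move=> CD cd dt ts Dt hU hV hZ; have ct := leq_trans cd dt.
rewrite /bracket_app /bracket_at_app /mor_app bracket_cons // -hcomp_id2; last first.
  by rewrite /= (cod_mor cX) // dom_bracket_at.
rewrite -hcompA /=; first last.
- by rewrite (cod_mor cX) // dom_bracket_at.
- by rewrite (dom_mor cX) // hU hV hZ catA.
congr (_ \o2 _); rewrite -prod2_id -prod2A -prod2_hcomp.
- by rewrite hcompIl.
- by rewrite /= hU hV (dom_mor cX).
- exact: hZ.
Qed.

Lemma bracket_at_app1 D C c t s U Z : subpred C D -> c <= t -> sorted_to D t s -> C t ->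
  el (B c t) U -> el (path_obj D t s) Z ->
  bracket_at_app D C c t s U Z = U \x2 bracket_app D C t t s one Z.
Proof.
move=> CD ct ts Ct hU hZ; rewrite /bracket_at_app /bracket_at Ct -prod2_id -prod2_hcomp.
- by rewrite hcompIl // /bracket_app prod2Il.
- exact: hU.
- by rewrite hZ dom_bracket // (obj_refl cX).
Qed.

Lemma bracket_at_app0 D C c t s U Z : C t = false ->
  bracket_at_app D C c t s U Z = bracket_app D C c t s U Z.
Proof. by rewrite /bracket_at_app /bracket_at => ->. Qed.

Lemma mor_app_one c d U : c <= d -> el (B c d) U -> mor_app c d d U one = U.
Proof.
by move=> cd hU; rewrite /mor_app (mor_idr cX) // prod2I hcompIl.
Qed.

Ltac le_chain := first [assumption | exact: leqnn | eapply leq_trans;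
  [eassumption | le_chain]].
Local Hint Extern 1 (is_true (leq _ _)) => le_chain : el.
Local Hint Resolve el_one el_id1 el_prod el_mor_app el_bracket_app el_bracket_at_app
  el_asc_app : el.

(** The boundary is expressed on elements because the induction substitutes [one] or a product for
    an argument; equations between unevaluated functors would have to be reassociated each time.
    [rebracket_typing_id] leads from unevaluated equations to this form, [src_rebracket] and
    [tgt_rebracket] lead back. *)
Definition rebracket_typing D C E e c d s : Prop :=
  [/\ dom1 (src (rebracket D C E e c d s)) = B e c ++ B c d ++ path_obj D d s,
    cod1 (src (rebracket D C E e c d s)) = path_obj E e s,
    forall W U Z, el (B e c) W -> el (B c d) U -> el (path_obj D d s) Z ->
      src (rebracket D C E e c d s) \o2 (W \x2 (U \x2 Z)) =
      bracket_app C E e c s W (bracket_app D C c d s U Z) &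
    forall W U Z, el (B e c) W -> el (B c d) U -> el (path_obj D d s) Z ->
      tgt (rebracket D C E e c d s) \o2 (W \x2 (U \x2 Z)) =
      bracket_app D E e d s (mor_app e c d W U) Z].

Definition rebracket_at_typing D C E e c t s : Prop :=
  [/\ dom1 (src (rebracket_at D C E e c t s)) = B e c ++ B c t ++ path_obj D t s,
    cod1 (src (rebracket_at D C E e c t s)) = bracket_at_cod E e t s,
    forall W U Z, el (B e c) W -> el (B c t) U -> el (path_obj D t s) Z ->
      src (rebracket_at D C E e c t s) \o2 (W \x2 (U \x2 Z)) =
      bracket_app C E e c (t :: s) W (bracket_at_app D C c t s U Z) &
    forall W U Z, el (B e c) W -> el (B c t) U -> el (path_obj D t s) Z ->
      tgt (rebracket_at D C E e c t s) \o2 (W \x2 (U \x2 Z)) =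
      bracket_at_app D E e t s (mor_app e c t W U) Z].

(** The claim about [rebracket] on [s] is a hypothesis, so that the lemma serves inside the
    induction of [rebracket_typingP] and again after it. *)
Lemma rebracket_at_typingP D C E e c t s : subpred C D -> subpred E C -> e <= c -> c <=
  t ->
  sorted_to D t s -> D t ->
  (forall e c d, e <= c -> c <= d -> sorted_to D d s -> rebracket_typing D C E e c d s) ->
  rebracket_at_typing D C E e c t s.
Proof.
move=> DC CE ec ct ts Dt IH; have et := leq_trans ec ct.
have DE : subpred E D by move=> x /CE /DC.
have cts := sorted_to_sub DC (leqnn t) ts.
have tt := leqnn t.
(* If [t] lies in [E], the finished part contributes the identity of [mor X e c t], and the boundary
   of the rest is the hypothesis at [t], [t], [t]. *)
case Et: (E t); first (have Ct := CE _ Et).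
- have [d2 c2 s2 t2] := IH t t t (leqnn t) (leqnn t) ts.
  have Bt := obj_refl cX t.
  rewrite /rebracket_at_typing /rebracket_at Et /bracket_at_cod Et; split.
  + by rewrite /= d2 (dom_mor cX) // !Bt /= -catA.
  + by rewrite /= c2 (cod_mor cX).
  + move=> W U Z hW hU hZ; have hTZ : el (path_obj C t s) (bracket_app D C t t s one Z)
    by eauto with el.
    rewrite bracket_at_app1 // bracket_app_cons // bracket_at_app1 //; last by eauto
      with el.
    rewrite src_prod2 -prod2_id -prod2A -prod2_hcomp; first last.
    * by rewrite /= d2 !Bt hZ.
    * by rewrite /= (dom_mor cX) // hW hU.
    congr (_ \x2 _); rewrite -s2 ?prod2Il //; exact: el_one.
  + move=> W U Z hW hU hZ.
    rewrite bracket_at_app1 //; last by eauto with el.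
    rewrite tgt_prod2 tgt_id2 -prod2_id -prod2A -prod2_hcomp; first last.
    * by rewrite /= d2 !Bt hZ.
    * by rewrite /= (dom_mor cX) // hW hU.
    congr (_ \x2 _); rewrite -{1}(prod2Il Z) -{1}(prod2Il (_ \x2 Z)) t2 ?mor_app_one //;
      exact: el_one.
(* If [t] lies in [C] only, the finished inner product moves into the outer accumulator, as computed
   by [mW], and the inner one restarts with [one]. *)
case Ct: (C t).
- have [d2 c2 s2 t2] := IH e t t et (leqnn t) ts.
  have Bt := obj_refl cX t.
  have mW (W U Z : cell2) : el (B e c) W -> el (B c t) U -> el (path_obj D t s) Z ->
     (mor X e c t \x1 id1 (path_obj D t s)) \o2 (W \x2 (U \x2 Z)) = mor_app e c t W U
       \x2 (one \x2 Z).
    move=> hW hU hZ; rewrite -prod2_id -prod2A -prod2_hcomp //.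
      by rewrite hcompIl // prod2Il.
    by rewrite /= (dom_mor cX) // hW hU.
  have el1 : cod1 (src (mor X e c t \x1 id1 (path_obj D t s) : cell2)) = dom1
    (src (rebracket D C E e t t s)).
    by rewrite /= d2 (cod_mor cX) // Bt.
  have el2 (W U Z : cell2) : el (B e c) W -> el (B c t) U -> el (path_obj D t s) Z ->
    cod1 (src (W \x2 (U \x2 Z))) = dom1 (src (id2
      (mor X e c t \x1 id1 (path_obj D t s)))).
    by move=> hW hU hZ /=; rewrite hW hU hZ (dom_mor cX) // catA.
  rewrite /rebracket_at_typing /rebracket_at Et /bracket_at_cod Et Ct; split.
  + by rewrite src_hcomp // dom1_comp //= (dom_mor cX) // catA.
  + by rewrite src_hcomp // cod1_comp.
  + move=> W U Z hW hU hZ; have hTZ : el (path_obj C t s) (bracket_app D C t t s one Z)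
    by eauto with el.
    rewrite bracket_at_app1 // bracket_app_cons // bracket_at_app0 //.
    rewrite src_hcomp // -hcomp_id2 // -hcompA ?mW ?el2 //.
    rewrite s2 //; eauto with el.
  + move=> W U Z hW hU hZ.
    rewrite bracket_at_app0 // tgt_hcomp // -hcomp_id2 // -hcompA ?tgt_id2 ?mW ?el2 //.
    rewrite t2 ?mor_app_one //; eauto with el.
have [d2 c2 s2 t2] := IH e c t ec ct ts.
rewrite /rebracket_at_typing /rebracket_at Et /bracket_at_cod Et Ct; split=> // W U Z hW
  hU hZ.
  by rewrite bracket_at_app0 // s2 // /bracket_app /= Ct.
by rewrite bracket_at_app0 // t2.
Qed.

Lemma id2_inj F G : id2 F = id2 G -> F = G.
Proof. exact: (congr1 src). Qed.

Lemma hcomp_hprod F G M (W U Z : cell2) L :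
  dom1 F = cod1 G ++ cod1 M -> el (dom1 G) W -> dom1 M = L -> el L (U \x2 Z) ->
  (F \o2 (G \x2 M)) \o2 (W \x2 (U \x2 Z)) = F \o2 ((G \o2 W) \x2 (M \o2 (U \x2 Z))).
Proof.
move=> h1 h2 <- h3; rewrite -hcompA -?prod2_hcomp //=.
by rewrite h2; congr (_ ++ _); exact: h3.
Qed.

Lemma rebracket_typing_id D C E e c d s : subpred C D -> subpred E C -> e <= c -> c <= d
  ->
  sorted_to D d s ->
  id2 (src (rebracket D C E e c d s)) =
    bracket C E e c s \o2 (id1 (B e c) \x2 bracket D C c d s) ->
  id2 (tgt (rebracket D C E e c d s)) =
    bracket D E e d s \o2 (mor X e c d \x2 id1 (path_obj D d s)) ->
  rebracket_typing D C E e c d s.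
Proof.
move=> DC CE ec cd ds hs ht; have ed := leq_trans ec cd.
have DE : subpred E D by move=> x /CE /DC.
have cs := sorted_to_sub DC cd ds.
have d1 := dom_bracket DC cd ds; have c1 := cod_bracket DC cd ds.
have d2 := dom_bracket CE ec cs; have c2 := cod_bracket CE ec cs.
have h : cod1 (id1 (B e c) \x1 bracket D C c d s) = dom1 (bracket C E e c s).
  by rewrite /= c1 d2.
have hs' : src (rebracket D C E e c d s) = bracket C E e c s \o1
  (id1 (B e c) \x1 bracket D C c d s).
  by apply: id2_inj; rewrite hs prod2_id hcomp_id2.
split.
- by rewrite hs' dom1_comp //= d1.
- by rewrite hs' cod1_comp.
- move=> W U Z hW hU hZ; rewrite hs (@hcomp_hprod _ _ _ _ _ _ (B c d ++ path_obj D d s))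
  //.
  + by rewrite hcompIl.
  + by apply: el_prod.
- move=> W U Z hW hU hZ; rewrite ht -hcompA.
  + by rewrite -prod2A -prod2_hcomp ?hcompIl //= hW hU (dom_mor cX).
  + by rewrite /= hW hU hZ (dom_mor cX) // catA.
  + by rewrite /= (cod_mor cX) // dom_bracket.
Qed.

(** The functor in the middle is [bracket_at D E e t s] after [mor X e c t] applied to
    [mor X c d t]. It is the target of the factor for the remaining positions, and its second part
    is the source of the associator [asc X e c d t]. *)
Lemma composable_rebracket D C E e c d t s : subpred C D -> subpred E C -> e <= c -> c
  <= d ->
  d <= t -> sorted_to D t s -> D t -> rebracket_at_typing D C E e c t s ->
  tgt (rebracket_at D C E e c t s
    \o2 (id1 (B e c) \x1 (mor X c d t \x1 id1 (path_obj D t s)))) =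
  src (bracket_at D E e t s \o2 (asc X e c d t \x2 id1 (path_obj D t s))).
Proof.
move=> DC CE ec cd dt ts Dt [dR cR sR tR].
have DE : subpred E D by move=> x /CE /DC.
have ct := leq_trans cd dt; have et := leq_trans ec ct.
apply: id2_inj; rewrite tgt_happ /= ?tgt_id2; last first.
  by rewrite /el /= dR (cod_mor cX).
rewrite -hcomp_id2 /=; last by rewrite dR (cod_mor cX).
rewrite -prod2_id -prod2_id tR //; last exact: cod_mor.
have ca := cod_asc ec cd dt.
rewrite src_happ; last by rewrite /el /= dom_bracket_at // ca.
rewrite -hcomp_id2 /=; last by rewrite dom_bracket_at // ca.
rewrite /bracket_at_app /mor_app -prod2_id (src_asc cX) // -hcomp_id2 -?prod2_id //=.
by rewrite (cod_mor cX) // (dom_mor cX).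
Qed.

Lemma rebracket_typingP D C E e c d s : subpred C D -> subpred E C -> e <= c -> c <= d ->
  sorted_to D d s -> rebracket_typing D C E e c d s.
Proof.
move=> DC CE; have DE : subpred E D by move=> x /CE /DC.
elim: s e c d => [|t s IH] e c d ec cd; last first.
  case Dt: (D t); last first.
    by have := IH e c d ec cd; rewrite /rebracket_typing /bracket_app /= Dt; case: ifP
      => [/CE/DC|_]; case: ifP => [/DC|_]; rewrite ?Dt.
  rewrite /= Dt => /andP[dt ts].
  have ct := leq_trans cd dt; have et := leq_trans ec ct.
  have R := rebracket_at_typingP DC CE ec ct ts Dt IH.
  have tm := composable_rebracket DC CE ec cd dt ts Dt R; have [dR cR sR tR] := R.
  have ca := cod_asc ec cd dt.
  apply: rebracket_typing_id => //; rewrite ?rebracket_cons ?(bracket_cons _ _ _ _ Dt)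
    //; first by rewrite /= Dt dt.
    rewrite src_vcomp // src_happ; last by rewrite /el /= dR (cod_mor cX).
    rewrite -hcomp_id2; last by rewrite /= dR (cod_mor cX).
    rewrite -prod2_id -prod2_id  sR //; last exact: cod_mor.
    rewrite /bracket_at_app /bracket_app; congr (_ \o2 (_ \x2 _)).
    by rewrite prod2_id hcomp_id2 //= (cod_mor cX) // dom_bracket_at.
  rewrite [path_obj _ _ (_ :: _)]/= Dt tgt_vcomp // tgt_happ ?tgt_id2; last by rewrite
    /el /= dom_bracket_at // ca.
  rewrite -hcomp_id2; last by rewrite /= dom_bracket_at // ca.
  rewrite tgt_prod2 tgt_id2 -prod2_id (tgt_asc cX) // -hcomp_id2 -?prod2_id; last first.
    by rewrite /= (dom_mor cX) ?(cod_mor cX) // (leq_trans ec).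
  have ed := leq_trans ec cd.
  rewrite -!hcomp_id2; last by rewrite /= (cod_mor cX) // dom_bracket_at.
  rewrite -hcompA; first last.
  - by rewrite /= (cod_mor cX) // dom_bracket_at.
  - by rewrite /= (cod_mor cX) // (dom_mor cX) // catA.
  congr (_ \o2 _); rewrite -[id1 (B d t ++ _)]prod1_id -!prod2_id -prod2A -prod2_hcomp
    ?hcompIl //=.
  by rewrite (cod_mor cX) // (dom_mor cX).
move=> /= dq; apply: rebracket_typing_id => //=.
- rewrite (src_asc cX) // -hcomp_id2 ?prod2_id //=.
  by rewrite (cod_mor cX) // (dom_mor cX) // (leq_trans cd).
- rewrite (tgt_asc cX) // -hcomp_id2 ?prod2_id //=.
  by rewrite (cod_mor cX) // (dom_mor cX) // (leq_trans ec).
Qed.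

(** * Boundaries and naturality of applied cells *)

Variant is_id2 U : Prop := IsId of id2 (src U) = U.
(** Boundaries are turned back into elements, so that sources and targets of nested applications are
    computed by rewriting from the outside in. *)
Local Notation sr U := (id2 (src U)).
Local Notation tg U := (id2 (tgt U)).

Lemma is_id2_id2 F : is_id2 (id2 F). Proof. by constructor. Qed.

Lemma sr_is_id2 U : is_id2 U -> sr U = U.
Proof. by case. Qed.

Lemma tg_is_id2 U : is_id2 U -> tg U = U.
Proof. by case=> <-; rewrite tgt_id2. Qed.

Lemma is_id2_prod U V : is_id2 U -> is_id2 V -> is_id2 (U \x2 V).
Proof. by move=> [<-] [<-]; rewrite prod2_id. Qed.

Lemma el_sr L U : el L U -> el L (sr U). Proof. by []. Qed.
Lemma el_tg L U : el L U -> el L (tg U). Proof. by []. Qed.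

Local Hint Resolve el_sr el_tg is_id2_id2 is_id2_prod : el.

Lemma sr_hcomp b U : el (dom1 (src b)) U -> sr (b \o2 U) = sr b \o2 sr U.
Proof. by move=> h; rewrite src_happ // hcomp_id2. Qed.

Lemma tg_hcomp b U : el (dom1 (src b)) U -> tg (b \o2 U) = tg b \o2 tg U.
Proof. by move=> h; rewrite tgt_happ // hcomp_id2. Qed.

Lemma sr_prod U V : sr (U \x2 V) = sr U \x2 sr V.
Proof. by rewrite prod2_id. Qed.

Lemma tg_prod U V : tg (U \x2 V) = tg U \x2 tg V.
Proof. by rewrite prod2_id. Qed.

Lemma vcomp_isidl U V : is_id2 U -> tg V = U -> U \v V = V.
Proof. by move=> [<-] /id2_inj <-; rewrite vcompIl. Qed.

Lemma vcomp_isidr U V : is_id2 U -> sr V = U -> V \v U = V.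
Proof. by move=> [<-] /id2_inj h; rewrite -h vcompI. Qed.

Section Mul.
Variables c d t : 'I_n.+1.
Hypotheses (cd : c <= d) (dt : d <= t).

Lemma el_dom_mor U V : el (B c d) U -> el (B d t) V ->
  el (dom1 (src (mor X c d t))) (U \x2 V).
Proof. by move=> hU hV; rewrite (dom_mor cX) //; apply: el_prod. Qed.

Lemma sr_mor_app U V : el (B c d) U -> el (B d t) V ->
  sr (mor_app c d t U V) = mor_app c d t (sr U) (sr V).
Proof. by move=> hU hV; rewrite sr_hcomp ?sr_prod //; apply: el_dom_mor. Qed.

Lemma tg_mor_app U V : el (B c d) U -> el (B d t) V ->
  tg (mor_app c d t U V) = mor_app c d t (tg U) (tg V).
Proof. by move=> hU hV; rewrite tg_hcomp ?tg_prod ?tgt_id2 //; apply: el_dom_mor. Qed.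

Lemma is_id2_mor_app U V : el (B c d) U -> el (B d t) V -> is_id2 U -> is_id2 V ->
  is_id2 (mor_app c d t U V).
Proof. by move=> hU hV [iU] [iV]; constructor; rewrite sr_mor_app // iU iV. Qed.

End Mul.

Section TapLemmas.
Variables (D C : 'I_n.+1 -> bool) (c d : 'I_n.+1) (s : seq 'I_n.+1).
Hypotheses (DC : subpred C D) (cd : c <= d) (ds : sorted_to D d s).

Lemma el_dom_bracket U Z : el (B c d) U -> el (path_obj D d s) Z ->
  el (dom1 (src (bracket D C c d s))) (U \x2 Z).
Proof. by move=> hU hZ; rewrite dom_bracket //; apply: el_prod. Qed.

Lemma sr_bracket_app U Z : el (B c d) U -> el (path_obj D d s) Z ->
  sr (bracket_app D C c d s U Z) = bracket_app D C c d s (sr U) (sr Z).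
Proof. by move=> hU hZ; rewrite sr_hcomp ?sr_prod //; apply: el_dom_bracket. Qed.

Lemma tg_bracket_app U Z : el (B c d) U -> el (path_obj D d s) Z ->
  tg (bracket_app D C c d s U Z) = bracket_app D C c d s (tg U) (tg Z).
Proof. by move=> hU hZ; rewrite tg_hcomp ?tg_prod ?tgt_id2 //; apply: el_dom_bracket. Qed.

Lemma is_id2_bracket_app U Z : el (B c d) U -> el (path_obj D d s) Z -> is_id2 U ->
  is_id2 Z ->
  is_id2 (bracket_app D C c d s U Z).
Proof. by move=> hU hV [iU] [iV]; constructor; rewrite sr_bracket_app // iU iV. Qed.

Lemma bracket_app_vcomp U U' V V' : el (B c d) U -> el (path_obj D d s) V ->
  tgt U = src U' -> tgt V = src V' ->
  bracket_app D C c d s (U' \v U) (V' \v V) = bracket_app D C c d s U' V' \v bracket_app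
    D C c d s U V.
Proof.
move=> hU hV UU VV; rewrite /bracket_app prod2_vcomp // happ_vcomp //.
- exact: el_dom_bracket.
- by rewrite tgt_prod2 src_prod2 UU VV.
Qed.

End TapLemmas.

Section ResTapLemmas.
Variables (D C : 'I_n.+1 -> bool) (c t : 'I_n.+1) (s : seq 'I_n.+1).
Hypotheses (DC : subpred C D) (ct : c <= t) (ts : sorted_to D t s).

Lemma el_dom_bracket_at U Z : el (B c t) U -> el (path_obj D t s) Z ->
  el (dom1 (src (bracket_at D C c t s))) (U \x2 Z).
Proof. by move=> hU hZ; rewrite dom_bracket_at //; apply: el_prod. Qed.

Lemma sr_bracket_at_app U Z : el (B c t) U -> el (path_obj D t s) Z ->
  sr (bracket_at_app D C c t s U Z) = bracket_at_app D C c t s (sr U) (sr Z).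
Proof. by move=> hU hZ; rewrite sr_hcomp ?sr_prod //; apply: el_dom_bracket_at. Qed.

Lemma tg_bracket_at_app U Z : el (B c t) U -> el (path_obj D t s) Z ->
  tg (bracket_at_app D C c t s U Z) = bracket_at_app D C c t s (tg U) (tg Z).
Proof. by move=> hU hZ; rewrite tg_hcomp ?tg_prod ?tgt_id2 //; apply: el_dom_bracket_at.
  Qed.

Lemma is_id2_bracket_at_app U Z : el (B c t) U -> el (path_obj D t s) Z -> is_id2 U ->
  is_id2 Z ->
  is_id2 (bracket_at_app D C c t s U Z).
Proof. by move=> hU hV [iU] [iV]; constructor; rewrite sr_bracket_at_app // iU iV. Qed.

Lemma bracket_at_app_vcomp U U' V V' : el (B c t) U -> el (path_obj D t s) V ->
  tgt U = src U' -> tgt V = src V' ->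
  bracket_at_app D C c t s (U' \v U) (V' \v V) =
  bracket_at_app D C c t s U' V' \v bracket_at_app D C c t s U V.
Proof.
move=> hU hV UU VV; rewrite /bracket_at_app prod2_vcomp // happ_vcomp //.
- exact: el_dom_bracket_at.
- by rewrite tgt_prod2 src_prod2 UU VV.
Qed.

End ResTapLemmas.

Section AssLemmas.
Variables e c d t : 'I_n.+1.
Hypotheses (ec : e <= c) (cd : c <= d) (dt : d <= t).

Lemma dom_asc : dom1 (src (asc X e c d t)) = B e c ++ B c d ++ B d t.
Proof.
have ct := leq_trans cd dt.
by rewrite (src_asc cX) // dom1_comp /= ?(cod_mor cX) ?(dom_mor cX).
Qed.

Lemma el_dom_asc W U V : el (B e c) W -> el (B c d) U -> el (B d t) V ->
  el (dom1 (src (asc X e c d t))) (W \x2 (U \x2 V)).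
Proof. by move=> hW hU hV; rewrite dom_asc; do ?apply: el_prod. Qed.

Lemma src_asc_app W U V : el (B e c) W -> el (B c d) U -> el (B d t) V ->
  sr (asc X e c d t) \o2 (W \x2 (U \x2 V)) = mor_app e c t W (mor_app c d t U V).
Proof.
move=> hW hU hV; have ct := leq_trans cd dt.
rewrite (src_asc cX) // -hcomp_id2; last by rewrite /= (cod_mor cX) ?(dom_mor cX).
rewrite -prod2_id (@hcomp_hprod _ _ _ _ _ _ (B c d ++ B d t)) //.
- by rewrite hcompIl.
- by rewrite (dom_mor cX) //= (cod_mor cX).
- by rewrite (dom_mor cX).
- exact: el_prod.
Qed.

Lemma tgt_asc_app W U V : el (B e c) W -> el (B c d) U -> el (B d t) V ->
  tg (asc X e c d t) \o2 (W \x2 (U \x2 V)) = mor_app e d t (mor_app e c d W U) V.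
Proof.
move=> hW hU hV; have ed := leq_trans ec cd.
rewrite (tgt_asc cX) // -hcomp_id2; last by rewrite /= (cod_mor cX) ?(dom_mor cX).
rewrite -hcompA; first last.
- by rewrite /= (cod_mor cX) ?(dom_mor cX).
- by rewrite /= hW hU hV (dom_mor cX) // catA.
rewrite -prod2_id -prod2A -prod2_hcomp ?hcompIl //=.
by rewrite hW hU (dom_mor cX).
Qed.

Lemma sr_asc_app W U V : el (B e c) W -> el (B c d) U -> el (B d t) V ->
  sr (asc_app e c d t W U V) = mor_app e c t (sr W) (mor_app c d t (sr U) (sr V)).
Proof.
move=> hW hU hV; rewrite -src_asc_app; try exact: el_sr.
by rewrite sr_hcomp ?sr_prod //; apply: el_dom_asc.
Qed.

Lemma tg_asc_app W U V : el (B e c) W -> el (B c d) U -> el (B d t) V ->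
  tg (asc_app e c d t W U V) = mor_app e d t (mor_app e c d (tg W) (tg U)) (tg V).
Proof.
move=> hW hU hV; rewrite -tgt_asc_app; try exact: el_tg.
by rewrite tg_hcomp ?tg_prod //; apply: el_dom_asc.
Qed.

End AssLemmas.

Lemma asc_app_id3 e c t W U : e <= c -> c <= t ->
  asc_app e c t t W U one = mor_app e c t W U.
Proof. by move=> ec ct; rewrite /asc_app (asc_id3 cX) // prod2I. Qed.

Section HapLemmas.
Variables (D C E : 'I_n.+1 -> bool) (e c d : 'I_n.+1) (s : seq 'I_n.+1).
Hypotheses (DC : subpred C D) (CE : subpred E C) (ec : e <= c) (cd : c <= d)
  (ds : sorted_to D d s).

Lemma el_dom_rebracket W U Z : el (B e c) W -> el (B c d) U -> el (path_obj D d s) Z ->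
  el (dom1 (src (rebracket D C E e c d s))) (W \x2 (U \x2 Z)).
Proof.
by move=> hW hU hV; have [-> _ _ _] := rebracket_typingP DC CE ec cd ds; do ?apply:
  el_prod.
Qed.

Lemma el_rebracket_app W U Z : el (B e c) W -> el (B c d) U -> el (path_obj D d s) Z ->
  el (path_obj E e s) (rebracket_app D C E e c d s W U Z).
Proof.
move=> hW hU hV; have [_ cH _ _] := rebracket_typingP DC CE ec cd ds.
by apply: el_hcomp; [reflexivity|exact: cH|exact: el_dom_rebracket].
Qed.

Lemma sr_rebracket_app W U Z : el (B e c) W -> el (B c d) U -> el (path_obj D d s) Z ->
  sr (rebracket_app D C E e c d s W U Z) =
  bracket_app C E e c s (sr W) (bracket_app D C c d s (sr U) (sr Z)).
Proof.
move=> hW hU hV; have [_ _ <- // _] := rebracket_typingP DC CE ec cd ds.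
by rewrite sr_hcomp ?sr_prod //; apply: el_dom_rebracket.
Qed.

Lemma tg_rebracket_app W U Z : el (B e c) W -> el (B c d) U -> el (path_obj D d s) Z ->
  tg (rebracket_app D C E e c d s W U Z) =
  bracket_app D E e d s (mor_app e c d (tg W) (tg U)) (tg Z).
Proof.
move=> hW hU hV; have [_ _ _ <- //] := rebracket_typingP DC CE ec cd ds.
by rewrite tg_hcomp ?tg_prod //; apply: el_dom_rebracket.
Qed.

(** The two factorizations [happ_natl] and [happ_natr] of one horizontal composite. This square
    moves a cell sitting in an accumulator past the rebracketing of what follows. *)
Lemma rebracket_app_nat W U Z : el (B e c) W -> el (B c d) U -> el (path_obj D d s) Z ->
  rebracket_app D C E e c d s (tg W) (tg U) (tg Z) \v bracket_app C E e c s W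
    (bracket_app D C c d s U Z) =
  bracket_app D E e d s (mor_app e c d W U) Z \v rebracket_app D C E e c d s (sr W)
    (sr U) (sr Z).
Proof.
move=> hW hU hZ; have h := el_dom_rebracket hW hU hZ.
have [_ _ <- // <- //] := rebracket_typingP DC CE ec cd ds.
by have := happ_natl h; rewrite (happ_natr h) tg_prod tg_prod sr_prod sr_prod.
Qed.

End HapLemmas.

Section ResHapLemmas.
Variables (D C E : 'I_n.+1 -> bool) (e c t : 'I_n.+1) (s : seq 'I_n.+1).
Hypotheses (DC : subpred C D) (CE : subpred E C) (ec : e <= c) (ct : c <= t)
  (ts : sorted_to D t s) (Dt : D t).

Let typing : rebracket_at_typing D C E e c t s.
Proof. by apply: rebracket_at_typingP => // *; apply: rebracket_typingP. Qed.

Lemma el_dom_rebracket_at W U Z : el (B e c) W -> el (B c t) U -> el (path_obj D t s) Z ->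
  el (dom1 (src (rebracket_at D C E e c t s))) (W \x2 (U \x2 Z)).
Proof. by move=> hW hU hV; have [-> _ _ _] := typing; do ?apply: el_prod. Qed.

Lemma el_rebracket_at_app W U Z : el (B e c) W -> el (B c t) U -> el (path_obj D t s) Z ->
  el (bracket_at_cod E e t s) (rebracket_at_app D C E e c t s W U Z).
Proof.
move=> hW hU hV; have [_ cH _ _] := typing.
by apply: el_hcomp; [reflexivity|exact: cH|exact: el_dom_rebracket_at].
Qed.

Lemma sr_rebracket_at_app W U Z : el (B e c) W -> el (B c t) U -> el (path_obj D t s) Z ->
  sr (rebracket_at_app D C E e c t s W U Z) =
  bracket_app C E e c (t :: s) (sr W) (bracket_at_app D C c t s (sr U) (sr Z)).
Proof.
move=> hW hU hV; have [_ _ <- // _] := typing.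
by rewrite sr_hcomp ?sr_prod //; apply: el_dom_rebracket_at.
Qed.

Lemma tg_rebracket_at_app W U Z : el (B e c) W -> el (B c t) U -> el (path_obj D t s) Z ->
  tg (rebracket_at_app D C E e c t s W U Z) =
  bracket_at_app D E e t s (mor_app e c t (tg W) (tg U)) (tg Z).
Proof.
move=> hW hU hV; have [_ _ _ <- //] := typing.
by rewrite tg_hcomp ?tg_prod //; apply: el_dom_rebracket_at.
Qed.

Lemma rebracket_at_app_nat W U Z : el (B e c) W -> el (B c t) U -> el (path_obj D t s) Z
  ->
  rebracket_at_app D C E e c t s (tg W) (tg U) (tg Z) \v
    bracket_app C E e c (t :: s) W (bracket_at_app D C c t s U Z) =
  bracket_at_app D E e t s (mor_app e c t W U) Z \v rebracket_at_app D C E e c t s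
    (sr W) (sr U) (sr Z).
Proof.
move=> hW hU hZ; have h := el_dom_rebracket_at hW hU hZ.
have [_ _ <- // <- //] := typing.
by have := happ_natl h; rewrite (happ_natr h) tg_prod tg_prod sr_prod sr_prod.
Qed.

Lemma rebracket_at_app2 W U Z : E t -> el (B e c) W -> el (B c t) U -> el
  (path_obj D t s) Z ->
  rebracket_at_app D C E e c t s W U Z = mor_app e c t W U \x2 rebracket_app D C E t t t
    s one one Z.
Proof.
move=> Et hW hU hZ; rewrite /rebracket_at_app /rebracket_at Et -prod2A -prod2_hcomp.
- by rewrite /rebracket_app !prod2Il.
- exact: el_dom_mor.
- have := el_dom_rebracket DC CE (leqnn t) (leqnn t) ts (el_one t) (el_one t) hZ.
  by rewrite !prod2Il.
Qed.

Lemma rebracket_at_app1 W U Z : C t -> E t = false ->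
  el (B e c) W -> el (B c t) U -> el (path_obj D t s) Z ->
  rebracket_at_app D C E e c t s W U Z = rebracket_app D C E e t t s (mor_app e c t W U)
    one Z.
Proof.
move=> Ct Et hW hU hZ; rewrite /rebracket_at_app /rebracket_at Et Ct.
have [dH _ _ _] := rebracket_typingP DC CE (leq_trans ec ct) (leqnn t) ts.
rewrite -hcompA /=; first last.
- by rewrite dH (cod_mor cX) // (obj_refl cX).
- by rewrite hW hU hZ (dom_mor cX) // catA.
rewrite -prod2_id -prod2A -prod2_hcomp //; last exact: el_dom_mor.
by rewrite hcompIl // /rebracket_app prod2Il.
Qed.

Lemma rebracket_at_app0 W U Z : C t = false -> E t = false ->
  rebracket_at_app D C E e c t s W U Z = rebracket_app D C E e c t s W U Z.
Proof. by rewrite /rebracket_at_app /rebracket_at => -> ->. Qed.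

End ResHapLemmas.

Local Hint Resolve el_rebracket_app is_id2_mor_app is_id2_bracket_app
  is_id2_bracket_at_app : el.

(** The arguments are identity cells because precomposition with an identity distributes over the
    vertical composite in the recursive clause; a general cell could be used in only one of the two
    factors. *)
Lemma rebracket_app_cons D C E e c d t s W U Y Z : subpred C D -> subpred E C ->
  e <= c -> c <= d -> d <= t -> sorted_to D t s -> D t ->
  el (B e c) W -> el (B c d) U -> el (B d t) Y -> el (path_obj D t s) Z ->
  is_id2 W -> is_id2 U -> is_id2 Y -> is_id2 Z ->
  rebracket_app D C E e c d (t :: s) W U (Y \x2 Z) =
  bracket_at_app D E e t s (asc_app e c d t W U Y) Z \v
  rebracket_at_app D C E e c t s W (mor_app c d t U Y) Z.
Proof.
move=> DC CE ec cd dt ts Dt hW hU hY hZ iW iU iY iZ.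
have ct := leq_trans cd dt; have et := leq_trans ec ct.
have DE : subpred E D by move=> x /CE /DC.
have R : rebracket_at_typing D C E e c t s by apply: rebracket_at_typingP => // *;
  apply: rebracket_typingP.
have tm := composable_rebracket DC CE ec cd dt ts Dt R.
have [dR _ _ _] := R.
have iV : is_id2 (W \x2 (U \x2 (Y \x2 Z))) by eauto with el.
have hV : cod1 (src (W \x2 (U \x2 (Y \x2 Z)))) = B e c ++ B c d ++ B d t ++ path_obj D t
  s.
  by rewrite /= hW hU hY hZ.
have ca := cod_asc ec cd dt.
rewrite /rebracket_app rebracket_cons // -(sr_is_id2 iV) vcomp_hcomp ?(sr_is_id2 iV) //;
  last first.
  by rewrite src_hcomp ?dom1_comp /= ?hW ?hU ?hY ?hZ ?dR ?(cod_mor cX) ?(dom_mor cX) //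
    -catA.
congr (_ \v _).
- rewrite -hcompA ?hV /=; first last.
  + by rewrite dom_bracket_at // ca.
  + by rewrite dom_asc // -!catA.
  have -> : W \x2 (U \x2 (Y \x2 Z)) = (W \x2 (U \x2 Y)) \x2 Z by rewrite !prod2A.
  rewrite /bracket_at_app -prod2_hcomp //; first by rewrite hcompIl.
  exact: el_dom_asc.
- rewrite -hcompA ?hV /=; first last.
  + by rewrite dR (cod_mor cX).
  + by rewrite (dom_mor cX) // -catA.
  rewrite -!prod2_id -prod2_hcomp //=; last by rewrite hU hY hZ (dom_mor cX) // catA.
  rewrite hcompIl // /rebracket_at_app -prod2A -prod2_hcomp ?hcompIl //.
  exact: el_dom_mor.
Qed.

(** Composability is an equation between functors. It is transported along [id2], after which both
    sides reduce to nested applications to the same identity elements. *)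
Ltac boundary := first [assumption | apply: id2_inj;
  rewrite ?(mor_app_one, asc_app_id3, tg_mor_app, sr_mor_app, tg_asc_app, sr_asc_app,
    tg_bracket_app, sr_bracket_app, tg_bracket_at_app, sr_bracket_at_app,
    tg_rebracket_app, sr_rebracket_app, tg_rebracket_at_app, sr_rebracket_at_app,
      tg_prod, sr_prod, tg_is_id2, sr_is_id2, tgt_id2);
  eauto 12 with el].

Lemma mor_app_id1 c d t : c <= d -> d <= t ->
  mor_app c d t (id1 (B c d)) (id1 (B d t)) = mor X c d t.
Proof. by move=> cd dt; rewrite /mor_app prod2_id prod1_id hcompI //= (dom_mor cX). Qed.

Lemma asc_app_id1 e c d t : e <= c -> c <= d -> d <= t ->
  asc_app e c d t (id1 (B e c)) (id1 (B c d)) (id1 (B d t)) = asc X e c d t.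
Proof.
move=> ec cd dt; rewrite /asc_app !prod2_id !prod1_id hcompI //.
exact: dom_asc.
Qed.

Lemma mor_app_hcomp c d t U V Y Z : c <= d -> d <= t ->
  el (B c d) U -> el (B d t) V -> el (dom1 (src U)) Y -> el (dom1 (src V)) Z ->
  mor_app c d t U V \o2 (Y \x2 Z) = mor_app c d t (U \o2 Y) (V \o2 Z).
Proof.
move=> cd dt hU hV hY hZ; rewrite /mor_app prod2_hcomp // hcompA //=.
- by rewrite hY hZ.
- by rewrite hU hV (dom_mor cX).
Qed.

Lemma asc_app_hcomp e c d t U V W Y Z b : e <= c -> c <= d -> d <= t ->
  el (B e c) W -> el (B c d) U -> el (B d t) V ->
  el (dom1 (src W)) Y -> el (dom1 (src U)) Z -> el (dom1 (src V)) b ->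
  asc_app e c d t W U V \o2 (Y \x2 (Z \x2 b)) =
  asc_app e c d t (W \o2 Y) (U \o2 Z) (V \o2 b).
Proof.
move=> ec cd dt hW hU hV hY hZ hb.
rewrite /asc_app !prod2_hcomp //=; last by rewrite hZ hb.
rewrite hcompA //=; first by rewrite hY hZ hb.
by rewrite hW hU hV dom_asc.
Qed.

Lemma dom_mor_app c d t U V : c <= d -> d <= t -> el (B c d) U -> el (B d t) V ->
  dom1 (src (mor_app c d t U V)) = dom1 (src U) ++ dom1 (src V).
Proof.
move=> cd dt hU hV; rewrite src_happ; last exact: el_dom_mor.
by rewrite dom1_comp //= hU hV (dom_mor cX).
Qed.

Lemma dom_asc_app e c d t U V W : e <= c -> c <= d -> d <= t ->
  el (B e c) W -> el (B c d) U -> el (B d t) V ->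
  dom1 (src (asc_app e c d t W U V)) = dom1 (src W) ++ dom1 (src U) ++ dom1 (src V).
Proof.
move=> ec cd dt hW hU hV; rewrite src_happ; last exact: el_dom_asc.
by rewrite dom1_comp //= dom_asc // hW hU hV.
Qed.

(** A generic element argument: the pentagon of the family is the instance [P0] at identity
    elements, and precomposing it with [V] gives every other instance. For each of the five cells
    [V] is reassociated to match its nesting. *)
Lemma pentagon_el (p u r v t : 'I_n.+1) W U Y Z :
  p <= u -> u <= r -> r <= v -> v <= t ->
  el (B p u) W -> el (B u r) U -> el (B r v) Y -> el (B v t) Z ->
  is_id2 W -> is_id2 U -> is_id2 Y -> is_id2 Z ->
  mor_app p v t (asc_app p u r v W U Y) Z \v
    (asc_app p u v t W (mor_app u r v U Y) Z \v mor_app p u t W (asc_app u r v t U Y Z)) =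
  asc_app p r v t (mor_app p u r W U) Y Z \v asc_app p u r t W U (mor_app r v t Y Z).
Proof.
move=> pu ur rs st hW hU hY hZ iW iU iY iZ.
have pr := leq_trans pu ur; have us := leq_trans ur rs; have rt := leq_trans rs st.
have ps := leq_trans pr rs; have ut := leq_trans us st.
set V := W \x2 (U \x2 (Y \x2 Z)).
have iV : is_id2 V by rewrite /V; eauto with el.
have hV : cod1 (src V) = B p u ++ B u r ++ B r v ++ B v t.
  by rewrite /V /= hW hU hY hZ.
set i1 := id2 (id1 (B p u)); set i2 := id2 (id1 (B u r)).
set i3 := id2 (id1 (B r v)); set i4 := id2 (id1 (B v t)).
have P0 : mor_app p v t (asc_app p u r v i1 i2 i3) i4 \v
    (asc_app p u v t i1 (mor_app u r v i2 i3) i4 \v mor_app p u t i1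
      (asc_app u r v t i2 i3 i4)) =
  asc_app p r v t (mor_app p u r i1 i2) i3 i4 \v asc_app p u r t i1 i2
    (mor_app r v t i3 i4).
  rewrite vcompA; try by boundary.
  rewrite !asc_app_id1 ?mor_app_id1 //.
  have := asc_pentagon cX pu ur rs st.
  by rewrite /mor_app /asc_app -!prod2_id !prod2A.
have I1 : i1 \o2 W = W := hcompIl hW.
have I2 : i2 \o2 U = U := hcompIl hU.
have I3 : i3 \o2 Y = Y := hcompIl hY.
have I4 : i4 \o2 Z = Z := hcompIl hZ.
have := congr1 (fun b => b \o2 id2 (src V)) P0.
rewrite !vcomp_hcomp; try by boundary.
- rewrite (sr_is_id2 iV).
  have -> : mor_app p v t (asc_app p u r v i1 i2 i3) i4 \o2 V =
      mor_app p v t (asc_app p u r v W U Y) Z.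
    have -> : V = (W \x2 (U \x2 Y)) \x2 Z by rewrite /V !prod2A.
    rewrite mor_app_hcomp ?asc_app_hcomp ?I1 ?I2 ?I3 ?I4 //; eauto with el.
    by rewrite dom_asc_app //; apply: el_prod => //; apply: el_prod.
  have -> : mor_app p u t i1 (asc_app u r v t i2 i3 i4) \o2 V =
      mor_app p u t W (asc_app u r v t U Y Z).
    rewrite /V mor_app_hcomp ?asc_app_hcomp ?I1 ?I2 ?I3 ?I4 //; eauto with el.
    by rewrite dom_asc_app //; apply: el_prod => //; apply: el_prod.
  have -> : asc_app p u v t i1 (mor_app u r v i2 i3) i4 \o2 V =
      asc_app p u v t W (mor_app u r v U Y) Z.
    have -> : V = W \x2 ((U \x2 Y) \x2 Z) by rewrite /V !prod2A.
    rewrite asc_app_hcomp ?mor_app_hcomp ?I1 ?I2 ?I3 ?I4 //; eauto with el.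
    by rewrite dom_mor_app //; apply: el_prod.
  have -> : asc_app p u r t i1 i2 (mor_app r v t i3 i4) \o2 V =
      asc_app p u r t W U (mor_app r v t Y Z).
    rewrite /V asc_app_hcomp ?mor_app_hcomp ?I1 ?I2 ?I3 ?I4 //; eauto with el.
    by rewrite dom_mor_app //; apply: el_prod.
  have -> : asc_app p r v t (mor_app p u r i1 i2) i3 i4 \o2 V =
      asc_app p r v t (mor_app p u r W U) Y Z.
    have -> : V = (W \x2 U) \x2 (Y \x2 Z) by rewrite /V !prod2A.
    rewrite asc_app_hcomp ?mor_app_hcomp ?I1 ?I2 ?I3 ?I4 //; eauto with el.
    by rewrite dom_mor_app //; apply: el_prod.
  by [].
- by rewrite hV dom_asc_app ?dom_mor_app //; eauto with el.
- by rewrite hV dom_mor_app ?dom_asc_app //; eauto with el.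
- rewrite tgt_vcomp; by boundary.
- rewrite src_vcomp; last by boundary.
  by rewrite hV dom_mor_app ?dom_asc_app //; eauto with el.
Qed.

Lemma el_bracket_at_app_cons D C c t s U Z : subpred C D -> c <= t -> sorted_to D t s ->
  el (B c t) U -> el (path_obj D t s) Z ->
  el (path_obj C c (t :: s)) (bracket_at_app D C c t s U Z).
Proof. exact: el_bracket_at_app. Qed.

Lemma el_rebracket_at_app_cons D C E e c t s W U Z : subpred C D -> subpred E C ->
  e <= c -> c <= t -> sorted_to D t s -> D t ->
  el (B e c) W -> el (B c t) U -> el (path_obj D t s) Z ->
  el (path_obj E e (t :: s)) (rebracket_at_app D C E e c t s W U Z).
Proof. by move=> *; apply: el_rebracket_at_app. Qed.

Local Hint Resolve el_bracket_at_app_cons el_rebracket_at_app_cons : el.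

(** * Coherence *)

(** The five cells have the shape of a pentagon on [a], [e], [c], [d] and the positions still to
    come; for empty [s] it is the pentagon ending in [q]. Arbitrary identity elements [y], [w], [u]
    make the claim stable under the recursion, which enlarges these accumulators. *)
Definition cocycle D C E A a e c d s : Prop :=
  forall y w u, el (B a e) y -> el (B e c) w -> el (B c d) u ->
  is_id2 y -> is_id2 w -> is_id2 u ->
  let z := id1 (path_obj D d s) in
  rebracket_app D C A a c d s (mor_app a e c y w) u z \v
    rebracket_app C E A a e c s y w (bracket_app D C c d s u z) =
  bracket_app D A a d s (asc_app a e c d y w u) z \v
    (rebracket_app D E A a e d s y (mor_app e c d w u) z \v
     bracket_app E A a e s y (rebracket_app D C E e c d s w u z)).

(** The cocycle condition just after the current position of [D] has moved to [t],
    that is when only the resets at [t] remain: no pentagon is needed. *)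
Lemma cocycle_reset D C E A a e c t s : subpred C D -> subpred E C -> subpred A E ->
  a <= e -> e <= c -> c <= t -> sorted_to D t s -> D t ->
  (forall a e c d, a <= e -> e <= c -> c <= d -> sorted_to D d s ->
    cocycle D C E A a e c d s) ->
  forall y w u, el (B a e) y -> el (B e c) w -> el (B c t) u ->
  is_id2 y -> is_id2 w -> is_id2 u ->
  let z := id1 (path_obj D t s) in
  rebracket_at_app D C A a c t s (mor_app a e c y w) u z \v
    rebracket_app C E A a e c (t :: s) y w (bracket_at_app D C c t s u z) =
  bracket_at_app D A a t s (asc_app a e c t y w u) z \v
    (rebracket_at_app D E A a e t s y (mor_app e c t w u) z \v
     bracket_app E A a e (t :: s) y (rebracket_at_app D C E e c t s w u z)).
Proof.
move=> DC CE EA ae ec ct ts Dt IH y w u hy hw hu iy iw iu z.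
have DE : subpred E D by move=> x /CE /DC.
have CA : subpred A C by move=> x /EA /CE.
have DA : subpred A D by move=> x /CA /DC.
have et := leq_trans ec ct; have ac := leq_trans ae ec; have a_t := leq_trans ac ct.
have tt := leqnn t.
have cts := sorted_to_sub DC (leqnn t) ts.
have es := sorted_to_sub DE et ts.
have ets := sorted_to_sub DE (leqnn t) ts.
have hz : el (path_obj D t s) z by [].
have iz : is_id2 z by constructor.
have hone := el_one t.
have ione : is_id2 one by constructor.
case Ct: (C t); last first.
  have Et : E t = false by apply/negP => /CE; rewrite Ct.
  have At : A t = false by apply/negP => /EA; rewrite Et.
  rewrite !rebracket_at_app0 // !bracket_at_app0 //.
  have := IH a e c t ae ec ct ts y w u hy hw hu iy iw iu.
  by rewrite /rebracket_app /bracket_app /= Ct Et.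
have hZ' : el (path_obj C t s) (bracket_app D C t t s one z) by eauto with el.
have iZ' : is_id2 (bracket_app D C t t s one z) by eauto with el.
have hwu : el (B e t) (mor_app e c t w u) by eauto with el.
have iwu : is_id2 (mor_app e c t w u) by eauto with el.
have hywu : el (B a t) (mor_app a e t y (mor_app e c t w u)) by eauto with el.
have iywu : is_id2 (mor_app a e t y (mor_app e c t w u)) by eauto with el.
set al := asc_app a e c t y w u.
have hal : el (B a t) al by rewrite /al; eauto with el.
have sal : sr al = mor_app a e t y (mor_app e c t w u) by rewrite /al sr_asc_app
  ?sr_is_id2.
have tal : tg al = mor_app a c t (mor_app a e c y w) u.
  by rewrite /al tg_asc_app // !tg_is_id2.
have hyw : el (B a c) (mor_app a e c y w) by eauto with el.
rewrite (bracket_at_app1 DC) // rebracket_app_cons // -/al.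
(* Naturality in the outer accumulator: the associator [al] of the finished segment is moved past
   the rebracketing of the rest. When [t] lies in [A], the two sit in different factors of a product
   instead. *)
have exch : A t = false -> rebracket_app D C A a t t s
  (mor_app a c t (mor_app a e c y w) u) one z \v
      bracket_app C A a t s al (bracket_app D C t t s one z) =
    bracket_app D A a t s al z \v rebracket_app D C A a t t s
      (mor_app a e t y (mor_app e c t w u)) one z.
  move=> At; have := @rebracket_app_nat D C A a t t s DC CA a_t tt ts al one z hal hone
    hz.
  by rewrite tal sal ?tg_is_id2 // ?sr_is_id2 // mor_app_one //.
case Et: (E t); last first.
  have At : A t = false by apply/negP => /EA; rewrite Et.
  have R0 D' e' c' W U Z := @rebracket_at_app0 D' E A e' c' t s W U Z Et At.
  rewrite (rebracket_at_app1 DC CA) // !R0.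
  rewrite (rebracket_at_app1 DC CE) // !bracket_at_app0 //.
  rewrite vcompA; [|by rewrite /al; boundary|by rewrite /al; boundary].
  rewrite exch //.
  (* The accumulator of [C] has restarted with [one], so the fifth cell of the hypothesis is an
     identity and drops out. *)
  have := IH a e t t ae et tt ts y (mor_app e c t w u) one hy hwu hone iy iwu ione.
  rewrite /= -/z asc_app_id3 // !mor_app_one // => IH'.
  rewrite -vcompA; [|by rewrite /al; boundary|by rewrite /al; boundary].
  rewrite IH' [X in _ \v X = _]vcomp_isidl; first by rewrite /bracket_app /= Et.
  + by eauto 12 with el.
  + by rewrite tgt_vcomp; [rewrite tg_rebracket_app // ?tg_is_id2|boundary].
case At: (A t); last first.
  have R0 D' c' U Z := @bracket_at_app0 D' A c' t s U Z At.
  rewrite (rebracket_at_app1 DC CA) // (rebracket_at_app1 CE EA) //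
    (rebracket_at_app1 DE EA) // (rebracket_at_app2 DC CE) //.
  rewrite !R0 bracket_app_cons //; last by eauto with el.
  rewrite R0 vcompA; [|by rewrite /al; boundary|by rewrite /al; boundary].
  rewrite exch // -vcompA; [|by rewrite /al; boundary|by rewrite /al; boundary].
  have := IH a t t t a_t tt tt ts _ one one hywu hone hone iywu ione ione.
  rewrite /= -/z asc_app_id3 // !mor_app_one // => ->.
  rewrite [X in _ \v X = _]vcomp_isidl //.
  + by eauto 12 with el.
  + by rewrite tgt_vcomp; [rewrite tg_rebracket_app // ?mor_app_one //
    ?tg_is_id2|boundary].
(* All four sets restart at [t], so both sides are products. On the finished segment every cell
   except [al] is an identity; on the rest the claim is the hypothesis with all accumulators
   empty. *)
set be := mor_app a e t y (mor_app e c t w u).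
have Ca := CA _ At.
have hH (D' C' E' : 'I_n.+1 -> bool) Z : subpred C' D' -> subpred E' C' ->
    sorted_to D' t s -> el (path_obj D' t s) Z ->
    el (path_obj E' t s) (rebracket_app D' C' E' t t t s one one Z).
  by move=> ? ? ? hZ; apply: el_rebracket_app.
rewrite (rebracket_at_app2 DC CA) // (rebracket_at_app2 CE EA) //
  (rebracket_at_app2 DE EA) // (rebracket_at_app2 DC CE) //.
rewrite (bracket_at_app1 CA) // (bracket_at_app1 DA) // bracket_app_cons //; last by
  apply: hH.
rewrite (bracket_at_app1 EA) //; last by apply: hH.
have e1 : al \v be = al by rewrite vcomp_isidr.
have e2 : be \v be = be by rewrite vcomp_isidr // sr_is_id2.
have e3 : mor_app a c t (mor_app a e c y w) u \v al = al.
  by rewrite vcomp_isidl //; apply: is_id2_mor_app => //; eauto with el.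
rewrite -/be -prod2_vcomp; [|by rewrite /al /be; boundary|by boundary].
rewrite -prod2_vcomp; [|by rewrite e1 /al; boundary|by rewrite tgt_vcomp; boundary].
rewrite -prod2_vcomp; [|by boundary|by boundary].
rewrite -prod2_vcomp; [|by rewrite e2 /al /be; boundary|by rewrite tgt_vcomp; boundary].
rewrite e2 !e1 e3; congr (_ \x2 _).
have := IH t t t t tt tt tt ts one one one hone hone hone ione ione ione.
rewrite /= -/z asc_app_id3 // !mor_app_one //.
rewrite [bracket_app C A t t s one _ \v _]vcomp_isidl //; first by eauto 12 with el.
by rewrite tg_rebracket_app // mor_app_one // !tg_is_id2.
Qed.

Lemma cocycleP D C E A a e c d s : subpred C D -> subpred E C -> subpred A E ->
  a <= e -> e <= c -> c <= d -> sorted_to D d s ->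
  cocycle D C E A a e c d s.
Proof.
move=> DC CE EA.
have DE : subpred E D by move=> x /CE /DC.
have CA : subpred A C by move=> x /EA /CE.
have DA : subpred A D by move=> x /CA /DC.
elim: s a e c d => [|t s IH] a e c d ae ec cd.
  move=> /= dq y w u hy hw hu iy iw iu.
  exact: esym (pentagon_el ae ec cd dq hy hw hu (el_id1 _) iy iw iu (is_id2_id2 _)).
case Dt: (D t); last first.
  move: (IH a e c d ae ec cd); rewrite /cocycle /rebracket_app /bracket_app /= Dt.
  have Ct : C t = false by apply/negP => /DC; rewrite Dt.
  have Et : E t = false by apply/negP => /DE; rewrite Dt.
  by rewrite Ct Et.
rewrite /cocycle /= Dt => /andP[dt ts] y w u hy hw hu iy iw iu.
have et := leq_trans ec (leq_trans cd dt); have ct := leq_trans cd dt.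
have a_t := leq_trans ae et; have ac := leq_trans ae ec; have ad := leq_trans ac cd.
have ed := leq_trans ec cd.
have cs := sorted_to_sub DC ct ts; have es := sorted_to_sub DE et ts.
have css := sorted_to_sub DC (leqnn t) ts; have ess := sorted_to_sub DE (leqnn t) ts.
set x := id2 (id1 (B d t)); set z := id2 (id1 (path_obj D t s)).
have -> : id2 (id1 (B d t ++ path_obj D t s)) = x \x2 z by rewrite prod2_id prod1_id.
have hx : el (B d t) x by []. have hz : el (path_obj D t s) z by [].
have ix : is_id2 x by constructor. have iz : is_id2 z by constructor.
have hyw : el (B a c) (mor_app a e c y w) by eauto with el.
have iyw : is_id2 (mor_app a e c y w) by eauto with el.
have hwu : el (B e d) (mor_app e c d w u) by eauto with el.
have iwu : is_id2 (mor_app e c d w u) by eauto with el.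
have hux : el (B c t) (mor_app c d t u x) by eauto with el.
have iux : is_id2 (mor_app c d t u x) by eauto with el.
rewrite rebracket_app_cons // rebracket_app_cons // rebracket_app_cons //
  !bracket_app_cons //; last by eauto with el.
(* With [x] already multiplied into [u], the reset case covers all cells but the associators caused
   by the move of [d] to [t]. *)
have R := cocycle_reset DC CE EA ae ec ct ts Dt IH hy hw hux iy iw iux.
have tsc : sorted_to C c (t :: s).
  by apply: (sorted_to_sub DC (leqnn c)); rewrite /= Dt ct.
have tse : sorted_to E e (t :: s).
  by apply: (sorted_to_sub DE (leqnn e)); rewrite /= Dt et.
rewrite -vcompA; [|by boundary|by boundary].
rewrite {}R.
set P0 := bracket_at_app D E e t s (asc_app e c d t w u x) z.
set Q0 := rebracket_at_app D C E e c t s w (mor_app c d t u x) z.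
have hP0 : el (path_obj E e (t :: s)) P0 by rewrite /P0; eauto with el.
have hQ0 : el (path_obj E e (t :: s)) Q0 by rewrite /Q0; eauto with el.
have kPQ : tgt Q0 = src P0 by rewrite /P0 /Q0; boundary.
(* [y] here, and [z] below, are written as composites with themselves because [bracket_app_vcomp]
   and [bracket_at_app_vcomp] split both arguments at once. *)
have ey : y \v y = y by rewrite vcomp_isidr // sr_is_id2.
have kyy : tgt y = src y by apply: id2_inj; rewrite tg_is_id2 ?sr_is_id2.
pose TP := bracket_app E A a e (t :: s) y P0; pose TQ := bracket_app E A a e (t :: s) y
  Q0.
have -> : bracket_app E A a e (t :: s) y (P0 \v Q0) = TP \v TQ.
  by rewrite -[in LHS]ey (bracket_app_vcomp EA).
have hwux : el (B e t) (asc_app e c d t w u x) by eauto with el.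
(* The associator [asc X e c d t] occurs inside the inner bracket; naturality exchanges it with the
   outer rebracketing, bringing it next to the other associators. *)
have := @rebracket_at_app_nat D E A a e t s DE EA ae et ts Dt y (asc_app e c d t w u x)
  z hy hwux hz.
rewrite (tg_is_id2 iy) (sr_is_id2 iy) (tg_is_id2 iz) ?(sr_is_id2 iz) tg_asc_app //
  sr_asc_app //.
rewrite (tg_is_id2 iw) (tg_is_id2 iu) (tg_is_id2 ix) ?(sr_is_id2 iw) ?(sr_is_id2 iu)
  ?(sr_is_id2 ix).
rewrite -/P0 -/TP => exch.
rewrite -/TQ.
set T1 := bracket_at_app D A a t s (mor_app a d t (asc_app a e c d y w u) x) z.
set T2 := bracket_at_app D A a t s (asc_app a e d t y (mor_app e c d w u) x) z in exch *.
set RH := rebracket_at_app D E A a e t s y (mor_app e d t (mor_app e c d w u) x) z in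
  exch *.
set RH' := rebracket_at_app D E A a e t s y (mor_app e c t w (mor_app c d t u x)) z in
  exch *.
set T3 := bracket_at_app D A a t s (mor_app a e t y _) z in exch.
set U1 := bracket_at_app D A a t s (asc_app a c d t _ _ _) z.
set U2 := bracket_at_app D A a t s (asc_app a e c t _ _ _) z.
have k1 : tgt T3 = src T2 by rewrite /T3 /T2; boundary.
have k2 : tgt T2 = src T1 by rewrite /T1 /T2; boundary.
have k3 : tgt RH' = src T3 by rewrite /RH' /T3; boundary.
have k4 : tgt TQ = src RH' by rewrite /TQ /RH' /Q0; boundary.
have k5 : tgt TP = src RH by rewrite /TP /RH /P0; boundary.
have k6 : tgt TQ = src TP by rewrite /TP /TQ /P0 /Q0; boundary.
have k7 : tgt RH = src T2 by rewrite /T2 /RH; boundary.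
have k8 : tgt U2 = src U1 by rewrite /U1 /U2; boundary.
have k9 : tgt RH' = src U2 by rewrite /U2 /RH'; boundary.
have zz : z \v z = z by rewrite vcomp_isidr // sr_is_id2.
have kzz : tgt z = src z by apply: id2_inj; rewrite tg_is_id2 ?sr_is_id2.
(* The pentagon on [a], [e], [c], [d], [t], whose five cells now all lie in the first argument of
   [bracket_at D A a t s]. *)
have pent : U1 \v U2 = T1 \v (T2 \v T3).
  have p1 : tgt (mor_app a e t y (asc_app e c d t w u x)) =
      src (asc_app a e d t y (mor_app e c d w u) x) by boundary.
  have p2 : tgt (asc_app a e d t y (mor_app e c d w u) x) =
      src (mor_app a d t (asc_app a e c d y w u) x) by boundary.
  have p3 : tgt (asc_app a e c t y w (mor_app c d t u x)) =
      src (asc_app a c d t (mor_app a e c y w) u x) by boundary.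
  rewrite /U1 /U2 /T1 /T2 /T3 -!bracket_at_app_vcomp ?zz ?tgt_vcomp //; first last.
  - by eauto with el.
  - by eauto with el.
  - by apply: el_vcomp => //; eauto with el.
  by rewrite (pentagon_el ae ec cd dt).
rewrite -(vcompA (c := T2)) ?tgt_vcomp // (vcompA (c := RH)) //.
rewrite exch -(vcompA (c := T3)) // (vcompA (c := U1)) ?tgt_vcomp // pent.
rewrite -(vcompA (c := T1)) ?tgt_vcomp ?src_vcomp //.
by rewrite -(vcompA (c := T2)) ?tgt_vcomp ?src_vcomp.
Qed.

(** * Boundaries, unit laws and dependence on the positions read *)

Lemma dom_rebracket D C E e c d s : subpred C D -> subpred E C -> e <= c -> c <= d ->
  sorted_to D d s ->
  dom1 (src (rebracket D C E e c d s)) = B e c ++ B c d ++ path_obj D d s.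
Proof. by move=> DC CE ec cd ds; case: (rebracket_typingP DC CE ec cd ds). Qed.

Lemma src_rebracket D C E e c d s : subpred C D -> subpred E C -> e <= c -> c <= d ->
  sorted_to D d s ->
  src (rebracket D C E e c d s) = bracket C E e c s \o1
    (id1 (B e c) \x1 bracket D C c d s).
Proof.
move=> DC CE ec cd ds; have [dH _ sH _] := rebracket_typingP DC CE ec cd ds.
have cs := sorted_to_sub DC cd ds.
apply: id2_inj; rewrite -hcomp_id2; last by rewrite /= cod_bracket // dom_bracket.
have := sH (id1 (B e c)) (id1 (B c d)) (id1 (path_obj D d s)) erefl erefl erefl.
rewrite !prod2_id !prod1_id hcompI // => ->.
by rewrite /bracket_app prod2_id prod1_id -(prod2_id _ (bracket D C c d s))
  (hcompI (a := bracket D C c d s)) ?dom_bracket.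
Qed.

Lemma tgt_rebracket D C E e c d s : subpred C D -> subpred E C -> e <= c -> c <= d ->
  sorted_to D d s ->
  tgt (rebracket D C E e c d s) = bracket D E e d s \o1
    (mor X e c d \x1 id1 (path_obj D d s)).
Proof.
move=> DC CE ec cd ds; have [dH _ _ tH] := rebracket_typingP DC CE ec cd ds.
have DE : subpred E D by move=> x /CE /DC.
have ed := leq_trans ec cd.
apply: id2_inj; rewrite -hcomp_id2; last by rewrite /= (cod_mor cX) // dom_bracket.
have := tH (id1 (B e c)) (id1 (B c d)) (id1 (path_obj D d s)) erefl erefl erefl.
by rewrite mor_app_id1 // !prod2_id !prod1_id hcompI // => ->; rewrite /bracket_app
  prod2_id.
Qed.

Lemma bracket_refl D c s : sorted_to D c s -> bracket D D c c s = id1 (path_obj D c s).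
Proof.
elim: s c => [|t s IH] c /=; first by move=> cq; rewrite (mor_idl cX).
case: ifP => Dt; last exact: IH.
by case/andP=> ct ts; rewrite IH // (mor_idl cX) // !prod1_id comp1I.
Qed.

Lemma bracket_cons_id D C c t s : subpred C D -> c <= t -> sorted_to D t s -> D t ->
  bracket D C c c (t :: s) = bracket_at D C c t s.
Proof.
move=> DC ct ts Dt; rewrite bracket_cons // (mor_idl cX) // prod1_id comp1I //.
by rewrite dom_bracket_at.
Qed.

Lemma bracket_at_hcomp D C c t s F : subpred C D -> c <= t -> sorted_to D t s ->
  C t -> cod1 F = B c t ->
  bracket_at D C c t s \o1 (F \x1 id1 (path_obj D t s)) = F \x1 bracket D C t t s.
Proof.
move=> DC ct ts Ct cF; rewrite /bracket_at Ct -prod1_comp //; last first.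
  by rewrite dom_bracket // (obj_refl cX).
by rewrite comp1Il // comp1I // dom_bracket // (obj_refl cX).
Qed.

(** With equal first two sets, the positions [c] and [d] stay equal along the recursion; only
    associators [asc X e c c t] occur, and they are identities. *)
Lemma rebracket_refll D E e c s : subpred E D -> e <= c -> sorted_to D c s ->
  rebracket D D E e c c s = bracket D E e c s.
Proof.
move=> DE; have DD : subpred D D by [].
elim: s e c => [|t s IH] e c ec /=; first exact: (asc_id2 cX).
case: ifP => Dt; last exact: IH.
case/andP=> ct ts; have et := leq_trans ec ct.
rewrite (mor_idl cX) // prod1_id prod1_id (asc_id2 cX) //.
have mt : cod1 (mor X e c t \x1 id1 (path_obj D t s)) = dom1 (bracket_at D E e t s).
  by rewrite /= (cod_mor cX) // dom_bracket_at.
have -> : (if E t then mor X e c t \x2 rebracket D D E t t t s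
    else rebracket D D E e t t s \o2 (mor X e c t \x1 id1 (path_obj D t s))) =
    bracket_at D E e t s \o1 (mor X e c t \x1 id1 (path_obj D t s)).
  case: ifP => Et; last first.
    by rewrite IH // /bracket_at Et hcomp_id2 //; move: mt; rewrite /bracket_at Et.
  by rewrite IH // prod2_id bracket_at_hcomp // (cod_mor cX).
rewrite hcompI; last first.
  by rewrite dom1_comp //= (dom_mor cX) // catA.
by rewrite prod2_id hcomp_id2 // vcompI.
Qed.

(** With equal last two sets, [e] and [c] stay equal, and the associators [asc X e e d t] are
    identities. *)
Lemma rebracket_reflr D C e d s : subpred C D -> e <= d -> sorted_to D d s ->
  rebracket D C C e e d s = bracket D C e d s.
Proof.
move=> DC; have CC : subpred C C by [].
elim: s e d => [|t s IH] e d ed /=; first exact: (asc_id1 cX).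
case: ifP => Dt; last exact: IH.
case/andP=> dt ts; have et := leq_trans ed dt.
rewrite (asc_id1 cX) // (obj_refl cX) prodI1 (mor_idl cX) //.
have mt : cod1 (mor X e d t \x1 id1 (path_obj D t s)) = dom1 (bracket_at D C e t s).
  by rewrite /= (cod_mor cX) // dom_bracket_at.
have -> : (if C t then id1 (B e t) \x2 rebracket D C C t t t s
    else if C t then rebracket D C C e t t s \o2 (id1 (B e t) \x1 id1 (path_obj D t s))
    else rebracket D C C e e t s) = bracket_at D C e t s.
  by rewrite /bracket_at; case: ifP => Ct; rewrite ?Ct IH // ?prod2_id.
by rewrite prod2_id hcomp_id2 // vcompI.
Qed.

Lemma path_obj_eq D D' d s : {in s, D =1 D'} -> path_obj D d s = path_obj D' d s.
Proof.
elim: s d => //= t s IH d DD'; rewrite -(DD' t) ?mem_head //.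
by rewrite !IH // => x xs; apply: DD'; rewrite inE xs orbT.
Qed.

Lemma bracket_eq D D' C C' c d s : {in s, D =1 D'} -> {in s, C =1 C'} ->
  bracket D C c d s = bracket D' C' c d s.
Proof.
elim: s c d => //= t s IH c d DD' CC'.
have h : {in s, D =1 D'} by move=> x xs; apply: DD'; rewrite inE xs orbT.
have h' : {in s, C =1 C'} by move=> x xs; apply: CC'; rewrite inE xs orbT.
by rewrite -(DD' t) -?(CC' t) ?mem_head // !IH // (path_obj_eq _ h).
Qed.

Lemma rebracket_eq D D' C C' E E' e c d s :
  {in s, D =1 D'} -> {in s, C =1 C'} -> {in s, E =1 E'} ->
  rebracket D C E e c d s = rebracket D' C' E' e c d s.
Proof.
elim: s e c d => //= t s IH e c d DD' CC' EE'.
have h : {in s, D =1 D'} by move=> x xs; apply: DD'; rewrite inE xs orbT.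
have h' : {in s, C =1 C'} by move=> x xs; apply: CC'; rewrite inE xs orbT.
have h'' : {in s, E =1 E'} by move=> x xs; apply: EE'; rewrite inE xs orbT.
rewrite -(DD' t) -?(CC' t) -?(EE' t) ?mem_head // !IH // (path_obj_eq _ h).
by rewrite /bracket_at (EE' t) ?mem_head // !(bracket_eq _ _ h h'').
Qed.

Lemma path_obj_nil D d s : {in s, D =1 xpred0} -> path_obj D d s = B d q.
Proof. by move=> h; rewrite (path_obj_eq _ h); elim: s {h}. Qed.

Lemma bracket_nil D C c d s : {in s, D =1 xpred0} -> bracket D C c d s = mor X c d q.
Proof. by move=> h; rewrite (bracket_eq _ _ h (fun _ _ => erefl)); elim: s {h}. Qed.

Lemma rebracket_nil D C E e c d s : {in s, D =1 xpred0} -> rebracket D C E e c d s = asc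
  X e c d q.
Proof.
move=> h; rewrite (rebracket_eq _ _ _ h (fun _ _ => erefl) (fun _ _ => erefl)).
by elim: s {h}.
Qed.
End Coherence.

(** * Splitting at a common position *)

Section Split.

Variables (n : nat) (X : skew_family n) (cX : coherent X) (p q : 'I_n.+1).

Implicit Types (e c d t : 'I_n.+1) (s : seq 'I_n.+1).
Implicit Types E C D : 'I_n.+1 -> bool.

Lemma sorted_to_split D d s1 s2 : D p ->
  sorted_to q D d (s1 ++ p :: s2) -> sorted_to p D d s1 /\ sorted_to q D p s2.
Proof.
move=> Dp; elim: s1 d => [|t s1 IH] d /=; first by rewrite Dp => /andP.
by case: ifP => _ //; [case/andP=> -> /IH|apply: IH].
Qed.

Lemma path_obj_split D d s1 s2 : D p ->
  path_obj X q D d (s1 ++ p :: s2) = path_obj X p D d s1 ++ path_obj X q D p s2.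
Proof.
move=> Dp; elim: s1 d => [|t s1 IH] d /=; first by rewrite Dp.
by case: ifP => _; rewrite IH ?catA.
Qed.

(** The clause for the empty list multiplies up to the final position, here [p]; this is what the
    step at [p] does in the longer list, which then restarts from a unit because [p] lies in [C]. *)
Lemma bracket_split D C c d s1 s2 : subpred C D -> C p -> c <= d ->
  sorted_to q D d (s1 ++ p :: s2) ->
  bracket X q D C c d (s1 ++ p :: s2) = bracket X p D C c d s1 \x1 bracket X q D C p p s2.
Proof.
move=> DC Cp; have Dp := DC _ Cp.
elim: s1 c d => [|t s1 IH] c d cd.
  move=> /= ; rewrite Dp Cp => /andP[dp ps].
  rewrite -prod1_comp ?comp1Il ?comp1I ?(cod_mor cX) //.
  - by rewrite (dom_bracket cX) // (obj_refl cX).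
  - by rewrite (dom_bracket cX) // (obj_refl cX).
case Dt: (D t) => /=; rewrite Dt; last exact: IH.
case/andP=> dt ts; have [ts1 ps] := sorted_to_split Dp ts.
have ct := leq_trans cd dt.
rewrite path_obj_split // -prod1_id -prod1A.
transitivity ((bracket_at X p D C c t s1 \x1 bracket X q D C p p s2) \o1
   ((mor X c d t \x1 id1 (path_obj X p D t s1)) \x1 id1 (path_obj X q D p s2))).
  by rewrite /bracket_at; case: ifP => _; rewrite IH ?prod1A.
rewrite -prod1_comp.
- by rewrite (comp1I (F := bracket X q D C p p s2)) // (dom_bracket cX) // (obj_refl cX).
- by rewrite /= (cod_mor cX) // (dom_bracket_at cX).
- by rewrite (dom_bracket cX) // (obj_refl cX).
Qed.

Lemma bracket_at_split D C c t s1 s2 : subpred C D -> C p -> c <= t ->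
  sorted_to q D t (s1 ++ p :: s2) ->
  bracket_at X q D C c t (s1 ++ p :: s2) = bracket_at X p D C c t s1 \x1 bracket X q D C
    p p s2.
Proof.
by move=> DC Cp ct ts; rewrite /bracket_at; case: ifP => _; rewrite bracket_split //
  prod1A.
Qed.

(** All segments close at [p], so the cell for [s2] appears as an independent factor. Products
    commute with both compositions, which carries this factor unchanged through the steps of [s1],
    each of which acts on it by identities. *)
Lemma rebracket_split D C E e c d s1 s2 : subpred C D -> subpred E C -> E p -> e <= c ->
  c <= d ->
  sorted_to q D d (s1 ++ p :: s2) ->
  rebracket X q D C E e c d (s1 ++ p :: s2) =
  rebracket X p D C E e c d s1 \x2 rebracket X q D C E p p p s2.
Proof.
move=> DC CE Ep; have Cp := CE _ Ep; have Dp := DC _ Cp.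
have DE : subpred E D by move=> x /CE /DC.
have pp := leqnn p; have Bp := obj_refl cX p.
have tH' : sorted_to q D p s2 -> tgt (rebracket X q D C E p p p s2) = bracket X q D E p
  p s2.
  move=> ps; rewrite (tgt_rebracket cX) // (mor_idl cX) // prod1_id Bp comp1I //.
  by rewrite (dom_bracket cX) // Bp.
have dH' : sorted_to q D p s2 -> dom1 (src (rebracket X q D C E p p p s2)) = path_obj X
  q D p s2.
  by move=> ps; rewrite (dom_rebracket cX) // Bp.
have dT' : sorted_to q D p s2 -> dom1 (bracket X q D E p p s2) = path_obj X q D p s2.
  by move=> ps; rewrite (dom_bracket cX) // Bp.
elim: s1 e c d => [|t s1 IH] e c d ec cd.
  rewrite /= Dp Ep => /andP[dp ps].
  have cp := leq_trans cd dp; have ed := leq_trans ec cd.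
  have ca := cod_asc cX ec cd dp.
  have -> : bracket_at X q D E e p s2 \o2 (asc X e c d p \x2 id1 (path_obj X q D p s2)) =
      asc X e c d p \x2 bracket X q D E p p s2.
    rewrite /bracket_at Ep -prod2_id -prod2_hcomp //=; last by rewrite dT'.
    by rewrite hcompIl // hcompI // dT'.
  have -> : id2 (id1 (obj X e c) \x1 (mor X c d p \x1 id1 (path_obj X q D p s2))) =
     (id1 (obj X e c) \x1 mor X c d p) \x2 id1 (path_obj X q D p s2).
    by rewrite prod2_id prod1A.
  rewrite -prod2_hcomp /= ?dH' ?(cod_mor cX) ?(dom_mor cX) //.
  rewrite hcompI ?dH' // hcomp_id2 /= ?(cod_mor cX) ?(dom_mor cX) //.
  rewrite -(src_asc cX) // -prod2_vcomp ?tgt_id2 ?tH' //.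
  by rewrite vcompI // vcompIl ?tH'.
case Dt: (D t); last by rewrite /= Dt; apply: IH.
rewrite [sorted_to _ _ _ _]/= Dt => /andP[dt ts].
have [ts1 ps] := sorted_to_split Dp ts.
have ct := leq_trans cd dt; have et := leq_trans ec ct.
have ca := cod_asc cX ec cd dt.
have R : rebracket_at X q D C E e c t (s1 ++ p :: s2) =
    rebracket_at X p D C E e c t s1 \x2 rebracket X q D C E p p p s2.
  rewrite /rebracket_at; case: ifP => _; first by rewrite IH // prod2A.
  case: ifP => _; last exact: IH.
  rewrite IH // path_obj_split // -prod1_id -prod1A -(prod2_id (_ \x1 _)).
  rewrite -prod2_hcomp /= ?dH' ?(dom_rebracket cX) // ?(cod_mor cX) ?(obj_refl cX) //.
  by rewrite (hcompI (a := rebracket X q _ _ _ _ _ _ _)) ?dH'.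
have [dR cR _ _] : rebracket_at_typing X p D C E e c t s1.
  by apply: (rebracket_at_typingP cX) => // *; apply: (rebracket_typingP cX).
have tm := composable_rebracket cX DC CE ec cd dt ts1 Dt.
rewrite cat_cons !rebracket_cons // R bracket_at_split // path_obj_split // -prod1_id.
have -> : asc X e c d t \x2 (id1 (path_obj X p D t s1) \x1 id1 (path_obj X q D p s2)) =
    (asc X e c d t \x2 id1 (path_obj X p D t s1)) \x2 id1 (path_obj X q D p s2).
  by rewrite prod2A prod2_id.
have -> : id2 (id1 (obj X e c) \x1 (mor X c d t \x1
      (id1 (path_obj X p D t s1) \x1 id1 (path_obj X q D p s2)))) =
    (id1 (obj X e c) \x1 (mor X c d t \x1 id1 (path_obj X p D t s1))) \x2
    id1 (path_obj X q D p s2).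
  by rewrite prod2_id !prod1A.
rewrite -(prod2_id (bracket_at _ _ _ _ _ _ _)) -!prod2_hcomp /= ?dH' ?dT' ?dR ?ca
  ?(dom_bracket_at cX) ?(cod_mor cX) //.
rewrite (hcompI (a := rebracket X q _ _ _ _ _ _ _)) ?dH' //
  (hcompI (a := bracket X q _ _ _ _ _)) ?dT' //.
rewrite -prod2_vcomp ?tgt_id2 ?tH' //; last first.
  by apply: tm; apply: (rebracket_at_typingP cX) => // *; apply: (rebracket_typingP cX).
by rewrite (vcompIl (a := rebracket X q _ _ _ _ _ _ _)) ?tH'.
Qed.

End Split.

(** * Restriction along a simplex map *)

Section Positions.

Variables (n : nat) (X : skew_family n) (cX : coherent X) (q : 'I_n.+1).

Implicit Types (e c d t w : 'I_n.+1) (s r : seq 'I_n.+1).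
Implicit Types E C D : 'I_n.+1 -> bool.

Notation ltO := (fun i j : 'I_n.+1 => i < j).

Lemma sorted_to_le D d s : sorted_to q D d s -> d <= q.
Proof.
elim: s d => //= t s IH d; case: ifP => _; last exact: IH.
by case/andP=> dt /IH; apply: leq_trans.
Qed.

Lemma sorted_to_bounds D d s : sorted_to q D d s ->
  forall t, t \in s -> D t -> d <= t <= q.
Proof.
elim: s d => //= x s IH d; case: ifP => [Dx /andP[dx xs]|Dx ds] t.
  rewrite inE => /predU1P[-> _|ts Dt]; first by rewrite dx (sorted_to_le xs).
  by have /andP[xt ->] := IH x xs t ts Dt; rewrite (leq_trans dx).
by rewrite inE => /predU1P[->|ts]; [rewrite Dx|apply: IH].
Qed.

Lemma sorted_toI D d s : pairwise ltO s -> d <= q ->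
  (forall t, t \in s -> D t -> d <= t <= q) -> sorted_to q D d s.
Proof.
elim: s d => //= x s IH d /andP[/allP xs ps] dq h.
have hs t : t \in s -> D t -> t <= q.
  by move=> ts Dt; have /h/(_ Dt)/andP[] : t \in x :: s by rewrite inE ts orbT.
case: ifP => [Dx|_].
  have /andP[-> xq] := h x (mem_head _ _) Dx; apply: IH => // t ts Dt.
  by rewrite ltnW ?xs // hs.
by apply: IH => // t ts Dt; apply: h => //; rewrite inE ts orbT.
Qed.

Lemma path_obj_drop D d r s : {in r, D =1 xpred0} ->
  path_obj X q D d (r ++ s) = path_obj X q D d s.
Proof.
elim: r => //= t r IH h; rewrite (h t) ?mem_head // IH // => x xr.
by apply: h; rewrite inE xr orbT.
Qed.

Lemma bracket_drop D C c d r s : {in r, D =1 xpred0} ->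
  bracket X q D C c d (r ++ s) = bracket X q D C c d s.
Proof.
elim: r => //= t r IH h; rewrite (h t) ?mem_head // IH // => x xr.
by apply: h; rewrite inE xr orbT.
Qed.

Lemma rebracket_drop D C E e c d r s : {in r, D =1 xpred0} ->
  rebracket X q D C E e c d (r ++ s) = rebracket X q D C E e c d s.
Proof.
elim: r => //= t r IH h; rewrite (h t) ?mem_head // IH // => x xr.
by apply: h; rewrite inE xr orbT.
Qed.

Lemma path_obj_head D t s : path_obj X q D t (t :: s) = path_obj X q D t s.
Proof. by rewrite /= (obj_refl cX); case: ifP. Qed.

(** When [t] is read again, [mor X c t t] is an identity and only the resets remain. This is how
    several positions with the same image under a simplex map collapse to one. *)
Lemma bracket_head D C c t s : subpred C D -> c <= t -> sorted_to q D t s ->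
  bracket X q D C c t (t :: s) = bracket_at X q D C c t s.
Proof.
move=> DC ct ts; case Dt: (D t); last first.
  by rewrite /= Dt /bracket_at; case: ifP => // /DC; rewrite Dt.
rewrite bracket_cons // (mor_idr cX) // prod1_id comp1I // (dom_bracket_at cX) //.
Qed.

Lemma bracket_at_refl D C t s : bracket_at X q D C t t s = bracket X q D C t t s.
Proof. by rewrite /bracket_at (obj_refl cX) prodI1; case: ifP. Qed.

Lemma rebracket_head D C E e c t s : subpred C D -> subpred E C -> e <= c -> c <= t ->
  sorted_to q D t s ->
  rebracket X q D C E e c t (t :: s) = rebracket_at X q D C E e c t s.
Proof.
move=> DC CE ec ct ts; case Dt: (D t); last first.
  rewrite /= Dt /rebracket_at; case: ifP => [/CE/DC|_]; first by rewrite Dt.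
  by case: ifP => // /DC; rewrite Dt.
have et := leq_trans ec ct; have DE : subpred E D by move=> x /CE /DC.
rewrite rebracket_cons //.
have R : rebracket_at_typing X q D C E e c t s.
  by apply: (rebracket_at_typingP cX) => // *; apply: (rebracket_typingP cX).
have [dR _ _ tR] := R.
have hid : id1 (obj X e c) \x1 (mor X c t t \x1 id1 (path_obj X q D t s)) =
    id1 (obj X e c ++ obj X c t ++ path_obj X q D t s).
  by rewrite (mor_idr cX) // !prod1_id.
rewrite hid hcompI // (asc_id3 cX) // prod2_id hcomp_id2; last first.
  by rewrite /= (cod_mor cX) // (dom_bracket_at cX).
rewrite vcompIl //; apply: id2_inj.
have := tR (id1 (obj X e c)) (id1 (obj X c t)) (id1 (path_obj X q D t s)) erefl erefl
  erefl.
rewrite !prod2_id !prod1_id hcompI // => ->.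
rewrite -hcomp_id2 /=; last by rewrite (cod_mor cX) // (dom_bracket_at cX).
by rewrite /bracket_at_app (mor_app_id1 cX) // prod2_id.
Qed.

Lemma rebracket_at_refl D C E t s : subpred C D -> subpred E C -> sorted_to q D t s ->
  rebracket_at X q D C E t t t s = rebracket X q D C E t t t s.
Proof.
move=> DC CE ts; rewrite /rebracket_at (mor_idl cX) // (obj_refl cX) prod2Il prodI1.
rewrite hcompI; first by case: ifP => // _; case: ifP.
by rewrite (dom_rebracket cX) // (obj_refl cX).
Qed.

(** Resetting [c] and afterwards [e] at the same [t] agrees with a simultaneous reset. It is needed
    when a position of [C] outside [E] is followed by a position of [E] with the same image. *)
Lemma rebracket_at_hcomp D C E e c t s : subpred C D -> subpred E C -> e <= c -> c <= t ->
  sorted_to q D t s ->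
  rebracket_at X q D C E e t t s \o2 (mor X e c t \x1 id1 (path_obj X q D t s)) =
  if E t then mor X e c t \x2 rebracket X q D C E t t t s
  else rebracket X q D C E e t t s \o2 (mor X e c t \x1 id1 (path_obj X q D t s)).
Proof.
move=> DC CE ec ct ts; have et := leq_trans ec ct; have Bt := obj_refl cX t.
rewrite /rebracket_at (mor_idr cX) //; case: ifP => Et.
  rewrite -prod2_id -prod2_hcomp ?(hcompIl (a := mor X e c t)) /=.
  - by rewrite hcompI // (dom_rebracket cX) // !Bt.
  - by rewrite (cod_mor cX).
  - by rewrite (cod_mor cX).
  - by rewrite (dom_rebracket cX) // !Bt.
by rewrite prod1_id hcompI ?if_same // (dom_rebracket cX) // Bt.
Qed.

End Positions.

Definition pull m n (f : simplex_map m n) (X : skew_family n) : skew_family m :=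
  SkewFamily (fun p q => obj X (f p) (f q)) (fun p q r => mor X (f p) (f q) (f r))
    (fun p q r s => asc X (f p) (f q) (f r) (f s)).

Section Pull.

Variables (m n : nat) (f : simplex_map m n) (X : skew_family n) (cX : coherent X).
Variable q : 'I_m.+1.

Implicit Types (e c d t : 'I_m.+1) (s : seq 'I_m.+1) (r : seq 'I_n.+1).
Implicit Types E C D : 'I_m.+1 -> bool.

Notation ltO := (fun i j : 'I_n.+1 => i < j).

(** The image of the positions still to be read, so that it shrinks along the recursion on [s]. *)
Definition direct_image D s (w : 'I_n.+1) := has (fun t => D t && (f t == w)) s.

Lemma direct_image_cons D t s w :
  direct_image D (t :: s) w = D t && (f t == w) || direct_image D s w.
Proof. by []. Qed.

Lemma direct_image_sub D C s : subpred C D -> subpred (direct_image C s)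
  (direct_image D s).
Proof.
move=> DC w /hasP[t ts /andP[Ct tw]]; apply/hasP; exists t => //.
by rewrite DC.
Qed.

Lemma direct_image_skip D t s : D t = false ->
  direct_image D (t :: s) =1 direct_image D s.
Proof. by move=> Dt w; rewrite direct_image_cons Dt. Qed.

Lemma direct_image_sorted D d s r : pairwise ltO r -> sorted_to q D d s ->
  sorted_to (f q) (direct_image D s) (f d) r.
Proof.
move=> rs ds; apply: sorted_toI => //; first by rewrite smap_mono ?(sorted_to_le ds).
move=> w _ /hasP[t ts /andP[Dt /eqP<-]].
by have /andP[? ?] := sorted_to_bounds ds ts Dt; rewrite !smap_mono.
Qed.

(** [f t] stays at the head of the second list because later elements of [s] may also be sent to it.
    On [l2] alone, the images of [t :: s] and of [s] coincide. *)
Variant split_spec D t s r : Prop :=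
  SplitSpec l1 l2 of r = l1 ++ f t :: l2
    & {in l1, direct_image D (t :: s) =1 xpred0}
    & pairwise ltO (f t :: l2)
    & (forall x, x \in s -> D x -> f x \in f t :: l2)
    & (forall C, {in l2, direct_image C (t :: s) =1 direct_image C s}).

Lemma direct_image_split D t s r : pairwise ltO r ->
  (forall x, x \in t :: s -> D x -> f x \in r) -> D t -> sorted_to q D t s ->
  split_spec D t s r.
Proof.
move=> rs sr Dt ts; have h := sr t (mem_head _ _) Dt.
move: (splitPr h) => {h} sp; case: r / sp rs sr => l1 l2 rs sr.
have := rs; rewrite pairwise_cat => /and3P[/allrelP l12 _ p2].
have sge x : x \in s -> D x -> f t <= f x.
  by move=> xs Dx; apply: smap_mono; have /andP[] := sorted_to_bounds ts xs Dx.
have tl2 : f t \notin l2.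
  by have /andP[/allP h _] := p2; apply/negP => /h; rewrite ltnn.
exists l1 l2 => //.
- move=> w wl; apply/hasP => -[x]; rewrite inE => xs /andP[Dx /eqP fx].
  have := l12 w (f t) wl (mem_head _ _); rewrite -fx ltnNge => /negP; apply.
  by case/predU1P: xs => [->|xs]; [|apply: sge].
- move=> x xs Dx; have := sr x; rewrite inE xs orbT => /(_ isT Dx).
  rewrite mem_cat => /orP[xl|//].
  by have := l12 _ _ xl (mem_head _ _); rewrite ltnNge sge.
- move=> C w wl; rewrite direct_image_cons; case: eqP => [e|_]; last by rewrite andbF.
  by rewrite e wl in tl2.
Qed.

(** [f] may identify positions of [s]; the repeated positions contribute units. *)
Lemma path_obj_pull D d s r : pairwise ltO r ->
  (forall x, x \in s -> D x -> f x \in r) -> sorted_to q D d s ->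
  path_obj (pull f X) q D d s = path_obj X (f q) (direct_image D s) (f d) r.
Proof.
elim: s r d => [|t s IH] r d rs sr; first by move=> _; rewrite (@path_obj_nil n).
case Dt: (D t) => /=; rewrite Dt.
  case/andP=> dt ts; have [l1 l2 -> l10 l2s sl2 im] := direct_image_split rs sr Dt ts.
  rewrite path_obj_drop // (IH (f t :: l2)) // path_obj_head //.
  by rewrite /= Dt eqxx (path_obj_eq _ _ _ (im D)).
move=> ds; rewrite (IH r) //; last by move=> x xs; apply: sr; rewrite inE xs orbT.
by apply: path_obj_eq => w _; rewrite direct_image_skip.
Qed.

Lemma bracket_pull D C c d s r : subpred C D -> c <= d -> pairwise ltO r ->
  (forall x, x \in s -> D x -> f x \in r) -> sorted_to q D d s ->
  bracket (pull f X) q D C c d s =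
  bracket X (f q) (direct_image D s) (direct_image C s) (f c) (f d) r.
Proof.
move=> DC; elim: s r c d => [|t s IH] r c d cd rs sr; first by move=> _; rewrite
  (@bracket_nil n).
case Dt: (D t); last first.
  have Ct : C t = false by apply/negP => /DC; rewrite Dt.
  rewrite /= Dt => ds; rewrite (IH r) //; last by move=> x xs; apply: sr; rewrite inE xs
    orbT.
  by apply: bracket_eq => w _; rewrite direct_image_skip.
rewrite [sorted_to _ _ _ _]/= Dt => /andP[dt ts].
have [l1 l2 -> l10 l2s sl2 im] := direct_image_split rs sr Dt ts.
have ct := leq_trans cd dt.
have ts' := direct_image_sorted l2s ts.
have fct : f c <= f t by apply: smap_mono.
have CDs := direct_image_sub (s := s) DC.
have ts2 : sorted_to (f q) (direct_image D s) (f t) l2.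
  by move: ts'; rewrite /=; case: ifP => // _ /andP[].
rewrite bracket_drop // !bracket_cons //; last by rewrite direct_image_cons Dt eqxx.
rewrite (path_obj_pull l2s) // path_obj_head // (path_obj_eq _ _ _ (im D)).
congr (_ \o1 _); rewrite /bracket_at direct_image_cons eqxx andbT.
rewrite !(IH (f t :: l2)) // !bracket_head // bracket_at_refl // /bracket_at.
rewrite !(bracket_eq _ _ _ _ (im D) (im C)).
by case: (C t).
Qed.

Lemma rebracket_pull D C E e c d s r : subpred C D -> subpred E C -> e <= c -> c <= d ->
  pairwise ltO r ->
  (forall x, x \in s -> D x -> f x \in r) -> sorted_to q D d s ->
  rebracket (pull f X) q D C E e c d s =
  rebracket X (f q) (direct_image D s) (direct_image C s) (direct_image E s)
    (f e) (f c) (f d) r.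
Proof.
move=> DC CE; have DE : subpred E D by move=> x /CE /DC.
elim: s r e c d => [|t s IH] r e c d ec cd rs sr; first by move=> _; rewrite
  (@rebracket_nil n).
case Dt: (D t); last first.
  have Ct : C t = false by apply/negP => /DC; rewrite Dt.
  have Et : E t = false by apply/negP => /CE; rewrite Ct.
  rewrite /= Dt => ds; rewrite (IH r) //; last by move=> x xs; apply: sr; rewrite inE xs
    orbT.
  by apply: rebracket_eq => w _; rewrite direct_image_skip.
rewrite [sorted_to _ _ _ _]/= Dt => /andP[dt ts].
have [l1 l2 -> l10 l2s sl2 im] := direct_image_split rs sr Dt ts.
have ct := leq_trans cd dt; have et := leq_trans ec ct.
have ts' := direct_image_sorted l2s ts.
have fct : f c <= f t by apply: smap_mono.
have fec : f e <= f c by apply: smap_mono.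
have fet : f e <= f t by apply: smap_mono.
have CDs := direct_image_sub (s := s) DC.
have ECs := direct_image_sub (s := s) CE.
have EDs := direct_image_sub (s := s) DE.
have ts2 : sorted_to (f q) (direct_image D s) (f t) l2.
  by move: ts'; rewrite /=; case: ifP => // _ /andP[].
rewrite rebracket_drop // !rebracket_cons //; last by rewrite direct_image_cons Dt eqxx.
have eT : bracket_at (pull f X) q D E e t s =
    bracket_at X (f q) (direct_image D (t :: s)) (direct_image E (t :: s)) (f e) (f t) l2.
  rewrite /bracket_at direct_image_cons eqxx andbT !(bracket_pull _ _ l2s) //
    !bracket_head // bracket_at_refl // /bracket_at.
  rewrite !(bracket_eq _ _ _ _ (im D) (im E)).
  by case: (E t).
rewrite (path_obj_pull l2s) // path_obj_head // (path_obj_eq _ _ _ (im D)).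
congr (_ \v (_ \o2 _)); first by rewrite eT.
rewrite [in LHS]/rebracket_at !(IH (f t :: l2)) // !rebracket_head // rebracket_at_refl
  //.
rewrite (path_obj_pull l2s) // path_obj_head //.
rewrite [in RHS]/rebracket_at !direct_image_cons eqxx !andbT.
rewrite !(rebracket_eq _ _ _ _ _ (im D) (im C) (im E)) (path_obj_eq _ _ _ (im D)).
case Et: (E t) => //=; case Ct: (C t) => //=.
by rewrite rebracket_at_hcomp.
Qed.

End Pull.

(** * The family of a simplex of the skew nerve *)

Lemma simplex_map_eq m n (f g : simplex_map m n) : (forall i, f i = g i) -> f = g.
Proof.
case: f g => [f hf] [g hg] /= /funext e; subst g.
by congr SimplexMap; apply: Prop_irrelevance.
Qed.

Definition ord_max2 n (i j : 'I_n.+1) := if i <= j then j else i.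

Lemma running_max_path n (p : 'I_n.+1) s :
  path (fun i j : 'I_n.+1 => i <= j) p (scanl (@ord_max2 n) p s).
Proof.
elim: s p => //= q s IH p; rewrite IH andbT /ord_max2.
by case: ifP.
Qed.

Lemma running_max_id n (p : 'I_n.+1) s :
  path (fun i j : 'I_n.+1 => i <= j) p s -> scanl (@ord_max2 n) p s = s.
Proof.
by elim: s p => //= q s IH p /andP[pq qs]; rewrite /ord_max2 pq IH.
Qed.

Lemma running_max_mono n (p : 'I_n.+1) s (i j : 'I_(size s).+1) : i <= j ->
  nth p (p :: scanl (@ord_max2 n) p s) i <= nth p (p :: scanl (@ord_max2 n) p s) j.
Proof.
move=> ij; pose leO (x y : 'I_n.+1) : bool := x <= y.
have leO_trans : transitive leO by move=> ? ? ?; apply: leq_trans.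
have leO_refl : reflexive leO by move=> ?; apply: leqnn.
have := @sorted_leq_nth _ leO leO_trans leO_refl p (p :: scanl (@ord_max2 n) p s)
  (running_max_path p s).
by apply; rewrite // inE /= size_scanl.
Qed.

(** Taking running maxima makes the vertices [p :: s] of a simplex monotone
    without any hypothesis on [p :: s]. *)
Definition vertices n (p : 'I_n.+1) (s : seq 'I_n.+1) : simplex_map (size s) n :=
  SimplexMap (@running_max_mono n p s).

Lemma verticesE n (p : 'I_n.+1) s i :
  path (fun i j : 'I_n.+1 => i <= j) p s -> vertices p s i = nth p (p :: s) i.
Proof. by move=> ps /=; rewrite running_max_id. Qed.

(** Monotone maps preserve binary maxima, hence running maxima. As no order hypothesis on [p :: s]
    enters, [family_of_act] is an equality of families at all indices, increasing or not. *)
Lemma smap_vertices m n (f : simplex_map m n) p s :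
  smap_comp f (vertices p s) =1 nth (f p) (f p :: scanl (@ord_max2 n) (f p) (map f s)).
Proof.
move=> i /=; rewrite -(nth_map _ (f p)); last first.
  by rewrite /= size_scanl ltn_ord.
congr (nth _ (_ :: _) _); elim: s p {i} => //= q s IH p.
rewrite IH; suff -> : f (ord_max2 p q) = ord_max2 (f p) (f q) by [].
rewrite /ord_max2; case: ifP => [pq|/negbT]; first by rewrite smap_mono.
rewrite -ltnNge => /ltnW qp; case: ifP => // fpq.
by apply/val_inj/eqP; rewrite eqn_leq fpq smap_mono.
Qed.

Section FamilyOf.

Variables (n : nat) (x : skew_nerve_Cat n).

Implicit Types p q r s t : 'I_n.+1.

Let y : coskeleton_simplex skew_truncation n := x.

Definition restr1 p q : seq category := cosk_fun y (isT : 1 <= 4) (vertices p [:: q]).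
Definition restr2 p q r : skew2 := cosk_fun y (isT : 2 <= 4) (vertices p [:: q; r]).
Definition restr3 p q r s : skew3 :=
  cosk_fun y (isT : 3 <= 4) (vertices p [:: q; r; s]).
Definition restr4 p q r s t : skew4 :=
  cosk_fun y (isT : 4 <= 4) (vertices p [:: q; r; s; t]).

Lemma cosk_face_eq k (h : k < 4) (h' : k <= 4) (i : 'I_k.+2)
    (f : simplex_map k.+1 n) (g : simplex_map k n) :
  (forall j, f (lift i j) = g j) ->
  skew_face h i (cosk_fun y h f) = cosk_fun y h' g.
Proof.
move=> fg; apply: etrans (esym (cosk_face y h i f)) _.
have -> : smap_comp f (coface i) = g by apply: simplex_map_eq => j; apply: fg.
by rewrite (bool_irrelevance (ltnW h) h').
Qed.

Lemma cosk_degen_eq k (h : k < 4) (h' : k <= 4) (i : 'I_k.+1)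
    (f : simplex_map k.+1 n) (g : simplex_map k n) :
  (forall j, f j = g (codegen i j)) ->
  cosk_fun y h f = skew_degen h i (cosk_fun y h' g).
Proof.
move=> fg; have -> : f = smap_comp g (codegen i) by apply: simplex_map_eq.
by apply: etrans (cosk_degen y h i g) _; rewrite (bool_irrelevance (ltnW h) h').
Qed.

Ltac vertex_cases :=
  case=> [[|[|[|[|?]]]] ?] //; rewrite !verticesE //=;
  repeat (apply/andP; split); eauto using leq_trans.

Lemma restr2_face p q r : p <= q -> q <= r ->
  [/\ s2_12 (restr2 p q r) = restr1 q r, s2_02 (restr2 p q r) = restr1 p r
    & s2_01 (restr2 p q r) = restr1 p q].
Proof.
move=> pq qr; split.
- by apply: (@cosk_face_eq 1 isT isT (@Ordinal 3 0 isT)); vertex_cases.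
- by apply: (@cosk_face_eq 1 isT isT (@Ordinal 3 1 isT)); vertex_cases.
- by apply: (@cosk_face_eq 1 isT isT (@Ordinal 3 2 isT)); vertex_cases.
Qed.

Lemma restr3_face p q r s : p <= q -> q <= r -> r <= s ->
  [/\ s3_123 (restr3 p q r s) = restr2 q r s, s3_023 (restr3 p q r s) = restr2 p r s,
    s3_013 (restr3 p q r s) = restr2 p q s & s3_012 (restr3 p q r s) = restr2 p q r].
Proof.
move=> pq qr rs; split.
- by apply: (@cosk_face_eq 2 isT isT (@Ordinal 4 0 isT)); vertex_cases.
- by apply: (@cosk_face_eq 2 isT isT (@Ordinal 4 1 isT)); vertex_cases.
- by apply: (@cosk_face_eq 2 isT isT (@Ordinal 4 2 isT)); vertex_cases.
- by apply: (@cosk_face_eq 2 isT isT (@Ordinal 4 3 isT)); vertex_cases.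
Qed.

Lemma restr4_face p q r s t : p <= q -> q <= r -> r <= s -> s <= t ->
  [/\ s4_1234 (restr4 p q r s t) = restr3 q r s t, s4_0234 (restr4 p q r s t) = restr3 p
    r s t,
    s4_0134 (restr4 p q r s t) = restr3 p q s t, s4_0124 (restr4 p q r s t) = restr3 p q
      r t
    & s4_0123 (restr4 p q r s t) = restr3 p q r s].
Proof.
move=> pq qr rs st; split.
- by apply: (@cosk_face_eq 3 isT isT (@Ordinal 5 0 isT)); vertex_cases.
- by apply: (@cosk_face_eq 3 isT isT (@Ordinal 5 1 isT)); vertex_cases.
- by apply: (@cosk_face_eq 3 isT isT (@Ordinal 5 2 isT)); vertex_cases.
- by apply: (@cosk_face_eq 3 isT isT (@Ordinal 5 3 isT)); vertex_cases.
- by apply: (@cosk_face_eq 3 isT isT (@Ordinal 5 4 isT)); vertex_cases.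
Qed.

Lemma restr1_degen p : restr1 p p = [::].
Proof.
apply: etrans (@cosk_degen_eq 0 isT isT (@Ordinal 1 0 isT) _ (vertices p [::]) _) _ => //.
by vertex_cases.
Qed.

Lemma restr2_degen p q : p <= q ->
  restr2 p p q = skew1_degen 0 (restr1 p q) /\ restr2 p q q = skew1_degen 1 (restr1 p q).
Proof.
move=> pq; split.
- by apply: (@cosk_degen_eq 1 isT isT (@Ordinal 2 0 isT)); vertex_cases.
- by apply: (@cosk_degen_eq 1 isT isT (@Ordinal 2 1 isT)); vertex_cases.
Qed.

Lemma restr3_degen p q r : p <= q -> q <= r ->
  [/\ restr3 p p q r = skew2_degen 0 (restr2 p q r), restr3 p q q r = skew2_degen 1
    (restr2 p q r)
    & restr3 p q r r = skew2_degen 2 (restr2 p q r)].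
Proof.
move=> pq qr; split.
- by apply: (@cosk_degen_eq 2 isT isT (@Ordinal 3 0 isT)); vertex_cases.
- by apply: (@cosk_degen_eq 2 isT isT (@Ordinal 3 1 isT)); vertex_cases.
- by apply: (@cosk_degen_eq 2 isT isT (@Ordinal 3 2 isT)); vertex_cases.
Qed.

Definition family_of : skew_family n :=
  SkewFamily restr1 (fun p q r => restr2 p q r) (fun p q r s => restr3 p q r s).

Lemma family_of_coherent : coherent family_of.
Proof.
split=> [p|p q r pq qr|p q r pq qr|p q pq|p q pq|p q r s pq qr rs
  |p q r s pq qr rs|p q r pq qr|p q r pq qr|p q r pq qr|p q r s t pq qr rs st] /=.
- exact: restr1_degen.
- by rewrite s2_dom; have [-> _ ->] := restr2_face pq qr.
- by rewrite s2_cod; have [_ -> _] := restr2_face pq qr.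
- by have [-> _] := restr2_degen pq.
- by have [_ ->] := restr2_degen pq.
- rewrite s3_src; have [-> _ -> ->] := restr3_face pq qr rs.
  by have [_ _ ->] := restr2_face pq qr.
- rewrite s3_tgt; have [-> -> _ ->] := restr3_face pq qr rs.
  by have [-> _ _] := restr2_face qr rs.
- by have [-> _ _] := restr3_degen pq qr.
- by have [_ -> _] := restr3_degen pq qr.
- by have [_ _ ->] := restr3_degen pq qr.
have pr := leq_trans pq qr; have qs := leq_trans qr rs; have ps := leq_trans pr rs.
have rt := leq_trans rs st; have qt := leq_trans qr rt.
have := s4_pentagon (restr4 p q r s t).
have [-> -> -> -> ->] := restr4_face pq qr rs st; rewrite /pentagon.
have [-> _ _ _] := restr3_face qr rs st.
have [-> _ _ ->] := restr3_face pq qr rs.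
have [_ -> _ _] := restr3_face pq qs st.
have [_ _ -> _] := restr3_face pq qr rt.
have [-> _ ->] := restr2_face pq qr.
have [-> _ _] := restr2_face qr rs.
by have [-> _ _] := restr2_face rs st.
Qed.

End FamilyOf.

(** * The simplicial functor of a coherent family *)

Lemma enum_pairwise n : pairwise (fun i j : 'I_n.+1 => i < j) (enum 'I_n.+1).
Proof.
have := iota_ltn_sorted 0 n.+1; rewrite -val_enum_ord sorted_map.
by rewrite sorted_pairwise // => ? ? ?; apply: ltn_trans.
Qed.

Section ChainCells.

Variables (n : nat) (X : skew_family n) (cX : coherent X) (p q : 'I_n.+1).
Variables (k : nat) (c : chain p q k).

Implicit Types i j l m : 'I_k.+1.

Notation mem i := (fun t : 'I_n.+1 => t \in c i).
Notation ords := (enum 'I_n.+1).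

Definition chain_obj i := path_obj X q (mem i) p ords.
Definition chain_mor i j := bracket X q (mem i) (mem j) p p ords.
Definition chain_cell i j l := rebracket X q (mem i) (mem j) (mem l) p p p ords.

Lemma chain_sub i j : i <= j -> subpred (mem j) (mem i).
Proof. by move=> ij t; apply/subsetP: t; apply: chain_anti. Qed.

Lemma chain_sorted i : sorted_to q (mem i) p ords.
Proof.
apply: sorted_toI => [||t _].
- exact: enum_pairwise.
- by have /andP[] := chain_range (chain_right c ord0).
- exact: chain_range.
Qed.

Lemma dom_chain_mor i j : i <= j -> dom1 (chain_mor i j) = chain_obj i.
Proof.
move=> ij; rewrite (dom_bracket cX) ?(obj_refl cX) //; first exact: chain_sub.
exact: chain_sorted.
Qed.

Lemma cod_chain_mor i j : i <= j -> cod1 (chain_mor i j) = chain_obj j.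
Proof.
by move=> ij; rewrite (cod_bracket cX) //; [exact: chain_sub|exact: chain_sorted].
Qed.

Lemma chain_mor_refl i : chain_mor i i = id1 (chain_obj i).
Proof. by rewrite /chain_mor (bracket_refl cX) //; apply: chain_sorted. Qed.

Lemma chain_cell_refll i l : i <= l -> chain_cell i i l = id2 (chain_mor i l).
Proof.
by move=> il; apply: (rebracket_refll cX) => //; [exact: chain_sub|exact: chain_sorted].
Qed.

Lemma chain_cell_reflr i j : i <= j -> chain_cell i j j = id2 (chain_mor i j).
Proof.
by move=> il; apply: (rebracket_reflr cX) => //; [exact: chain_sub|exact: chain_sorted].
Qed.

Lemma chain_composable i j l : i <= j -> j <= l ->
  cod1 (chain_mor i j) = dom1 (chain_mor j l).
Proof. by move=> ij jl; rewrite cod_chain_mor // dom_chain_mor. Qed.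

Lemma src_chain_cell i j l : i <= j -> j <= l ->
  src (chain_cell i j l) = chain_mor j l \o1 chain_mor i j.
Proof.
move=> ij jl; rewrite (src_rebracket cX) ?(obj_refl cX) ?prodI1 //; try exact: chain_sub.
exact: chain_sorted.
Qed.

Lemma dom_chain_cell i j l : i <= j -> j <= l ->
  dom1 (src (chain_cell i j l)) = chain_obj i.
Proof.
move=> ij jl; rewrite src_chain_cell // dom1_comp ?dom_chain_mor //.
by rewrite cod_chain_mor.
Qed.

Lemma cod_chain_cell i j l : i <= j -> j <= l ->
  cod1 (src (chain_cell i j l)) = chain_obj l.
Proof.
move=> ij jl; rewrite src_chain_cell // cod1_comp ?cod_chain_mor //.
by rewrite dom_chain_mor.
Qed.

Lemma tgt_chain_cell i j l : i <= j -> j <= l ->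
  tgt (chain_cell i j l) = chain_mor i l.
Proof.
move=> ij jl; have il := leq_trans ij jl.
have ci := chain_sorted i.
rewrite (tgt_rebracket cX) //; try exact: chain_sub.
rewrite (mor_idl cX) // (obj_refl cX) prod1_id comp1I //.
exact: dom_chain_mor.
Qed.

(** This is [cocycleP] with every accumulator empty at [p], where all members of the chain begin;
    the fifth cell is then an identity and is removed by [vcompIl]. *)
Lemma chain_cocycle i j l m : i <= j -> j <= l -> l <= m ->
  chain_cell i j m \v (chain_cell j l m \o2 id2 (chain_mor i j)) =
  chain_cell i l m \v (id2 (chain_mor l m) \o2 chain_cell i j l).
Proof.
move=> ij jl lm; have il := leq_trans ij jl; have jm := leq_trans jl lm.
have im := leq_trans il lm.
have one p' : el (obj X p' p') (id2 (id1 [::])) by rewrite /el /= (obj_refl cX).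
have ione : is_id2 (id2 (id1 [::])) by constructor.
have := cocycleP cX (chain_sub ij) (chain_sub jl) (chain_sub lm) (leqnn p)
  (leqnn p) (leqnn p) (chain_sorted i) (one p) (one p) (one p) ione ione ione.
have hz : id2 (id1 (path_obj X q (mem i) p ords)) = id1 (chain_obj i) by [].
rewrite /= !hz (mor_app_one cX) // (asc_app_id3 cX) // (mor_app_one cX) //
  /rebracket_app /bracket_app !prod2Il.
rewrite -/(chain_mor i j) -/(chain_mor l m) -/(chain_mor i m).
rewrite -/(chain_cell i j m) -/(chain_cell j l m) -/(chain_cell i l m)
  -/(chain_cell i j l).
rewrite !(hcompI (A := chain_obj i)) //; try by
  rewrite /= ?dom_chain_cell ?dom_chain_mor.
move=> ->; rewrite vcompIl //.
rewrite tgt_vcomp ?tgt_chain_cell //.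
by rewrite tgt_happ ?tgt_id2 ?tgt_chain_cell ?src_chain_cell // /el
  cod_chain_cell // dom_chain_mor.
Qed.

Definition chain_duskin2 i j l (ij : i <= j) (jl : j <= l) : duskin2 :=
  Duskin2 (chain_composable ij jl) (src_chain_cell ij jl) (tgt_chain_cell ij jl).

Definition chain_duskin3 i j l m (ij : i <= j) (jl : j <= l) (lm : l <= m) :
    duskin3.
Proof.
exists (chain_duskin2 jl lm) (chain_duskin2 (leq_trans ij jl) lm)
  (chain_duskin2 ij (leq_trans jl lm)) (chain_duskin2 ij jl).
- by [].
- exact: chain_cocycle.
Defined.

End ChainCells.

(** * Simplices of the mapping object attached to chains *)

Section ChainSimplex.

Variables (n : nat) (X : skew_family n) (cX : coherent X).

Implicit Types p q r : 'I_n.+1.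

Lemma inord_mono l k (g : simplex_map l k) a b : a <= b <= l ->
  g (inord a) <= g (inord b).
Proof.
by case/andP=> ab bl; apply: smap_mono; rewrite !inordK // ltnS (leq_trans ab).
Qed.

(** Vertices are named by numerals through [inord], so the order conditions between them are closed
    by [isT]. Above dimension 3 [duskin_simplex] is [unit] and the last clause is a filler. *)
Definition chain_value p q k (c : chain p q k) (l : nat) :
    simplex_map l k -> duskin_simplex l :=
  match l with
  | 0 => fun g => chain_obj X c (g (inord 0))
  | 1 => fun g => chain_mor X c (g (inord 0)) (g (inord 1))
  | 2 => fun g => chain_duskin2 cX c (@inord_mono _ _ g 0 1 isT)
                    (@inord_mono _ _ g 1 2 isT)
  | 3 => fun g => chain_duskin3 cX c (@inord_mono _ _ g 0 1 isT)
                    (@inord_mono _ _ g 1 2 isT) (@inord_mono _ _ g 2 3 isT)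
  | _ => fun _ => tt
  end.

Lemma lift_inord l (i : 'I_l.+2) a : a < l.+1 ->
  lift i (inord a : 'I_l.+1) = inord (bump i a).
Proof.
move=> al; apply: val_inj; rewrite /= !inordK //.
by rewrite /bump; case: (i <= a); rewrite ?add1n ?add0n // ltnW.
Qed.

Lemma codegen_inord l (i : 'I_l.+1) a : a < l.+2 ->
  codegen i (inord a : 'I_l.+2) = inord (unbump i a).
Proof.
move=> al; apply: val_inj; rewrite /= !inordK //.
by have := unbump_ord i (Ordinal al).
Qed.

Section Values.

Variables (p q : 'I_n.+1) (k : nat) (c : chain p q k).

Lemma chain_duskin2_eq i j l i' j' l' ij jl ij' jl' :
  i = i' -> j = j' -> l = l' ->
  @chain_duskin2 n X cX p q k c i j l ij jl =
  @chain_duskin2 n X cX p q k c i' j' l' ij' jl'.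
Proof. by move=> ? ? ?; subst; apply: duskin2_eq. Qed.

Lemma chain_duskin2_degen0 i j ii ij :
  @chain_duskin2 n X cX p q k c i i j ii ij = duskin1_degen 0 (chain_mor X c i j).
Proof.
apply: duskin2_eq => //=; first by rewrite chain_mor_refl ?dom_chain_mor.
exact: chain_cell_refll.
Qed.

Lemma chain_duskin2_degen1 i j jj ij :
  @chain_duskin2 n X cX p q k c i j j ij jj = duskin1_degen 1 (chain_mor X c i j).
Proof.
apply: duskin2_eq => //=; first by rewrite chain_mor_refl ?cod_chain_mor.
exact: chain_cell_reflr.
Qed.

Lemma chain_value_face l (h : l < 3) (i : 'I_l.+2) (g : simplex_map l.+1 k) :
  chain_value c (smap_comp g (coface i)) = duskin_face h i (chain_value c g).
Proof.
case: l h i g => [|[|[|l]]] // h [i hi] g.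
- have g01 := @inord_mono _ _ g 0 1 isT.
  rewrite /= lift_inord //; case: i hi => [|[|i]] // hi.
    by rewrite /duskin1_face (cod_chain_mor cX).
  by rewrite /duskin1_face (dom_chain_mor cX).
- by rewrite /= !lift_inord //; case: i hi => [|[|[|i]]].
- case: i hi => [|[|[|[|i]]]] // hi; apply: chain_duskin2_eq;
  by rewrite /= lift_inord.
Qed.

Lemma smap_codegen_inord l (i : 'I_l.+1) (g : simplex_map l k) a : a < l.+2 ->
  smap_comp g (codegen i) (inord a) = g (inord (unbump i a)).
Proof. by move=> al; congr (g _); apply: codegen_inord. Qed.

Lemma chain_value_degen l (h : l < 3) (i : 'I_l.+1) (g : simplex_map l k) :
  chain_value c (smap_comp g (codegen i)) = duskin_degen h i (chain_value c g).
Proof.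
case: l h i g => [|[|[|l]]] // h [i hi] g.
- rewrite /chain_value !smap_codegen_inord //; case: i hi => // hi.
  exact: chain_mor_refl.
- case: i hi => [|[|i]] // hi.
  + apply: etrans (chain_duskin2_degen0 (leqnn _) (@inord_mono _ _ g 0 1 isT)).
    by apply: chain_duskin2_eq; rewrite smap_codegen_inord.
  + apply: etrans (chain_duskin2_degen1 (leqnn _) (@inord_mono _ _ g 0 1 isT)).
    by apply: chain_duskin2_eq; rewrite smap_codegen_inord.
- have ge a : a < 4 ->
    smap_comp g (codegen (Ordinal hi)) (inord a) = g (inord (unbump i a)).
    by move=> a4; apply: smap_codegen_inord.
  have g01 := @inord_mono _ _ g 0 1 isT; have g12 := @inord_mono _ _ g 1 2 isT.
  have g02 := @inord_mono _ _ g 0 2 isT.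
  have d0 a b j j' l ij jl : j = j' -> g (inord a) = j -> g (inord b) = l ->
      @chain_duskin2 n X cX p q k c j j' l ij jl =
      duskin1_degen 0 (chain_mor X c (g (inord a)) (g (inord b))).
    by move=> ? ? ?; subst; apply: chain_duskin2_degen0.
  have d1 a b j l l' ij jl : l = l' -> g (inord a) = j -> g (inord b) = l ->
      @chain_duskin2 n X cX p q k c j l l' ij jl =
      duskin1_degen 1 (chain_mor X c (g (inord a)) (g (inord b))).
    by move=> ? ? ?; subst; apply: chain_duskin2_degen1.
  case: i hi ge => [|[|[|i]]] // hi /= ge; apply: duskin3_eq => -[|[|[|a]]] /=.
  all: first [by apply: chain_duskin2_eq; rewrite !ge
    | by apply: d0; rewrite !ge | by apply: d1; rewrite !ge].
Qed.

Definition chain_simplex : duskin_nerve_Cat k :=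
  @CoskeletonSimplex 3 duskin_truncation k (fun l _ g => chain_value c g)
    chain_value_face chain_value_degen.

End Values.

Section Split.

Variables (p q r : 'I_n.+1) (k : nat) (c : chain p q k) (d : chain q r k).
Implicit Types i j m : 'I_k.+1.

Notation ords := (enum 'I_n.+1).

(** Elements of [c] are at most [q] and those of [d] at least [q]. Hence the list of all positions
    can be cut at [q] so that each chain is empty on one side, and [q] is common to all members of
    the union. *)
Variant union_spec : Prop :=
  UnionSpec l1 l2 of ords = l1 ++ q :: l2
    & (forall i, {in l1, (fun t => t \in d i) =1 xpred0})
    & (forall i, {in l2, (fun t => t \in c i) =1 xpred0}).

Lemma unionP : union_spec.
Proof.
have [l1 [l2 e]] : exists l1 l2, ords = l1 ++ q :: l2.
  by case/splitPr: (mem_enum predT q) => l1 l2; exists l1, l2.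
have := enum_pairwise n; rewrite e pairwise_cat =>
  /and3P[/allrelP l12 _ /andP[/allP l2q _]].
exists l1 l2 => // i t tl; apply/negP => /chain_range/andP[h h'].
- by have := l12 _ _ tl (mem_head _ _); rewrite ltnNge h.
- by have := l2q _ tl; rewrite ltnNge h'.
Qed.

Lemma chain_obj_union i :
  chain_obj X (chain_union c d) i = chain_obj X c i ++ chain_obj X d i.
Proof.
case: unionP => l1 l2 e d0 c0; rewrite /chain_obj e.
have qc := chain_right c i; have qd := chain_left d i.
rewrite !path_obj_split ?inE ?qc //.
rewrite (path_obj_nil _ _ _ (c0 i)) (path_obj_nil _ _ _ (d0 i)) (obj_refl cX) cats0.
congr (_ ++ _); apply: path_obj_eq => t tl; rewrite inE.
  by rewrite [t \in d i]d0 ?orbF.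
by rewrite [t \in c i]c0.
Qed.

Lemma chain_mor_union i j : i <= j ->
  chain_mor X (chain_union c d) i j = chain_mor X c i j \x1 chain_mor X d i j.
Proof.
move=> ij.
have sU := chain_sorted (chain_union c d) i; have sc := chain_sorted c i.
have sd := chain_sorted d i; have uU := chain_sub (c := chain_union c d) ij.
have uc := chain_sub (c := c) ij; have ud := chain_sub (c := d) ij.
move: sU sc sd; case: unionP => l1 l2 e d0 c0; rewrite /chain_mor e => sU sc sd.
have qc := chain_right c; have qd := chain_left d.
(* The brackets of [c] and of [d] are cut at [q] as well; their surplus factors, of [c] after [q]
   and of [d] before [q], are units. *)
rewrite (bracket_split cX uU) ?inE ?qc // (bracket_split cX uc) // (bracket_split cX ud)
  //.
rewrite (bracket_nil _ _ _ _ _ (c0 i)) (bracket_nil _ _ _ _ _ (d0 i)) !(mor_idl cX) //.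
rewrite (obj_refl cX) prod1I prodI1.
congr (_ \x1 _); apply: bracket_eq => t tl; rewrite inE.
- by rewrite [t \in d i]d0 ?orbF.
- by rewrite [t \in d j]d0 ?orbF.
- by rewrite [t \in c i]c0.
- by rewrite [t \in c j]c0.
Qed.

Lemma chain_cell_union i j (l : 'I_k.+1) : i <= j -> j <= l ->
  chain_cell X (chain_union c d) i j l =
  chain_cell X c i j l \x2 chain_cell X d i j l.
Proof.
move=> ij jl.
have sU := chain_sorted (chain_union c d) i; have sc := chain_sorted c i.
have sd := chain_sorted d i; have uU := chain_sub (c := chain_union c d) ij.
have uc := chain_sub (c := c) ij; have ud := chain_sub (c := d) ij.
have uU' := chain_sub (c := chain_union c d) jl.
have uc' := chain_sub (c := c) jl; have ud' := chain_sub (c := d) jl.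
move: sU sc sd; case: unionP => l1 l2 e d0 c0; rewrite /chain_cell e => sU sc sd.
have qc := chain_right c; have qd := chain_left d.
rewrite (rebracket_split cX uU uU') ?inE ?qc // (rebracket_split cX uc uc') //.
rewrite (rebracket_split cX ud ud') //.
rewrite (rebracket_nil _ _ _ _ _ _ _ (c0 i)) (rebracket_nil _ _ _ _ _ _ _ (d0 i)).
rewrite !(asc_id1 cX) // !(mor_idl cX) // (obj_refl cX) prod2I prod2Il.
congr (_ \x2 _); apply: rebracket_eq => t tl; rewrite inE.
- by rewrite [t \in d i]d0 ?orbF.
- by rewrite [t \in d j]d0 ?orbF.
- by rewrite [t \in d l]d0 ?orbF.
- by rewrite [t \in c i]c0.
- by rewrite [t \in c j]c0.
- by rewrite [t \in c l]c0.
Qed.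

Lemma chain_duskin2_union i j l ij jl :
  chain_duskin2 cX (chain_union c d) ij jl =
  duskin2_prod (@chain_duskin2 n X cX p q k c i j l ij jl)
    (chain_duskin2 cX d ij jl).
Proof.
apply: duskin2_eq; rewrite /= ?chain_mor_union ?chain_cell_union //.
exact: leq_trans jl.
Qed.

Lemma chain_simplex_union :
  chain_simplex (chain_union c d) = duskin_comp (chain_simplex c) (chain_simplex d).
Proof.
apply: coskeleton_simplex_eq => -[|[|[|[|l]]]] // h g /=.
- exact: chain_obj_union.
- by rewrite chain_mor_union // inord_mono.
- exact: chain_duskin2_union.
- by apply: duskin3_eq => -[|[|[|i]]]; apply: chain_duskin2_union.
Qed.

End Split.
Lemma chain_obj_id p i : chain_obj X (chain_id p) i = [::].
Proof.
rewrite /chain_obj; elim: (enum _) => [|t s IH] /=; first exact: obj_refl.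
by rewrite inE; case: eqP => [->|_] //; rewrite (obj_refl cX).
Qed.

Lemma chain_mor_id p i : chain_mor X (chain_id p) i i = id1 [::].
Proof. by rewrite chain_mor_refl // chain_obj_id. Qed.

Lemma chain_duskin2_id p i j l ij jl :
  @chain_duskin2 n X cX p p 0 (chain_id p) i j l ij jl = duskin_unit 2.
Proof.
have ji : j = i by rewrite !ord1.
have li : l = i by rewrite !ord1.
subst; rewrite -[RHS]/(duskin1_degen 0 (id1 [::])) -(chain_mor_id p i).
exact: chain_duskin2_degen0.
Qed.

Lemma chain_simplex_id p : chain_simplex (chain_id p) = duskin_id.
Proof.
apply: coskeleton_simplex_eq => -[|[|[|[|l]]]] // h g /=.
- exact: chain_obj_id.
- by rewrite (ord1 (g (inord 1))) (ord1 (g (inord 0))) chain_mor_id.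
- exact: chain_duskin2_id.
- by apply: duskin3_eq => -[|[|[|i]]]; apply: chain_duskin2_id.
Qed.

Definition coherent_functor : coherent_nerve N2_Cat n.
Proof.
exists (fun _ => tt) (fun p q k c => chain_simplex c).
- move=> p q k l f c; apply: coskeleton_simplex_eq => -[|[|[|[|j]]]] // h g.
  + exact: duskin2_eq.
  + by apply: duskin3_eq => -[|[|[|i]]]; apply: duskin2_eq.
- exact: chain_simplex_id.
- by move=> p q r k c d; apply: chain_simplex_union.
Defined.

End ChainSimplex.

(** * Naturality and injectivity *)

Lemma family_of_act m n (f : simplex_map m n) (x : skew_nerve_Cat n) :
  family_of (act f x) = pull f (family_of x).
Proof.
have ev k (h h' : k <= 4) (g g' : simplex_map k n) : g =1 g' ->
    cosk_fun (x : coskeleton_simplex skew_truncation n) h g = cosk_fun x h' g'.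
  by move=> /simplex_map_eq ->; rewrite (bool_irrelevance h h').
rewrite /family_of /pull /=; congr SkewFamily.
- apply: funext => p; apply: funext => q.
  by apply: (ev 1 _ _ _ (vertices (f p) [:: f q])) => i; exact:
    (@smap_vertices _ _ f p [:: q]).
- apply: funext => p; apply: funext => q; apply: funext => r; congr s2_map.
  by apply: (ev 2 _ _ _ (vertices (f p) [:: f q; f r])) => i;
  exact: (@smap_vertices _ _ f p [:: q; r]).
- apply: funext => p; apply: funext => q; apply: funext => r; apply: funext => s.
  congr s3_map; apply: (ev 3 _ _ _ (vertices (f p) [:: f q; f r; f s])) => i.
  exact: (@smap_vertices _ _ f p [:: q; r; s]).
Qed.

(** * Values of the brackets on flags *)

Section Flags.
Variables (n : nat) (X : skew_family n) (cX : coherent X).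

(** With [c] and [d] equal the associator [asc X e c c t] is an identity, and only the resets at [t]
    remain. *)
Lemma rebracket_cons_id (q : 'I_n.+1) D C E (e c t : 'I_n.+1) s : subpred C D -> subpred
  E C -> e <= c -> c <= t ->
  sorted_to q D t s -> D t ->
  rebracket X q D C E e c c (t :: s) = rebracket_at X q D C E e c t s.
Proof.
move=> DC CE ec ct ts Dt; have et := leq_trans ec ct.
have DE : subpred E D by move=> x /CE /DC.
have R : rebracket_at_typing X q D C E e c t s.
  by apply: (rebracket_at_typingP cX) => // *; apply: (rebracket_typingP cX).
have tm := composable_rebracket cX DC CE ec (leqnn c) ct ts Dt R; have [dR cR _ _] := R.
move: tm; rewrite rebracket_cons // (mor_idl cX) // !prod1_id hcompI //.
rewrite (asc_id2 cX) // prod2_id hcomp_id2; last first.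
  by rewrite /= (cod_mor cX) // (dom_bracket_at cX).
by move=> tm; rewrite vcompIl.
Qed.

Variables (a b c d : 'I_n.+1).
Hypotheses (ab : a <= b) (bc : b <= c) (cd : c <= d).

Lemma path_obj_flag (D : 'I_n.+1 -> bool) : D a -> D b ->
  path_obj X b D a [:: a; b] = obj X a b.
Proof. by move=> Da Db; rewrite /= Da Db !(obj_refl cX) cats0. Qed.

Lemma bracket_flag (D C : 'I_n.+1 -> bool) : subpred C D ->
  D b -> C a -> C c -> C b = false -> bracket X c D C a a [:: a; b; c] = mor X a b c.
Proof.
move=> DC Db Ca Cc Cb; have Da := DC _ Ca; have Dc := DC _ Cc.
have s1 : sorted_to c D a [:: b; c] by rewrite /= Db Dc ab bc leqnn.
have s2 : sorted_to c D b [:: c] by rewrite /= Dc bc leqnn.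
rewrite (bracket_head cX) // (bracket_at_refl cX) (bracket_cons_id cX) // /bracket_at Cb.
rewrite (bracket_split cX DC Cc ab (s1 := [::])) //=.
by rewrite (mor_idl cX) // (obj_refl cX) prod1I.
Qed.

(** Reading [b] resets only the middle position, to [b]; reading [c] moves only the last one, to
    [c]; reading [d] then produces [asc X a b c d]. The associators met earlier have a repeated
    index and are identities. *)
Lemma rebracket_flag (D C E : 'I_n.+1 -> bool) : subpred C D -> subpred E C ->
  D c -> C b -> C c = false -> E a -> E d -> E b = false -> E c = false ->
  rebracket X d D C E a a a [:: a; b; c; d] = asc X a b c d.
Proof.
move=> DC CE Dc Cb Cc Ea Ed Eb Ec.
have Ca := CE _ Ea; have Cd := CE _ Ed.
have Da := DC _ Ca; have Db := DC _ Cb; have Dd := DC _ Cd.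
have ac := leq_trans ab bc.
have s1 : sorted_to d D a [:: b; c; d] by rewrite /= Db Dc Dd ab bc cd leqnn.
have s2 : sorted_to d D b [:: c; d] by rewrite /= Dc Dd bc cd leqnn.
have s3 : sorted_to d D c [:: d] by rewrite /= Dd cd leqnn.
rewrite (rebracket_head cX) // (rebracket_at_refl cX) // rebracket_cons_id //
  /rebracket_at Eb Cb.
rewrite rebracket_cons_id // /rebracket_at Ec Cc.
rewrite (mor_idl cX) // prod1_id hcompI; last first.
  by rewrite (dom_rebracket cX) //= Dc.
rewrite (rebracket_split cX DC CE Ed ab bc (s1 := [::])) //=.
by rewrite (asc_id1 cX) // (mor_idl cX) // (obj_refl cX) prod2I.
Qed.

End Flags.

(** For [n = k.+1] and [k <= 2] this is the chain {0,n} \subset ... \subset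
    {0,...,n} used to read off the value of a family at (0,...,n). *)
Definition flag n k : chain (ord0 : 'I_n.+1) ord_max k.
Proof.
exists (fun i : 'I_k.+1 => [set x : 'I_n.+1 | (x == ord0) || (x == ord_max) ||
  (x + i < n)]).
- by move=> i x _; rewrite leq0n -ltnS /=.
- by move=> i; rewrite inE eqxx.
- by move=> i; rewrite inE eqxx orbT.
- move=> i j ij; apply/subsetP => x; rewrite !inE => /orP[->//|h].
  by rewrite (leq_ltn_trans _ h) ?leq_add2l ?orbT.
Defined.

(** * The map and its naturality *)

Definition beta_fun n (x : skew_nerve_Cat n) : coherent_nerve N2_Cat n :=
  coherent_functor (family_of_coherent x).

Lemma direct_imageE m n (f : simplex_map m n) (S : {set 'I_m.+1}) :
  direct_image f (fun t => t \in S) (enum 'I_m.+1) =1 (fun w => w \in f @: S).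
Proof.
move=> w; apply/hasP/imsetP => [[t _ /andP[tS /eqP<-]]|[t tS ->]].
  by exists t.
by exists t; rewrite ?mem_enum // tS eqxx.
Qed.

Section ChainPull.

Variables (m n : nat) (f : simplex_map m n) (X : skew_family n) (cX : coherent X).
Variables (p q : 'I_m.+1) (k : nat) (c : chain p q k).

Implicit Types i j l : 'I_k.+1.

Lemma chain_obj_pull i :
  chain_obj (pull f X) c i = chain_obj X (chain_image f c) i.
Proof.
have all_ords (D : 'I_m.+1 -> bool) x : x \in enum 'I_m.+1 -> D x ->
  f x \in enum 'I_n.+1 by rewrite !mem_enum.
rewrite /chain_obj (path_obj_pull cX (enum_pairwise n) (@all_ords _) (chain_sorted c i))
  //.
by apply: path_obj_eq => w _; apply: direct_imageE.
Qed.

Lemma chain_mor_pull i j : i <= j ->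
  chain_mor (pull f X) c i j = chain_mor X (chain_image f c) i j.
Proof.
move=> ij.
have all_ords (D : 'I_m.+1 -> bool) x : x \in enum 'I_m.+1 -> D x ->
  f x \in enum 'I_n.+1 by rewrite !mem_enum.
rewrite /chain_mor (bracket_pull cX (chain_sub ij) (leqnn p) (enum_pairwise n)
  (@all_ords _) (chain_sorted c i)).
by apply: bracket_eq => w _; apply: direct_imageE.
Qed.

Lemma chain_cell_pull i j l : i <= j -> j <= l ->
  chain_cell (pull f X) c i j l = chain_cell X (chain_image f c) i j l.
Proof.
move=> ij jl.
have all_ords (D : 'I_m.+1 -> bool) x : x \in enum 'I_m.+1 -> D x ->
  f x \in enum 'I_n.+1 by rewrite !mem_enum.
rewrite /chain_cell (rebracket_pull cX (chain_sub ij) (chain_sub jl) (leqnn p) (leqnn p)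
  (enum_pairwise n) (@all_ords _) (chain_sorted c i)).
by apply: rebracket_eq => w _; apply: direct_imageE.
Qed.

End ChainPull.

Lemma beta_act m n (f : simplex_map m n) (x : skew_nerve_Cat n) :
  beta_fun (act f x) = act f (beta_fun x).
Proof.
apply: simplicial_functor_eq => p q k c; apply: coskeleton_simplex_eq.
have e2 i j l ij jl : chain_duskin2 (family_of_coherent (act f x)) c ij jl =
    @chain_duskin2 n _ (family_of_coherent x) _ _ _ (chain_image f c) i j l ij jl.
  have cX := family_of_coherent x; apply: duskin2_eq;
    rewrite /= family_of_act ?chain_mor_pull ?chain_cell_pull //.
  exact: leq_trans jl.
move=> -[|[|[|[|l]]]] // h g.
- by rewrite /= family_of_act (chain_obj_pull _ (family_of_coherent x)).
- by rewrite /= family_of_act (chain_mor_pull _ (family_of_coherent x)) // inord_mono.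
- exact: e2.
- by apply: duskin3_eq => -[|[|[|i]]]; apply: e2.
Qed.

Definition beta : simplicial_map skew_nerve_Cat (coherent_nerve N2_Cat) :=
  SimplicialMap beta_act.

(** * Recovery of a simplex from its values on flags *)

Lemma enum_ord2 : enum 'I_2 = [:: ord0; ord_max].
Proof. by apply: (inj_map val_inj); rewrite val_enum_ord. Qed.

Lemma enum_ord3 : enum 'I_3 = [:: ord0; inord 1; ord_max].
Proof. by apply: (inj_map val_inj); rewrite val_enum_ord /= inordK. Qed.

Lemma enum_ord4 : enum 'I_4 = [:: ord0; inord 1; inord 2; ord_max].
Proof. by apply: (inj_map val_inj); rewrite val_enum_ord /= !inordK. Qed.

Lemma chain_obj_flag (X : skew_family 1) i : coherent X ->
  chain_obj X (flag 1 0) i = obj X ord0 ord_max.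
Proof.
by move=> cX; rewrite /chain_obj enum_ord2 path_obj_flag // inE eqxx ?orbT.
Qed.

Lemma chain_mor_flag (X : skew_family 2) : coherent X ->
  chain_mor X (flag 2 1) (inord 0) (inord 1) = mor X ord0 (inord 1) ord_max.
Proof.
move=> cX; rewrite /chain_mor enum_ord3 bracket_flag //.
all: try by apply: chain_sub; rewrite !inordK.
all: by rewrite ?inE -?val_eqE /= ?inordK.
Qed.

Lemma chain_cell_flag (X : skew_family 3) : coherent X ->
  chain_cell X (flag 3 2) (inord 0) (inord 1) (inord 2) =
  asc X ord0 (inord 1) (inord 2) ord_max.
Proof.
move=> cX; rewrite /chain_cell enum_ord4 rebracket_flag //.
all: try by apply: chain_sub; rewrite !inordK.
all: by rewrite ?inE -?val_eqE /= ?inordK.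
Qed.

Section Injectivity.

Variables (n : nat) (x y : skew_nerve_Cat n).
Hypothesis beta_xy : beta_fun x = beta_fun y.

Implicit Types p q r s : 'I_n.+1.

Let X := family_of x.
Let Y := family_of y.

(** Naturality restricts the problem along the edge from [p] to [q], that is to a 1-simplex, where
    the flag reads off the single category. The next two lemmas do the same with triangles and
    tetrahedra. *)
Lemma beta_obj p q : p <= q -> obj X p q = obj Y p q.
Proof.
move=> pq; have := congr1 (act (vertices p [:: q])) beta_xy; rewrite -!beta_act.
pose ev (F : coherent_nerve N2_Cat 1) : seq category :=
  cosk_fun (sfhom F (flag 1 0) : coskeleton_simplex duskin_truncation 0)
    (isT : 0 <= 3) (smap_id 0).
move/(congr1 ev); rewrite /ev /= !chain_obj_flag; try exact: family_of_coherent.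
by rewrite !family_of_act /pull /obj !verticesE /= ?pq.
Qed.

Lemma beta_mor p q r : p <= q -> q <= r -> mor X p q r = mor Y p q r.
Proof.
move=> pq qr; have := congr1 (act (vertices p [:: q; r])) beta_xy.
rewrite -!beta_act.
pose ev (F : coherent_nerve N2_Cat 2) : cell1 :=
  cosk_fun (sfhom F (flag 2 1) : coskeleton_simplex duskin_truncation 1)
    (isT : 1 <= 3) (smap_id 1).
move/(congr1 ev); rewrite /ev /= !chain_mor_flag; try exact: family_of_coherent.
by rewrite !family_of_act /pull /mor !verticesE ?inordK //= ?pq ?qr.
Qed.

Lemma beta_asc p q r s : p <= q -> q <= r -> r <= s ->
  asc X p q r s = asc Y p q r s.
Proof.
move=> pq qr rs; have := congr1 (act (vertices p [:: q; r; s])) beta_xy.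
rewrite -!beta_act.
pose ev (F : coherent_nerve N2_Cat 3) : cell2 :=
  d2_map (cosk_fun (sfhom F (flag 3 2) : coskeleton_simplex duskin_truncation 2)
    (isT : 2 <= 3) (smap_id 2)).
move/(congr1 ev); rewrite /ev /= !chain_cell_flag; try exact: family_of_coherent.
by rewrite !family_of_act /pull /asc !verticesE ?inordK //= ?pq ?qr ?rs.
Qed.

Lemma beta_restr2 p q r : p <= q -> q <= r -> restr2 x p q r = restr2 y p q r.
Proof.
move=> pq qr; have pr := leq_trans pq qr.
have [e1 e2 e3] := restr2_face x pq qr; have [f1 f2 f3] := restr2_face y pq qr.
apply: skew2_eq; rewrite ?(e1, e2, e3) ?(f1, f2, f3).
- exact: beta_obj.
- exact: beta_obj.
- exact: beta_obj.
- exact: beta_mor.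
Qed.

Lemma beta_restr3 p q r s : p <= q -> q <= r -> r <= s -> restr3 x p q r s = restr3 y p
  q r s.
Proof.
move=> pq qr rs; have pr := leq_trans pq qr; have qs := leq_trans qr rs.
have [e1 e2 e3 e4] := restr3_face x pq qr rs.
have [f1 f2 f3 f4] := restr3_face y pq qr rs.
apply: skew3_eq; rewrite ?(e1, e2, e3, e4) ?(f1, f2, f3, f4).
- exact: beta_restr2.
- exact: beta_restr2.
- exact: beta_restr2.
- exact: beta_restr2.
- exact: beta_asc.
Qed.

(** A 4-simplex carries no data beyond its five faces, since the pentagon is a proposition. *)
Lemma beta_restr4 p q r s (t : 'I_n.+1) : p <= q -> q <= r -> r <= s -> s <= t ->
  restr4 x p q r s t = restr4 y p q r s t.
Proof.
move=> pq qr rs st; have pr := leq_trans pq qr; have qs := leq_trans qr rs.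
have rt := leq_trans rs st.
have [e1 e2 e3 e4 e5] := restr4_face x pq qr rs st.
have [f1 f2 f3 f4 f5] := restr4_face y pq qr rs st.
by apply: skew4_eq => -[|[|[|[|i]]]] /=;
  rewrite ?(e1, e2, e3, e4, e5) ?(f1, f2, f3, f4, f5); apply: beta_restr3.
Qed.

Lemma beta_eq : x = y.
Proof.
apply: coskeleton_simplex_eq => -[|[|[|[|[|k]]]]] h f //;
  try rewrite (bool_irrelevance h isT).
- have unit_eq (a b : unit) : a = b by case: a b => -[].
  exact: unit_eq.
(* The values of a simplex map are already increasing, so passing to running maxima does not change
   them and [vertices] recovers [f]. *)
- have -> : f = vertices (f (inord 0)) [:: f (inord 1)].
    apply: simplex_map_eq => -[[|[|i]] hi] //; rewrite verticesE /= ?inord_mono //;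
    by congr (f _); apply: val_inj; rewrite /= inordK.
  by apply: beta_obj; apply: inord_mono.
- have -> : f = vertices (f (inord 0)) [:: f (inord 1); f (inord 2)].
    apply: simplex_map_eq => -[[|[|[|i]]] hi] //; rewrite verticesE /= ?inord_mono //;
    by congr (f _); apply: val_inj; rewrite /= inordK.
  by apply: beta_restr2; apply: inord_mono.
- have -> : f = vertices (f (inord 0)) [:: f (inord 1); f (inord 2); f (inord 3)].
    apply: simplex_map_eq => -[[|[|[|[|i]]]] hi] //; rewrite verticesE /= ?inord_mono //;
    by congr (f _); apply: val_inj; rewrite /= inordK.
  by apply: beta_restr3; apply: inord_mono.
- have -> : f = vertices (f (inord 0))
      [:: f (inord 1); f (inord 2); f (inord 3); f (inord 4)].
    apply: simplex_map_eq => -[[|[|[|[|[|i]]]]] hi] //; rewrite verticesE /= ?inord_mono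
      //;
    by congr (f _); apply: val_inj; rewrite /= inordK.
  by apply: beta_restr4; apply: inord_mono.
Qed.

End Injectivity.

Theorem proposition2p8 :
  exists beta : simplicial_map skew_nerve_Cat (coherent_nerve N2_Cat),
    monomorphism beta.
Proof.
exists beta; apply/monomorphismP => n x y; exact: beta_eq.
Qed.
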